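(* Let $n\ge 2$ and let $S$ be a $d$-set in $\mathbb{R}^n$ with $n-1<d<n$. Suppose that $1<p<\infty$, $1\le q\le\infty$, and $s>(n-d)/p$. Let $f\in F^{s}_{pq}(\mathbb{R}^n)$ be such that $\mathrm{Tr}_S f=0$ pointwise $\mathcal{H}^d$-almost everywhere on $S$. Then $f$ satisfies the Hardy type inequality \[ \bigg(\int_{\mathbb{R}^n}\frac{|f(x)|^p}{\mathrm{dist}(x,S)^{sp}}\,dx\bigg)^{1/p}\le c\,\|f\|_{F^s_{pq}(\mathbb{R}^n)} , \] where the constant $c>0$ depends on $n$, $d$, $p$, $s$, and $S$.
   Context: Distances in $\mathbb{R}^n$ are measured in the supremum norm. $Q(x,r)$ denotes the closed cube centered at $x\in\mathbb{R}^n$ with side length $2r$ and sides parallel to the coordinate axes. $\mathcal{H}^d$ is the $d$-dimensional Hausdorff measure. $d$-set: for $0<d\le n$, a closed set $S\subset\mathbb{R}^n$ is a $d$-set if there is a constant $C>1$ such that $C^{-1}r^d\le\mathcal{H}^d(Q(w,r)\cap S)\le Cr^d$ for every $w\in S$ and $0<r\le1$. Local approximation: $\mathcal{P}_{m}$ is the space of polynomials on $\mathbb{R}^n$ of degree at most $m$. For $f\in L^u_{\mathrm{loc}}(\mathbb{R}^n)$, $1\le u\le\infty$, an integer $k\ge 1$ and a cube $Q$, \[\mathcal{E}_k(f,Q)_{L^u(\mathbb{R}^n)}:=\inf_{P\in\mathcal{P}_{k-1}}\Big(\frac1{|Q|}\int_Q|f(x)-P(x)|^u\,dx\Big)^{1/u}.\]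 Triebel--Lizorkin space: let $s>0$, $1\le p<\infty$, $1\le q\le\infty$, let $k$ be an integer with $s<k$ and $1\le u\le\min\{p,q\}$. For $f\in L^u_{\mathrm{loc}}(\mathbb{R}^n)$ put $g(x):=\big(\int_0^1\big(t^{-s}\mathcal{E}_k(f,Q(x,t))_{L^u(\mathbb{R}^n)}\big)^q\frac{dt}{t}\big)^{1/q}$ if $q<\infty$, and $g(x):=\sup_{0<t\le1}t^{-s}\mathcal{E}_k(f,Q(x,t))_{L^u(\mathbb{R}^n)}$ if $q=\infty$. Then $f\in F^s_{pq}(\mathbb{R}^n)$ if $f,g\in L^p(\mathbb{R}^n)$, and $\|f\|_{F^s_{pq}(\mathbb{R}^n)}:=\|f\|_{L^p(\mathbb{R}^n)}+\|g\|_{L^p(\mathbb{R}^n)}$. Different admissible choices of $k$ and $u$ give equivalent norms; any fixed choice may be used. Trace: for locally integrable $f$, put $\bar f(x)=\lim_{r\to0+}\frac{1}{|Q(x,r)|}\int_{Q(x,r)}f(y)\,dy$ whenever the limit exists, and $\mathrm{Tr}_Sf(x):=\bar f(x)$ at those $x\in S$ where $\bar f(x)$ exists. If $f\in F^s_{pq}(\mathbb{R}^n)$ with $s>(n-d)/p$, $1<p<\infty$, $1\le q\le \infty$ and $S$ is a $d$-set with $n-1<d<n$, then $\mathrm{Tr}_Sf$ is defined $\mathcal{H}^d$-almost everywhere on $S$. *)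

(* Defs.v *)
From HB Require Import structures.
From mathcomp Require Import all_boot all_order all_algebra.
From mathcomp Require Import all_classical all_reals all_analysis.
From mathcomp Require Import measurable_realfun.
From mathcomp.multinomials Require Import -(notations) mpoly.

Set Implicit Arguments.
Unset Strict Implicit.
Unset Printing Implicit Defensive.
Import Order.TTheory GRing.Theory Num.Theory.
Import numFieldNormedType.Exports.

Local Open Scope classical_set_scope.
Local Open Scope ring_scope.

(* R^n is 'rV[R]_n, whose library norm and topology are those of the supremum
   norm. *)

Section lebesgue_outer.
Context {R : realType} {n : nat}.
Implicit Types (x : 'rV[R]_n) (ab : 'rV[R]_n * 'rV[R]_n) (A : set 'rV[R]_n).

Definition box ab : set 'rV[R]_n :=
  [set x | forall i, ab.1 0 i <= x 0 i <= ab.2 0 i].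

Definition box_volume ab : R := \prod_(i < n) Num.max 0 (ab.2 0 i - ab.1 0 i).

Definition box_covers A : set (set ('rV[R]_n * 'rV[R]_n)) :=
  [set B | countable B /\ A `<=` \bigcup_(ab in B) box ab].

Definition lebesgue_outer A : \bar R :=
  ereal_inf [set \esum_(ab in B) (box_volume ab)%:E | B in box_covers A].

Let volume_ge0 ab : (0 <= (box_volume ab)%:E)%E.
Proof.
by rewrite lee_fin; apply: prodr_ge0 => i _; rewrite le_max lexx.
Qed.

Lemma lebesgue_outer_ge0 A : (0 <= lebesgue_outer A)%E.
Proof.
by apply: le_ereal_inf_tmp => _ [B _ <-]; apply: esum_ge0 => ? _.
Qed.

Lemma lebesgue_outer0 : lebesgue_outer set0 = 0%E.
Proof.
apply/eqP; rewrite eq_le lebesgue_outer_ge0 andbT.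
apply: ereal_inf_lbound; exists set0; last by rewrite esum_set0.
by split=> //; exact: countable0.
Qed.

Lemma le_lebesgue_outer :
  {homo lebesgue_outer : A B / A `<=` B >-> (A <= B)%E}.
Proof.
move=> A B AB; apply: ereal_inf_le_tmp => _ [C [cC BC] <-].
by exists C => //; split => //; exact: subset_trans BC.
Qed.

Let esum_bigcup_le (B : nat -> set ('rV[R]_n * 'rV[R]_n)) :
  (\esum_(ab in \bigcup_k B k) (box_volume ab)%:E <=
   \sum_(k <oo) \esum_(ab in B k) (box_volume ab)%:E)%E.
Proof.
rewrite seqDU_bigcup_eq esum_bigcupT//.
rewrite nneseries_esumT; last by move=> k; apply: esum_ge0.
apply: le_esum => k _; apply: ereal_sup_le => _ [X [fX XB] <-].
exists X => //; split => //.
exact: subset_trans XB (@subset_seqDU _ _ _).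
Qed.

Lemma lebesgue_outer_sigma_subadditive : sigma_subadditive lebesgue_outer.
Proof.
move=> A.
have [[i ioo]|] := pselect (exists i, lebesgue_outer (A i) = +oo%E).
  rewrite (eseries_pinfty _ _ ioo) ?leey// => k _.
  by rewrite -ltNye (lt_le_trans _ (lebesgue_outer_ge0 _)).
rewrite -forallNE => Aoo.
apply/lee_addgt0Pr => e e0.
rewrite (le_trans _ (epsilon_trick _ _ (ltW e0)))//; last first.
  by move=> k; exact: lebesgue_outer_ge0.
pose P k B := box_covers (A k) B /\
  (\esum_(ab in B) (box_volume ab)%:E <=
   lebesgue_outer (A k) + (e / (2 ^ k.+1)%:R)%:E)%E.
have [G PG] : {G : nat -> set ('rV[R]_n * 'rV[R]_n) & forall k, P k (G k)}.
  apply: (@choice _ _ P) => k; rewrite /P.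
  have e1 : 0 < e / (2 ^ k.+1)%:R by rewrite divr_gt0// ltr0n expn_gt0.
  have fA : lebesgue_outer (A k) \is a fin_num.
    by rewrite ge0_fin_numE ?lebesgue_outer_ge0// ltey; apply/eqP/Aoo.
  have [_ [B BA <-] /ltW BAe] := lb_ereal_inf_adherent e1 fA.
  by exists B; split.
apply: (@le_trans _ _ (\esum_(ab in \bigcup_k G k) (box_volume ab)%:E)%E).
  apply: ereal_inf_lbound; exists (\bigcup_k G k) => //; split.
    by apply: bigcup_countable => // k _; have [[]] := PG k.
  move=> x [k _ /((PG k).1.2)[ab Gab abx]].
  by exists ab => //; exists k.
apply: (le_trans (esum_bigcup_le G)).
apply: lee_nneseries => k _; first by move=> _; apply: esum_ge0 => ? _.
exact: (PG k).2.
Qed.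

HB.instance Definition _ := isOuterMeasure.Build R 'rV[R]_n lebesgue_outer
  lebesgue_outer0 lebesgue_outer_ge0 le_lebesgue_outer
  lebesgue_outer_sigma_subadditive.

Definition lebesgue_outer_measure : {outer_measure set 'rV[R]_n -> \bar R} :=
  lebesgue_outer.

End lebesgue_outer.

(* R^n with the complete sigma-algebra of Lebesgue measurable sets. *)
Notation Rn R n := (caratheodory_type (@lebesgue_outer_measure R n)).

Definition lebn (R : realType) (n : nat) : {measure set (Rn R n) -> \bar R} :=
  (@lebesgue_outer_measure R n : set (Rn R n) -> \bar R).

Section definitions.
Context {R : realType} {n : nat}.
Implicit Types (x y : 'rV[R]_n) (A S : set 'rV[R]_n) (f : 'rV[R]_n -> R).

Definition cube x (r : R) : set 'rV[R]_n :=
  [set y | forall i, `|y 0 i - x 0 i| <= r].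

(* The point 0 makes the diameter of the empty set 0. *)
Definition diameter A : \bar R :=
  ereal_sup ([set 0%E] `|` [set edist (x, y) | x in A & y in A]).

Definition hausdorff_content (d delta : R) A : \bar R :=
  ereal_inf [set (\sum_(k <oo) diameter (E k) `^ d)%E |
    E in [set E : nat -> set 'rV[R]_n |
      A `<=` \bigcup_k E k /\ forall k, (diameter (E k) <= delta%:E)%E]].

Definition hausdorff_measure (d : R) A : \bar R :=
  ereal_sup [set hausdorff_content d delta A |
    delta in [set delta | 0 < delta]].

Definition d_set (d : R) S : Prop :=
  [/\ 0 < d <= n%:R, closed S &
      exists2 C : R, 1 < C & forall w r, S w -> 0 < r <= 1 ->
        ((C^-1 * r `^ d)%:E <= hausdorff_measure d (cube w r `&` S)
           <= (C * r `^ d)%:E)%E].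

(* mmeasure mdeg is the degree plus one, so that P ranges over the polynomials of
   degree at most k - 1. *)
Definition local_approximation (k : nat) (u : R) f (Q : set 'rV[R]_n) : \bar R :=
  ereal_inf [set (((lebn R n Q)^-1 * \int[lebn R n]_(x in Q)
                    (`|f x - meval (x 0) P| `^ u)%:E) `^ u^-1)%E |
    P in [set P : mpoly n R | (mmeasure mdeg P <= k)%N]].

(* k and u are the auxiliary parameters of the norm, subject to s < k and
   1 <= u <= min p q; u is finite since p is. The value at q = -oo is a junk
   value, as 1 <= q is always assumed. *)
Definition TL_function (s : R) (q : \bar R) (k : nat) (u : R) f x : \bar R :=
  let h t := ((t `^ (- s))%:E * local_approximation k u f (cube x t))%E in
  match q with
  | r%:E => ((\int[lebesgue_measure]_(t in `]0%R, 1%R]) (h t `^ r * t^-1%:E))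
               `^ r^-1)%E
  | +oo%E => ereal_sup [set h t | t in `]0, 1]]
  | -oo%E => 0%E
  end.

Definition in_Lp (p : R) (g : 'rV[R]_n -> \bar R) : Prop :=
  measurable_fun [set: Rn R n] (g : Rn R n -> \bar R) /\
  ('N[lebn R n]_p%:E [g] < +oo)%E.

Definition in_TL (s p : R) (q : \bar R) (k : nat) (u : R) f : Prop :=
  in_Lp p (EFin \o f) /\ in_Lp p (TL_function s q k u f).

Definition TL_norm (s p : R) (q : \bar R) (k : nat) (u : R) f : \bar R :=
  ('N[lebn R n]_p%:E [EFin \o f] +
   'N[lebn R n]_p%:E [TL_function s q k u f])%E.

(* lim has a junk value where the limit does not exist: trace f x is only
   meaningful under trace_defined f x. *)
Definition cube_average f x (r : R) : R :=
  (fine (lebn R n (cube x r)))^-1 * \int[lebn R n]_(y in cube x r) f y.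

Definition trace_defined f x : Prop := cvg (cube_average f x r @[r --> 0^'+]).

Definition trace f x : R := lim (cube_average f x r @[r --> 0^'+]).

Definition hausdorff_ae (d : R) S (P : 'rV[R]_n -> Prop) : Prop :=
  hausdorff_measure d (S `&` [set x | ~ P x]) = 0%E.

End definitions.

(* Main.v *)
Require Import Defs.
From mathcomp Require Import all_boot all_order all_algebra.
From mathcomp Require Import all_classical all_reals all_analysis.
From mathcomp Require Import measurable_realfun.
From mathcomp.multinomials Require Import -(notations) mpoly.
From mathcomp Require Import lra ring zify.
Set Implicit Arguments.
Unset Strict Implicit.
Unset Printing Implicit Defensive.
Import Order.TTheory GRing.Theory Num.Theory.
Import numFieldNormedType.Exports.
Local Open Scope classical_set_scope.
Local Open Scope ring_scope.
Local Notation ev P x := (meval (x 0) P).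
Local Notation coef P m := (mcoeff m P).
(* The degree plus one. *)
Local Notation msz P := (mmeasure mdeg P).

(** Write [n.+1] for the dimension, so that [n < d < n.+1], and let [g] be the
    Triebel-Lizorkin function of [f]. Besides the integrability of [g `^ p], what
    matters is that on a small cube of radius [t] some polynomial [P] of degree less than
    [k] approximates [f] in mean up to a multiple of [t `^ s * g y], for every
    point [y] of the cube ([TL_function_controls]).

    Take a cube of radius [r] centred on [S], with approximating polynomial [P].
    Near the centre, [f - P] is almost everywhere at most a multiple of
    [r `^ s * g] ([ae_poly_le]), so that only the size [A] of [P] has to be
    estimated, and this is where the vanishing trace enters ([trace_estimate]).
    Since [d > n], a polynomial cannot be much smaller than [A] on most of [S]:
    the set where this happens is covered by small cubes for which the sum of
    the [d]-th powers of the radii is small ([remez]). At almost all of the other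
    points [w] of [S] in the cube the averages of [f] tend to zero although [P]
    is of size [A], so that the approximations of [f] on the cubes around [w]
    must change a lot at some scale [r / 2 ^+ j], which forces [g] to be large on
    the whole cube of that radius around [w] ([trace_poly_le]). The points that
    are bad at the scale [j] are few: the cubes around a separated net of them
    are disjoint, and most of each cube keeps a distance of the order of
    [r / 2 ^+ j] from [S] because [d < n.+1], so the integral of [g `^ p] over
    the points at this distance bounds the Hausdorff measure of the set of bad
    points ([level_hausdorff]). The inequality [s * p > n.+1 - d] leaves a
    geometric factor, and
    [A `^ p * r ^+ n.+1 <= K * r `^ (s * p) * \sum_j q ^+ j * I j], where [q < 1]
    and [I j] is the integral of [g `^ p] at distance about [r / 2 ^+ j] from [S].

    For the global inequality, the points at a distance between [h] and [2 * h]
    from [S] are cut into the cells of a grid of mesh [h]. Each cell lies in a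
    cube centred on [S] of comparable radius, the weight is comparable to
    [h `^ (- (s * p))] on it, and the local estimates sum up by bounded overlap
    and the geometric factors ([layers_estimate]). The set [S] itself is
    negligible, and far away from it the weight is bounded. *)

(** * Sublevel sets of polynomials *)

Lemma powRDp (R : realType) (x a b : R) : 0 < x ->
  x `^ (a + b) = x `^ a * x `^ b.
Proof. by move=> x0; rewrite powRD//; apply/implyP => _; rewrite gt_eqF. Qed.

Lemma powR_half_lt1 (R : realType) (b : R) : 0 < b -> 2^-1 `^ b < 1.
Proof.
move=> b0; rewrite [ltRHS](_ : 1 = 1 `^ b); last by rewrite powR1.
by apply: gt0_ltr_powR; rewrite ?nnegrE//; rewrite invf_lt1//; lra.
Qed.

Section taylor.
Context {R : realType} {n : nat}.
Implicit Types (P : mpoly n R) (x y : 'rV[R]_n).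

(** A bound for the expansion in the direction [i] alone, while the other
    coordinates move by at most [h]. This form is stable under products, so that
    it passes from the variables to all polynomials. *)
Definition taylor_bounded (i : 'I_n) P (T : R) := 0 <= T /\
  forall x y h, cube 0 1 x -> cube 0 1 y -> 0 <= h ->
    (forall l, l != i -> `|y 0 l - x 0 l| <= h) ->
    [/\ `|ev P y| <= T, `|ev (mderiv i P) x| <= T &
      `|ev P y - ev P x - ev (mderiv i P) x * (y 0 i - x 0 i)|
         <= T * (h + (y 0 i - x 0 i) ^+ 2)].

Lemma taylor_boundedM i P Q T U : taylor_bounded i P T ->
  taylor_bounded i Q U -> taylor_bounded i (P * Q) (5 * (T * U)).
Proof.
move=> [T0 tP] [U0 tQ]; split; first by rewrite !mulr_ge0.
move=> x y h cx cy h0 hl.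
have [Py P'x tPxy] := tP x y h cx cy h0 hl.
have [Qy Q'x tQxy] := tQ x y h cx cy h0 hl.
have xx0 l : l != i -> `|x 0 l - x 0 l| <= h by rewrite subrr normr0.
have [Px _ _] := tP x x h cx cx h0 xx0.
have [Qx _ _] := tQ x x h cx cx h0 xx0.
have TU0 : 0 <= T * U by rewrite mulr_ge0.
have Mle (a b s t : R) : `|a| <= s -> `|b| <= t -> `|a * b| <= s * t.
  by move=> ? ?; rewrite normrM; apply: ler_pM.
rewrite mderivM mevalD !mevalM; split.
- by apply: (le_trans (Mle _ _ _ _ Py Qy)); lra.
- apply: (le_trans (ler_normD _ _)).
  by have := Mle _ _ _ _ P'x Qx; have := Mle _ _ _ _ Px Q'x; lra.
set D := y 0 i - x 0 i in tPxy tQxy *.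
have D2 : `|D| <= 2.
  have := cx i; have := cy i; rewrite !mxE !subr0 /D => ? ?.
  by apply: (le_trans (ler_normB _ _)); lra.
have D2E : `|D| ^+ 2 = D ^+ 2 by rewrite real_normK ?num_real.
set w := h + D ^+ 2 in tPxy tQxy *.
have w0 : 0 <= w by rewrite addr_ge0 ?sqr_ge0.
have Dw : `|D| ^+ 2 <= w by rewrite D2E /w lerDr.
move: tPxy tQxy Py P'x Qy Q'x Px Qx.
set a := ev P x; set a2 := ev P y; set a' := ev _ x.
set b := ev Q x; set b2 := ev Q y; set b' := ev _ x.
move=> tP' tQ' Py P'x Qy Q'x Px Qx.
have -> : a2 * b2 - a * b - (a' * b + a * b') * D =
   (a2 - a - a' * D) * b2 + a' * (D * (b2 - b - b' * D) + b' * (D * D))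
   + a * (b2 - b - b' * D) by ring.
have e1 := Mle _ _ _ _ tP' Qy.
have e3 := Mle _ _ _ _ Px tQ'.
have e2 : `|D * (b2 - b - b' * D) + b' * (D * D)| <= 3 * (U * w).
  apply: (le_trans (ler_normD _ _)).
  have := Mle _ _ _ _ D2 tQ'.
  have : `|b' * (D * D)| <= U * w by apply: Mle => //; rewrite normrM.
  lra.
have e4 := Mle _ _ _ _ P'x e2.
apply: (le_trans (ler_normD _ _)); apply: (le_trans (lerD (ler_normD _ _) (lexx _))).
lra.
Qed.

Lemma taylor_boundedC i (c : R) : taylor_bounded i (mpolyC n c) `|c|.
Proof.
split=> // x y h _ _ h0 _; rewrite mderivC meval0 !mevalC; split=> //.
  by rewrite normr0.
by rewrite mul0r subr0 subrr normr0 mulr_ge0// addr_ge0 ?sqr_ge0.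
Qed.

Lemma taylor_boundedU (i j : 'I_n) :
  taylor_bounded i (mpolyX R (mnm1 j)) 1.
Proof.
split=> // x y h cx cy h0 hl; rewrite mderivX mevalZ !mevalXU mnm1E.
have yj : `|y 0 j| <= 1 by have := cy j; rewrite mxE subr0.
have s0 := sqr_ge0 (y 0 i - x 0 i).
have [->|ji] := eqVneq j i.
  rewrite !mul1r mevalX big1 ?mul1r ?subrr ?normr0; last first.
    by move=> l _; rewrite mnmBE subnn expr0.
  by split; rewrite ?normr1//; [have := cy i; rewrite mxE subr0|lra].
rewrite !mul0r subr0 normr0 ler01; split => //.
by have := hl _ ji; lra.
Qed.

Lemma taylor_bounded_monomial i m : exists T, taylor_bounded i (mpolyX R m) T.
Proof.
rewrite mpolyXE_id; apply: (big_ind (fun P => exists T, taylor_bounded i P T)).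
- by exists `|1|; apply: taylor_boundedC.
- by move=> P Q [T tP] [U tQ]; eexists; apply: taylor_boundedM tP tQ.
- move=> j _; elim: (m j) => [|k [T tT]].
    by rewrite expr0; exists `|1|; apply: taylor_boundedC.
  by rewrite exprS; eexists; apply: taylor_boundedM (taylor_boundedU i j) tT.
Qed.

(** A polynomial depends linearly on its coefficients, hence one constant serves
    all polynomials of bounded degree with bounded coefficients. *)
Lemma taylor_bounded_uniform (k : nat) (M : R) : exists2 T, 0 < T &
  forall i P, (msz P <= k)%N -> (forall m, `|coef P m| <= M) ->
    taylor_bounded i P T.
Proof.
have [M0|M0] := ltP M 0.
  exists 1 => // i P _ /(_ mnm0) h; have := le_lt_trans h M0.
  by rewrite ltNge normr_ge0.
have /choice[T0 hT0] : forall im : 'I_n * bmultinom n k,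
    exists T, taylor_bounded im.1 (mpolyX R im.2) T.
  by move=> [i m]; exact: taylor_bounded_monomial.
have T0ge im : 0 <= T0 im by have [] := hT0 im.
pose S := \sum_i \sum_m T0 (i, m).
have S0 : 0 <= S by apply: sumr_ge0 => i _; apply: sumr_ge0.
exists (M * S + 1); first by have := mulr_ge0 M0 S0; lra.
move=> i P sP cP; split; first by have := mulr_ge0 M0 S0; lra.
move=> x y h cx cy h0 hl.
have Ssum (E : bmultinom n k -> R) b : 0 <= b ->
    (forall m, `|E m| <= T0 (i, m) * b) ->
    `|\sum_(m : bmultinom n k) coef P m * E m| <= (M * S + 1) * b.
  move=> b0 Eb; apply: (le_trans (ler_norm_sum _ _ _)).
  apply: (@le_trans _ _ (\sum_m M * (T0 (i, m) * b))).
    by apply: ler_sum => m _; rewrite normrM ler_pM.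
  rewrite -mulr_sumr -mulr_suml mulrA.
  apply: ler_wpM2r => //; apply: (@le_trans _ _ (M * S)); last by rewrite lerDl.
  apply: ler_wpM2l => //; rewrite /S.
  rewrite (bigD1 i)//= lerDl; apply: sumr_ge0 => j _; exact: sumr_ge0.
have PE (z : 'rV[R]_n) : ev P z = \sum_(m : bmultinom n k) coef P m * ev (mpolyX R m) z.
  rewrite [P in LHS](mpolywE sP) raddf_sum; apply: eq_bigr => m _.
  exact: mevalZ.
have dPE (z : 'rV[R]_n) : ev (mderiv i P) z =
    \sum_(m : bmultinom n k) coef P m * ev (mderiv i (mpolyX R m)) z.
  rewrite [P in LHS](mpolywE sP) (raddf_sum (mderiv i)) raddf_sum.
  apply: eq_bigr => m _.
  by rewrite /= mderivZ mevalZ.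
have w0 : 0 <= h + (y 0 i - x 0 i) ^+ 2 by rewrite addr_ge0 ?sqr_ge0.
split.
- rewrite PE -[leRHS]mulr1; apply: Ssum => // m; rewrite mulr1.
  by have [_ /(_ x y h cx cy h0 hl)[]] := hT0 (i, m).
- rewrite dPE -[leRHS]mulr1; apply: Ssum => // m; rewrite mulr1.
  by have [_ /(_ x y h cx cy h0 hl)[]] := hT0 (i, m).
rewrite dPE !PE mulr_suml -!sumrB.
under eq_bigr => m _ do rewrite -mulrA -!mulrBr.
apply: Ssum => // m.
by have [_ /(_ x y h cx cy h0 hl)[]] := hT0 (i, m).
Qed.

End taylor.

Section remez.
Context {R : realType}.

(** A finite family of cubes is a list of pairs of a centre and a radius. *)
Definition covered {n} (B : set 'rV[R]_n) (cs : seq ('rV[R]_n * R)) :=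
  forall y, B y -> exists2 c, c \in cs & cube c.1 c.2 y.

Definition thin {n} (d eps : R) (cs : seq ('rV[R]_n * R)) :=
  {in cs, forall c, 0 < c.2 <= 1} /\ \sum_(c <- cs) c.2 `^ d <= eps.

(** At the resolution [h], each part of [B] of height [eta] in the direction [i]
    looks like a Lipschitz graph over the other [n] coordinates. It is covered by
    about [h ^- n] cubes of radius [K * h], and [d > n]. *)
Lemma graph_cover (n : nat) (d K eta eps : R) :
  n%:R < d -> 1 <= K -> 0 < eta -> 0 < eps -> exists2 h, 0 < h &
  forall (i : 'I_n.+1) (B : set 'rV[R]_n.+1), B `<=` cube 0 1 ->
    (forall x y, B x -> B y -> `|y 0 i - x 0 i| <= eta ->
      (forall l, l != i -> `|y 0 l - x 0 l| <= h) ->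
      `|y 0 i - x 0 i| <= K * h) ->
    exists2 cs, thin d eps cs & covered B cs.
Proof.
move=> nd K1 eta0 eps0.
have K0 : 0 < K by lra.
pose J2 := Num.truncn (2 / eta).
pose C := (2 ^+ n * J2.+1%:R * (2 * K) `^ d) / eps.
have C0 : 0 < C by rewrite divr_gt0// !mulr_gt0 ?powR_gt0 ?exprn_gt0//; lra.
have dn0 : 0 < d - n%:R by lra.
pose J := (Num.truncn (2 * K + C `^ (d - n%:R)^-1)).+1.
have Jge : 2 * K + C `^ (d - n%:R)^-1 <= J%:R by apply/ltW/truncnS_gt.
have J0 : 0 < J%:R :> R by rewrite ltr0n.
have JC : C <= J%:R `^ (d - n%:R).
  have e : 0 <= C `^ (d - n%:R)^-1 by apply: powR_ge0.
  have : C `^ (d - n%:R)^-1 <= J%:R by lra.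
  move=> /(ge0_ler_powR (ltW dn0)) -/(_ _ _)/=.
  rewrite -powRrM mulVf ?gt_eqF// powRr1; last exact: ltW.
  by apply; rewrite nnegrE ?powR_ge0 ?ler0n.
exists (2 / J%:R); first by rewrite divr_gt0.
move=> i B B01 Bg.
pose co (x : 'rV[R]_n.+1) l : R := x 0 l + 1.
have coE x l : B x -> 0 <= co x l <= 2.
  move=> /B01 /(_ l); rewrite mxE subr0 ler_norml /co; lra.
(* Points with the same index are [h]-close in the coordinates other than [i],
   but only [eta]-close in the coordinate [i]. *)
pose idx (x : 'rV[R]_n.+1) : {ffun 'I_n -> 'I_J.+1} * 'I_J2.+1 :=
  ([ffun l : 'I_n => inord (Num.truncn (co x (lift i l) * (J%:R / 2)))],
   inord (Num.truncn (co x i / eta))).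
have close (u v : R) : 0 <= u -> 0 <= v -> Num.truncn u = Num.truncn v -> `|u - v| <= 1.
  move=> u0 v0 uv; have := truncn_itv u0; have := truncn_itv v0; rewrite uv.
  rewrite -natr1 => /andP[? ?] /andP[? ?]; rewrite ler_norml; lra.
have tle (u : R) N : 0 <= u -> u < N.+1%:R -> (Num.truncn u < N.+1)%N.
  by move=> u0 uN; rewrite truncn_lt_nat.
have tJ2 (v : R) : 0 <= v <= 2 -> (Num.truncn (v / eta) < J2.+1)%N.
  move=> /andP[v0 v2]; apply: tle; first by rewrite divr_ge0// ltW.
  by apply: le_lt_trans (truncnS_gt (2 / eta)); rewrite ler_pM2r ?invr_gt0.
have tJ (v : R) : 0 <= v <= 2 -> (Num.truncn (v * (J%:R / 2)) < J.+1)%N.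
  move=> /andP[v0 v2]; apply: tle; first by rewrite mulr_ge0// divr_ge0// ltW.
  apply: (@le_lt_trans _ _ (2 * (J%:R / 2))).
    by rewrite ler_wpM2r// divr_ge0// ltW.
  by rewrite mulrC divfK// ltr_nat.
have idx_near x y : B x -> B y -> idx x = idx y ->
    `|y 0 i - x 0 i| <= eta /\ forall l, l != i -> `|y 0 l - x 0 l| <= 2 / J%:R.
  move=> Bx By [/ffunP e1 e2]; split.
    have xe := coE x i Bx; have ye := coE y i By.
    have /andP[x0 x2] := xe; have /andP[y0 y2] := ye.
    have e : `|co y i / eta - co x i / eta| <= 1.
      apply: close; rewrite ?divr_ge0// ?(ltW eta0)//.
      move: e2 => /(congr1 val)/=; rewrite !inordK//.
      - exact: tJ2.
      - exact: tJ2.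
    move: e; rewrite -mulrBl normrM [`|eta^-1|]gtr0_norm ?invr_gt0//.
    by rewrite ler_pdivrMr// mul1r /co opprD addrACA subrr addr0.
  move=> l; rewrite eq_sym => /unlift_some[l' -> _].
  have xe := coE x (lift i l') Bx; have ye := coE y (lift i l') By.
  have /andP[x0 x2] := xe; have /andP[y0 y2] := ye.
  have J20 : 0 < J%:R / 2 :> R by rewrite divr_gt0.
  have e : `|co y (lift i l') * (J%:R / 2) - co x (lift i l') * (J%:R / 2)| <= 1.
    apply: close; rewrite ?mulr_ge0// ?(ltW J20)//.
    move: (e1 l'); rewrite !ffunE => /(congr1 val)/=; rewrite !inordK//.
    - exact: tJ.
    - exact: tJ.
  move: e; rewrite -mulrBl normrM [`|J%:R / 2|]gtr0_norm//.
  by rewrite -ler_pdivlMr// /co opprD addrACA subrr addr0 invf_div mul1r.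
pose pt e : 'rV[R]_n.+1 := xget 0 [set x | B x /\ idx x = e].
exists [seq (pt e, K * (2 / J%:R)) | e <- enum {: {ffun 'I_n -> 'I_J.+1} * 'I_J2.+1}].
  split.
    move=> _ /mapP[e _ ->] /=; rewrite mulr_gt0 ?divr_gt0//=.
    rewrite mulrA ler_pdivrMr// mul1r.
    have := powR_ge0 C (d - n%:R)^-1; lra.
  rewrite big_map big_enum/= sumr_const card_prod card_ffun !card_ord.
  have iJ0 : 0 <= J%:R^-1 :> R by rewrite invr_ge0 ltW.
  rewrite mulrA [K * 2]mulrC powRM//; last by rewrite mulr_ge0// ltW.
  have J1 : J.+1%:R <= 2 * J%:R :> R.
    by rewrite -natr1 mulrDl mul1r lerD2l ler1n.
  rewrite -[_ *+ (_ * _)]mulr_natr natrM natrX.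
  have J1n : (J.+1%:R) ^+ n <= 2 ^+ n * J%:R ^+ n :> R.
    by rewrite -exprMn lerXn2r ?nnegrE ?mulr_ge0.
  have JdE : J%:R `^ d = J%:R `^ (d - n%:R) * J%:R ^+ n.
    by rewrite -powR_mulrn ?ler0n// -powRDp// subrK.
  have iJE : J%:R^-1 `^ d = (J%:R `^ d)^-1.
    by rewrite -powR_inv1 ?ler0n// -powRrM mulN1r powRN.
  rewrite iJE JdE.
  set X := J%:R `^ (d - n%:R) in JC *.
  have X0 : 0 < X by apply: lt_le_trans JC.
  have Jn0 : 0 < J%:R ^+ n :> R by rewrite exprn_gt0.
  rewrite ler_pdivrMr -?mulrA in JC; last by [].
  apply: (@le_trans _ _ ((2 * K) `^ d / (X * J%:R ^+ n) * (2 ^+ n * J%:R ^+ n * J2.+1%:R))).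
    apply: ler_wpM2l; last by rewrite ler_wpM2r.
    by rewrite divr_ge0 ?powR_ge0// mulr_ge0 ?(ltW X0) ?(ltW Jn0).
  have -> : (2 * K) `^ d / (X * J%:R ^+ n) * (2 ^+ n * J%:R ^+ n * J2.+1%:R)
     = (2 ^+ n * (J2.+1%:R * (2 * K) `^ d)) / X.
    by field; rewrite !gt_eqF.
  by rewrite ler_pdivrMr// [eps * X]mulrC.
move=> y By; exists (pt (idx y), K * (2 / J%:R)).
  by apply/mapP; exists (idx y); rewrite ?mem_enum.
have [Bp pE] : B (pt (idx y)) /\ idx (pt (idx y)) = idx y.
  by rewrite /pt; case: xgetP => [x -> []//|/(_ y)]; case.
move=> l /=; have [e1 e2] := idx_near _ _ Bp By pE.
have [->|li] := eqVneq l i; first exact: Bg.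
by rewrite (le_trans (e2 _ li))// ler_peMl// divr_ge0.
Qed.

Lemma ev_bound n k (Q : mpoly n R) (a L : R) y : (msz Q <= k)%N -> 0 <= a ->
  1 <= L -> (forall m, `|coef Q m| <= a) -> cube 0 L y ->
  `|ev Q y| <= #|{: bmultinom n k}|%:R * a * L ^+ k.
Proof.
move=> sQ a0 L1 Qa yL; have L0 : 0 <= L by lra.
rewrite [Q](mpolywE sQ) raddf_sum (le_trans (ler_norm_sum _ _ _))//.
rewrite -mulrA mulr_natl -sumr_const; apply: ler_sum => m _.
rewrite /= mevalZ normrM ler_pM//= mevalX normr_prod.
apply: (@le_trans _ _ (\prod_(i < n) L ^+ ((m : multinom n) i))).
  apply: ler_prod => i _; rewrite normr_ge0 normrX lerXn2r ?nnegrE//.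
  by have := yL i; rewrite mxE subr0.
rewrite -expr_sum -mdegE ler_weXn2l//.
by case: m => m /= /ltnW.
Qed.

Lemma msz_mderiv n k (i : 'I_n) (P : mpoly n R) : (msz P <= k.+1)%N ->
  (msz (mderiv i P) <= k)%N.
Proof.
move=> sP; rewrite mmeasureE; apply/bigmax_leqP_seq => m mi _.
have : mnm_add m (mnm1 i) \in msupp P.
  move: mi; rewrite !mcoeff_msupp mcoeff_deriv; apply: contra => /eqP->.
  by rewrite mul0rn.
move=> /msize_mdeg_lt; rewrite mdegD mdeg1 addn1 => h.
by rewrite -ltnS (leq_trans h).
Qed.

Lemma coef_mderiv_le n k (i : 'I_n) (P : mpoly n R) (M : R) m : (msz P <= k)%N ->
  (forall m, `|coef P m| <= M) -> `|coef (mderiv i P) m| <= M * k%:R.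
Proof.
move=> sP PM; have M0 : 0 <= M by apply: le_trans (PM mnm0).
rewrite mcoeff_deriv.
have [/msize_mdeg_lt|] := boolP (mnm_add m (mnm1 i) \in msupp P).
  rewrite mdegD mdeg1 addn1 => h.
  rewrite normrMn -[_ *+ (m i).+1]mulr_natr ler_pM// ler_nat.
  apply: leq_trans (leq_trans h sP); rewrite ltnS mdegE (bigD1 i)//=.
  exact: (leq_trans (leq_addr _ _)).
by rewrite mcoeff_msupp negbK => /eqP->; rewrite mul0rn normr0 mulr_ge0.
Qed.

(** Induction on the degree. If some coefficient other than the constant one is
    not small, then some partial derivative has a coefficient that is bounded
    from below: the points where this derivative is small are covered by
    induction, and the other points of the sublevel set form a graph. Otherwise
    the polynomial is nearly constant and the sublevel set is empty. *)
Lemma remez_unit (n k : nat) (d : R) : n%:R < d ->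
  forall tau M eps : R, 0 < tau -> 0 < eps -> exists2 c, 0 < c &
  forall P : mpoly n.+1 R, (msz P <= k)%N -> (forall m, `|coef P m| <= M) ->
    (exists m, tau <= `|coef P m|) ->
    exists2 cs, thin d eps cs &
      covered [set y | cube 0 1 y /\ `|ev P y| < c] cs.
Proof.
move=> nd; elim: k => [|k IH] tau M eps tau0 eps0.
  exists 1 => // P; rewrite leqn0 mmeasure_poly_eq0 => /eqP-> _ [m].
  by rewrite mcoeff0 normr0; lra.
pose N : R := #|{: bmultinom n.+1 k.+1}|%:R.
have N0 : 0 <= N by rewrite ler0n.
(* Coefficients below [tau1] change the value by at most [tau / 2] in total. *)
pose tau1 := tau / (2 * (N + 1)).
have tau10 : 0 < tau1 by rewrite divr_gt0// mulr_gt0//; lra.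
have tau1E : tau1 * (2 * (N + 1)) = tau by rewrite divfK// gt_eqF// mulr_gt0//; lra.
have eps20 : 0 < eps / 2 by lra.
have [c1 c10 Hc1] := IH tau1 (M * k.+1%:R) _ tau10 eps20.
have [T T0 HT] := @taylor_bounded_uniform R n.+1 k.+1 M.
pose K := (2 / c1) * (2 + T) + 1.
have c1i : 0 < 2 / c1 by rewrite divr_gt0.
have K1 : 1 <= K by rewrite /K lerDr mulr_ge0 ?ltW//; lra.
have eta0 : 0 < c1 / (2 * T) by rewrite divr_gt0// mulr_gt0.
have [h h0 Hh] := graph_cover nd K1 eta0 eps20.
pose c := Num.min (tau / 2) h.
have c0 : 0 < c by rewrite lt_min h0 andbT; lra.
exists c => // P sP PM [m0 m0tau].
have [[m [m_neq0 mbig]]|small] :=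
    pselect (exists m, m != mnm0 /\ tau1 <= `|coef P m|).
  have [i mi] : exists i, m i != 0%N.
    apply/existsP; apply: contraNT m_neq0 => /existsPn hm.
    by apply/eqP/mnmP => i; rewrite mnm0E; apply/eqP; have := hm i; rewrite negbK.
  have [] := Hc1 (mderiv i P).
  - exact: msz_mderiv.
  - by move=> m'; exact: coef_mderiv_le.
  - exists (mnm_sub m (mnm1 i)); rewrite mcoeff_deriv submK; last first.
      by rewrite lep1mP.
    by rewrite normrMn (le_trans mbig)// -[leLHS]mulr1n ler_wpMn2l.
  move=> cs1 [cs1t cs1s] cs1c.
  have [] := Hh i [set y | [/\ cube 0 1 y, `|ev P y| < c & c1 <= `|ev (mderiv i P) y|]].
  - by move=> y [].
  - move=> x y [cx Px P'x] [cy Py _] D hl.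
    have [_ _] := (HT i P sP PM).2 x y h cx cy (ltW h0) hl.
    set D' := y 0 i - x 0 i in D *; set a := ev _ x in P'x * => tP.
    have ch : c <= h by rewrite ge_min lexx orbT.
    have : `|a * D'| <= 2 * c + T * (h + D' ^+ 2).
      have -> : a * D' = (ev P y - ev P x) - (ev P y - ev P x - a * D') by ring.
      apply: (le_trans (ler_normB _ _)); apply: lerD => //.
      by apply: (le_trans (ler_normB _ _)); lra.
    rewrite normrM -real_normK ?num_real//.
    set b := `|D'| in D *; have b0 : 0 <= b by exact: normr_ge0.
    have e1 : T * b ^+ 2 <= c1 / 2 * b.
      rewrite expr2 mulrA ler_wpM2r//.
      apply: (@le_trans _ _ (T * (c1 / (2 * T)))); first by rewrite ler_pM2l.
      by rewrite le_eqVlt; apply/orP; left; apply/eqP; field; rewrite gt_eqF.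
    have e2 : c1 * b <= `|a| * b by rewrite ler_wpM2r.
    rewrite mulrDr => e3.
    have e4 : b * c1 <= 2 * ((2 + T) * h) by lra.
    have -> : K * h = 2 * ((2 + T) * h) / c1 + h by rewrite /K; ring.
    by rewrite -ler_pdivlMr// in e4; rewrite (le_trans e4)// lerDl ltW.
  move=> cs2 [cs2t cs2s] cs2c; exists (cs1 ++ cs2).
    split; first by move=> e; rewrite mem_cat => /orP[/cs1t|/cs2t].
    by rewrite big_cat/=; lra.
  move=> y [cy Py]; have [lt|ge] := ltP `|ev (mderiv i P) y| c1.
    by have [e ein ey] := cs1c y (conj cy lt); exists e; rewrite // mem_cat ein.
  by have [e ein ey] := cs2c y (And3 cy Py ge); exists e; rewrite // mem_cat ein orbT.
have sm m : m != mnm0 -> `|coef P m| < tau1.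
  by move=> m0'; rewrite ltNge; apply/negP => h'; apply: small; exists m.
have tau1le : tau1 <= tau by rewrite -tau1E ler_peMr ?ltW//; lra.
have m00 : m0 = mnm0.
  apply/eqP; apply: contraT => /sm; lra.
exists [::]; first by split=> //; rewrite big_nil ltW.
move=> y [cy]; suff : tau / 2 <= `|ev P y|.
  by move=> h1 /(le_lt_trans h1); rewrite lt_min ltxx.
pose Q := P - mpolyC n.+1 (coef P mnm0).
have Qs : (msz Q <= k.+1)%N.
  rewrite (leq_trans (mmeasureD_le _ _ _))// geq_max sP mmeasureN mmeasureC.
  by case: (_ != 0).
have Qc m : `|coef Q m| <= tau1.
  rewrite mcoeffB mcoeffC; have [->|mn0] := eqVneq m mnm0.
    by rewrite mulr1 subrr normr0 ltW.
  by rewrite mulr0 subr0 ltW// sm.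
have := ev_bound Qs (ltW tau10) (lexx 1) Qc cy; rewrite expr1n mulr1 -/N.
rewrite mevalB mevalC => h1.
rewrite m00 in m0tau.
have -> : ev P y = coef P mnm0 + (ev P y - coef P mnm0) by ring.
have := lerB_normD (coef P mnm0) (ev P y - coef P mnm0).
lra.
Qed.

Lemma mszM_le n (P Q : mpoly n R) : (msz (P * Q) <= (msz P + msz Q).-1)%N.
Proof.
have [->|P0] := eqVneq P 0; first by rewrite mul0r mmeasure0.
have [->|Q0] := eqVneq Q 0; first by rewrite mulr0 mmeasure0.
by rewrite msizeM.
Qed.

Lemma poly_affine n k (x0 : 'rV[R]_n) (r : R) (P : mpoly n R) : (msz P <= k)%N ->
  exists2 P' : mpoly n R, (msz P' <= k)%N &
    forall z : 'rV[R]_n, ev P' z = ev P (x0 + r *: z).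
Proof.
move=> sP.
pose lq := [tuple mpolyC n (x0 0 i) + r *: mpolyX R (mnm1 i) | i < n].
exists (comp_mpoly lq P).
  rewrite (comp_mpolywE _ sP) (leq_trans (mmeasure_sum _ _ _ _))//.
  apply/bigmax_leqP => m _; rewrite (leq_trans (mmeasureZ_le _ _ _))//.
  apply: leq_trans (bmdeg m); rewrite mdegE.
  apply: (@big_ind2 _ _ (fun (p : mpoly n R) e => (msz p <= e.+1)%N)).
  - by rewrite mmeasure1.
  - move=> p a q b pa qb; rewrite (leq_trans (mszM_le _ _))//.
    by move: pa qb; lia.
  - move=> i _; elim: ((m : multinom n) i) => [|e IH].
      by rewrite expr0 mmeasure1.
    rewrite exprS (leq_trans (mszM_le _ _))//.
    suff : (msz (tnth lq i) <= 2)%N.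
      move: (msz (tnth lq i ^+ e)) IH (msz (tnth lq i)) => u + v; lia.
    rewrite tnth_mktuple (leq_trans (mmeasureD_le _ _ _))// geq_max.
    rewrite mmeasureC (leq_trans (mmeasureZ_le _ _ _)) ?msizeX ?mdeg1//.
    by case: (_ != 0).
move=> z; rewrite comp_mpoly_meval; apply: meval_eq => i.
by rewrite tnth_mktuple mevalD mevalC mevalZ mevalXU !mxE.
Qed.

(** A Remez inequality for the [d]-dimensional content: up to a constant, [A] is
    the largest coefficient of the polynomial transported to the unit cube, and
    dividing by it reduces the claim to [remez_unit]. *)
Lemma remez (n k : nat) (d L eps : R) : n%:R < d -> 1 <= L -> 0 < eps ->
  exists2 c, 0 < c & forall (P : mpoly n.+1 R) (x0 : 'rV[R]_n.+1) (r : R), (msz P <= k)%N -> 0 < r ->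
  exists2 A, 0 <= A /\ (forall z, cube x0 (L * r) z -> `|ev P z| <= A) &
  exists2 cs, thin d eps cs & forall y, cube x0 r y -> `|ev P y| < c * A ->
    exists2 e, e \in cs & cube (x0 + r *: e.1) (r * e.2) y.
Proof.
move=> nd L1 eps0; have L0 : 0 < L by lra.
pose N : R := #|{: bmultinom n.+1 k}|%:R.
have N0 : 0 <= N by rewrite ler0n.
have tau0 : 0 < (N + 1)^-1 by rewrite invr_gt0; lra.
have [c0 c00 Hc] := remez_unit k nd 1 tau0 eps0.
have Lk0 : 0 < L ^+ k by rewrite exprn_gt0.
exists (c0 / ((N + 1) * L ^+ k)); first by rewrite divr_gt0// mulr_gt0//; lra.
move=> P x0 r sP r0; have [P' sP' P'E] := poly_affine x0 r sP.
pose mx := \sum_(m : bmultinom n.+1 k) `|coef P' m|.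
have mx0 : 0 <= mx by apply: sumr_ge0.
have P'mx m : `|coef P' m| <= mx.
  have [mk|km] := ltnP (mdeg m) k.
    by rewrite /mx (bigD1 (BMultinom mk))//= lerDl sumr_ge0.
  by rewrite memN_msupp_eq0 ?normr0// msize_mdeg_ge// (leq_trans sP').
have zE y : y = x0 + r *: (r^-1 *: (y - x0)).
  by rewrite scalerA divff ?gt_eqF// scale1r addrC subrK.
have zc y s : cube x0 (s * r) y -> cube 0 s (r^-1 *: (y - x0)).
  move=> h i; have := h i; rewrite !mxE subr0 normrM.
  by rewrite gtr0_norm ?invr_gt0// ler_pdivrMl// mulrC.
exists ((N + 1) * mx * L ^+ k).
  split; first by rewrite !mulr_ge0 ?(ltW Lk0)//; lra.
  move=> z /zc hz; rewrite (zE z) -P'E (le_trans (ev_bound sP' mx0 L1 P'mx hz))//.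
  by rewrite ler_wpM2r ?(ltW Lk0)// ler_wpM2r// lerDl.
have [mx00|mx_neq0] := eqVneq mx 0.
  exists [::]; first by split=> //; rewrite big_nil ltW.
  by move=> y _; rewrite mx00 mulr0 mul0r mulr0 ltNge normr_ge0.
have mxp : 0 < mx by rewrite lt_def mx_neq0.
have [] := Hc (mx^-1 *: P').
- exact: leq_trans (mmeasureZ_le _ _ _) sP'.
- by move=> m; rewrite mcoeffZ normrM gtr0_norm ?invr_gt0// ler_pdivrMl// mulr1.
- apply: contrapT => /forallNP hm.
  have : mx <= \sum_(m : bmultinom n.+1 k) (N + 1)^-1 * mx.
    apply: ler_sum => m _; have /negP := hm m; rewrite -ltNge mcoeffZ normrM.
    by rewrite gtr0_norm ?invr_gt0// ltr_pdivrMl// mulrC => /ltW.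
  rewrite sumr_const -[X in _ <= X -> _]mulr_natr -/N mulrAC leNgt => /negP.
  by apply; rewrite gtr_pMl// mulrC ltr_pdivrMr; lra.
move=> cs ct cc; exists cs => // y cy Py.
have hy : [set y | cube 0 1 y /\ `|ev (mx^-1 *: P') y| < c0] (r^-1 *: (y - x0)).
  split; first by apply: zc; rewrite mul1r.
  rewrite mevalZ P'E -zE normrM gtr0_norm ?invr_gt0// ltr_pdivrMl//.
  apply: (lt_le_trans Py); rewrite le_eqVlt; apply/orP; left; apply/eqP.
  by field; rewrite !gt_eqF//; lra.
have [e ein ec] := cc _ hy; exists e => // i.
have := ec i; rewrite !mxE.
have -> : y 0 i - (x0 0 i + r * e.1 0 i) = r * (r^-1 * (y 0 i - x0 0 i) - e.1 0 i).
  by field; rewrite gt_eqF.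
by rewrite normrM gtr0_norm// ler_pM2l.
Qed.

End remez.

(** * Lebesgue measure of boxes and grid cells *)

Section lebesgue.
Context {R : realType} {n : nat}.
Local Notation V := 'rV[R]_n.+1.
Local Notation mu := (@lebesgue_outer R n.+1).
Local Notation L := (lebn R n.+1).
Implicit Types (A X : set V) (x y : V) (u : nat -> V * V).

Lemma box_volume_ge0 (ab : V * V) : 0 <= box_volume ab.
Proof. by apply: prodr_ge0 => i _; rewrite le_max lexx. Qed.

Lemma outer_box_le (ab : V * V) : (mu (box ab) <= (box_volume ab)%:E)%E.
Proof.
apply: ereal_inf_lbound; exists [set ab]; last by rewrite esum_set1// lee_fin box_volume_ge0.
by split; [exact: countable1|move=> x bx; exists ab].
Qed.

Lemma outer_seq_le X u : X `<=` \bigcup_k box (u k) ->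
  (mu X <= \sum_(k <oo) (box_volume (u k))%:E)%E.
Proof.
move=> Xu; apply: (le_trans (le_lebesgue_outer Xu)).
apply: (le_trans (lebesgue_outer_sigma_subadditive _)).
by apply: lee_nneseries => [k _ _|k _]; [exact: lebesgue_outer_ge0|exact: outer_box_le].
Qed.

(** Enumerating a countable cover by a sequence needs a box of volume zero to
    fill the unused indices, which is why the dimension is positive. *)
Lemma outer_seq_ge X (y : \bar R) :
  (forall u, X `<=` \bigcup_k box (u k) ->
     (y <= \sum_(k <oo) (box_volume (u k))%:E)%E) -> (y <= mu X)%E.
Proof.
move=> H; apply: le_ereal_inf_tmp => _ [B [cB XB] <-].
have /countable_injP[g ginj] := cB.
pose o : V * V := (const_mx 1, 0).
have o0 : box_volume o = 0.
  rewrite /box_volume big_ord_recl !mxE sub0r.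
  by have -> : Num.max 0 (-1) = 0 :> R; [apply/max_idPl; lra|rewrite mul0r].
pose u k := xget o [set ab | B ab /\ g ab = k].
have uE ab : B ab -> u (g ab) = ab.
  move=> Bab; rewrite /u; case: xgetP => [z -> [Bz gz]|/(_ ab)/=[]//].
  by apply: ginj; rewrite ?inE.
apply: le_trans (H u _) _.
  by move=> x /XB[ab Bab abx]; exists (g ab); rewrite ?uE.
have u0 k : (0 <= (box_volume (u k))%:E)%E by rewrite lee_fin box_volume_ge0.
rewrite nneseries_esumT//.
rewrite (esum_mkcond setT) (_ : (fun k => _) = fun k =>
    if k \in g @` B then (box_volume (u k))%:E else 0%E); last first.
  apply/funext => k; rewrite in_setT; case: ifPn => // kB.
  rewrite /u; case: xgetP => [z _ [Bz gz]|_]; last by rewrite o0.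
  by move: kB; rewrite notin_setE; case; exists z.
rewrite -esum_mkcond (@reindex_esum _ _ _ B (g @` B) g); last first.
  split; [by move=> z Bz; exists z|exact: ginj|by move=> _ [z Bz <-]; exists z].
by apply: le_esum => ab Bab; rewrite uE.
Qed.

(** A hyperplane cuts each box of a cover into two boxes whose volumes add up,
    which is the criterion of Caratheodory. *)
Lemma measurable_halfspace (i : 'I_n.+1) (t : R) :
  measurable ([set x : V | x 0 i <= t] : set (Rn R n.+1)).
Proof.
pose lo (ab : V * V) : V * V := (ab.1, \row_j (if j == i then Num.min (ab.2 0 j) t else ab.2 0 j)).
pose hi (ab : V * V) : V * V := (\row_j (if j == i then Num.max (ab.1 0 j) t else ab.1 0 j), ab.2).
have volD ab : box_volume ab = box_volume (lo ab) + box_volume (hi ab).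
  rewrite /box_volume (bigD1 i)//= [in RHS](bigD1 i)//= [X in _ = _ + X](bigD1 i)//=.
  rewrite !mxE !eqxx.
  under [X in _ = _ * X + _]eq_bigr => j ji do rewrite mxE (negbTE ji).
  under [X in _ = _ + _ * X]eq_bigr => j ji do rewrite mxE (negbTE ji).
  rewrite -mulrDl; congr (_ * _).
  set a := ab.1 0 i; set b := ab.2 0 i.
  rewrite /Num.max /Num.min; repeat case: ifPn; rewrite -?leNgt; lra.
apply: le_caratheodory_measurable => X /=.
apply: outer_seq_ge => u Xu.
rewrite (eq_eseriesr (fun k _ => congr1 EFin (volD (u k)))).
under eq_eseriesr do rewrite EFinD.
rewrite nneseriesD; [|by move=> *; rewrite lee_fin box_volume_ge0..].
apply: leeD; apply: outer_seq_le => x [Xx xt]; have [k _ ukx] := Xu x Xx; exists k => // j.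
  rewrite /= mxE; have := ukx j; case: eqP => // -> /andP[-> ?]/=.
  by rewrite le_min xt andbT.
rewrite /= mxE; have := ukx j; case: eqP => // -> /andP[? ->].
by rewrite andbT ge_max; apply/andP; split=> //; move/negP: xt; rewrite -ltNge => /ltW.
Qed.

Lemma measurable_coord (i : 'I_n.+1) :
  measurable_fun [set: Rn R n.+1] (fun x : Rn R n.+1 => (x : V) 0 i).
Proof.
move=> mD; apply: (measurability _ (RGenOInfty.measurableE R)) => //.
move=> _ [_ [t ->] <-]; rewrite setTI.
rewrite (_ : _ @^-1` _ = ~` [set x : V | x 0 i <= t]).
  by apply: measurableC; exact: measurable_halfspace.
apply/seteqP; split=> x /=; rewrite in_itv/= andbT; first by rewrite ltNge => /negP.
by move/negP; rewrite -ltNge.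
Qed.

Lemma measurable_prodset (I : 'I_n.+1 -> interval R) :
  measurable ([set x : V | forall i, x 0 i \in I i] : set (Rn R n.+1)).
Proof.
rewrite (_ : mkset _ = \bigcap_(i in [set: 'I_n.+1])
    ((fun x : V => x 0 i) @^-1` [set` I i])); last first.
  by apply/seteqP; split=> x h i; [move=> _; exact: h|exact: h].
apply: fin_bigcap_measurable; first exact: finite_finset.
move=> i _; rewrite -[X in measurable X]setTI.
exact: (measurable_coord i) (measurable_itv _).
Qed.

(** The indicator functions of the boxes of a cover sum up to at least one on the
    open box. Integrating this inequality in one coordinate after the other
    replaces the indicator functions by the volumes. *)
Lemma outer_openbox_ge (a b : V) (A : set V) : (forall i, a 0 i <= b 0 i) ->
  [set x : V | forall i, a 0 i < x 0 i < b 0 i] `<=` A ->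
  ((\prod_i (b 0 i - a 0 i))%:E <= mu A)%E.
Proof.
move=> ab oA; apply: outer_seq_ge => u Au.
have [abs|/forallNP ne] := pselect (exists i, a 0 i = b 0 i).
  have [i abi] := abs; rewrite (bigD1 i)//= abi subrr mul0r.
  by apply: nneseries_ge0 => k _ _; rewrite lee_fin box_volume_ge0.
have {ne ab} ab i : a 0 i < b 0 i.
  by rewrite lt_neqAle ab andbT; apply/eqP/ne.
pose w k i : R := Num.max 0 ((u k).2 0 i - (u k).1 0 i).
have w0 k i : 0 <= w k i by rewrite le_max lexx.
pose ind k i : R -> R := \1_(`[(u k).1 0 i, (u k).2 0 i]%classic).
have ind0 k i t : 0 <= ind k i t by rewrite /ind.
(* The first [m] coordinates have been integrated out. *)
pose F m k x : R := \prod_(i < n.+1) (if (i < m)%N then w k i else ind k i (x 0 i)).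
pose B m : R := \prod_(i < n.+1) (if (i < m)%N then b 0 i - a 0 i else 1).
pose mid : V := \row_i ((a 0 i + b 0 i) / 2).
have midP i : a 0 i < mid 0 i < b 0 i by rewrite mxE; have := ab i; lra.
suff key m : (m <= n.+1)%N -> forall x, (forall i, a 0 i < x 0 i < b 0 i) ->
    ((B m)%:E <= \sum_(k <oo) (F m k x)%:E)%E.
  have := key _ (leqnn n.+1) mid midP.
  rewrite /B (eq_bigr (fun i => b 0 i - a 0 i)); last by move=> i _; rewrite ltn_ord.
  move=> /le_trans; apply; apply: lee_nneseries => [k _ _|k _].
    by rewrite lee_fin prodr_ge0// => i _; case: ifP.
  rewrite lee_fin /F (eq_bigr (fun i => w k i))//.
  by move=> i _; rewrite ltn_ord.
elim: m => [_ x xP|m IH mn x xP].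
  rewrite {1}/B big1//.
  have [k _ ukx] := Au x (oA x xP).
  have Fk : F 0%N k x = 1.
    rewrite /F big1// => i _; rewrite /ind indicE mem_set//=.
    by rewrite in_itv/=; exact: ukx.
  rewrite -Fk; apply: (@le_trans _ _ (\sum_(0 <= j < k.+1) (F 0%N j x)%:E)%E).
    rewrite big_nat_recr//= leeDr// sume_ge0// => j _.
    by rewrite lee_fin prodr_ge0// => i _; case: ifP.
  apply: nneseries_lim_ge => j _; by rewrite lee_fin prodr_ge0// => i _; case: ifP.
pose im : 'I_n.+1 := Ordinal mn.
have ltE (i : 'I_n.+1) : i != im -> (i < m.+1)%N = (i < m)%N.
  move=> iim; rewrite [LHS]ltnS [LHS]leq_eqVlt; case: eqP => // im'.
  by case/eqP: iim; exact: val_inj.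
pose xt (t : R) : V := \row_i (if i == im then t else x 0 i).
pose c k : R := \prod_(i < n.+1 | i != im)
   (if (i < m.+1)%N then w k i else ind k i (x 0 i)).
have c0 k : 0 <= c k by apply: prodr_ge0 => i _; case: ifP.
have FS k : F m.+1 k x = c k * w k im.
  by rewrite /F (bigD1 im)//= ltnSn mulrC.
have Fm k t : F m k (xt t) = c k * ind k im t.
  rewrite /F (bigD1 im)//= ltnn mxE eqxx mulrC; congr (_ * _).
  by apply: eq_bigr => i iim; rewrite mxE (negbTE iim) ltE.
have BS : B m.+1 = B m * (b 0 im - a 0 im).
  rewrite /B (bigD1 im)//= ltnSn mulrC; congr (_ * _).
  rewrite [in RHS](bigD1 im)//= ltnn mul1r.
  by apply: eq_bigr => i iim; rewrite ltE.
have Bm0 : 0 <= B m by apply: prodr_ge0 => i _; case: ifP => // _; rewrite subr_ge0 ltW.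
pose J : set R := `]a 0 im, b 0 im[%classic.
have mJ : measurable J by exact: measurable_itv.
have muJ : lebesgue_measure J = (b 0 im - a 0 im)%:E.
  by rewrite /J lebesgue_measure_itv/= lte_fin ab.
have -> : (B m.+1)%:E = ((B m)%:E * lebesgue_measure J)%E.
  by rewrite muJ -EFinM BS.
rewrite -integral_cst//.
have mind k : measurable_fun J (fun t => (c k * ind k im t)%:E).
  by apply/measurable_EFinP; apply: measurable_funM => //; exact: measurable_indic.
apply: (@le_trans _ _ (\int[lebesgue_measure]_(t in J)
     (\sum_(k <oo) (c k * ind k im t)%:E))%E).
  apply: ge0_le_integral => //.
  - apply: (@ge0_emeasurable_sum _ _ _ J
      (fun k t => (c k * ind k im t)%:E) xpredT) => k.
      by move=> t _ _; rewrite lee_fin mulr_ge0.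
    by move=> _; exact: mind.
  - move=> t; rewrite /J/= in_itv/= => tJ.
    have := IH (ltnW mn) (xt t); rewrite (eq_eseriesr (fun k _ => congr1 EFin (Fm k t))).
    by apply => i; rewrite mxE; case: eqP => [->|].
rewrite integral_nneseries//; last by move=> k t _; rewrite lee_fin mulr_ge0.
apply: lee_nneseries => [k _ _|k _].
  by apply: integral_ge0 => t _; rewrite lee_fin mulr_ge0.
under eq_integral do rewrite EFinM.
rewrite ge0_integralZl ?lee_fin//; last 2 first.
- by apply/measurable_EFinP; exact: measurable_indic.
- by move=> t _; rewrite lee_fin.
rewrite FS EFinM lee_wpmul2l ?lee_fin// integral_indic//.
apply: (@le_trans _ _ (lebesgue_measure (`[(u k).1 0 im, (u k).2 0 im]%classic : set R))).
  by apply: le_measure; rewrite ?inE//; exact: measurableI.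
rewrite lebesgue_measure_itv/= lte_fin; case: ifPn => [h|_]; last by rewrite lee_fin.
by rewrite -EFinB lee_fin /w le_max lexx orbT.
Qed.

Lemma lebn_between (a b : V) (A : set V) : (forall i, a 0 i <= b 0 i) ->
  [set x : V | forall i, a 0 i < x 0 i < b 0 i] `<=` A ->
  A `<=` box (a, b) -> L A = (\prod_i (b 0 i - a 0 i))%:E.
Proof.
move=> ab oA Ac; apply/eqP; rewrite eq_le; apply/andP; split; last exact: outer_openbox_ge.
apply: (le_trans (le_lebesgue_outer Ac)); apply: (le_trans (outer_box_le _)).
rewrite lee_fin /box_volume le_eqVlt; apply/orP; left; apply/eqP.
by apply: eq_bigr => i _; apply/max_idPr; rewrite subr_ge0.
Qed.

Lemma measurable_cube x (r : R) : measurable (cube x r : set (Rn R n.+1)).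
Proof.
rewrite (_ : cube x r = [set y : V | forall i, y 0 i \in `[x 0 i - r, x 0 i + r]]).
  exact: measurable_prodset.
by apply/seteqP; split=> y h i; have := h i; rewrite in_itv/= ler_distl.
Qed.

Lemma lebn_cube x (r : R) : 0 <= r -> L (cube x r) = ((2 * r) ^+ n.+1)%:E.
Proof.
move=> r0; rewrite (@lebn_between (x - const_mx r) (x + const_mx r)).
- rewrite (eq_bigr (fun=> 2 * r)) ?prodr_const ?card_ord// => i _.
  by rewrite !mxE; ring.
- by move=> i; rewrite !mxE; lra.
- by move=> y h i; have := h i; rewrite !mxE ler_distl => /andP[/ltW-> /ltW->].
- by move=> y h i; have := h i; rewrite !mxE ler_distl.
Qed.

Definition grid_index (h : R) (x : V) : nat :=
  pickle (\row_i Num.floor (x 0 i / h) : 'rV[int]_n.+1).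

(** The half-open cells of the grid of mesh [h], numbered by a code of the
    integer coordinates of their lower corner. *)
Definition cell (h : R) (k : nat) : set V := [set x | grid_index h x = k].

(** The default value is taken at the numbers that code no lattice point; their
    cells are empty. *)
Definition cell_center (h : R) (k : nat) : V :=
  if unpickle k is Some m then
    \row_i (h * ((m : 'rV[int]_n.+1) 0 i)%:~R + h / 2) else 0.

Lemma cell_bigcup h : \bigcup_k cell h k = setT.
Proof. by apply/seteqP; split=> // x _; exists (grid_index h x). Qed.

Lemma cell_trivIset h : trivIset setT (cell h).
Proof.
apply/trivIsetP => i j _ _ /eqP ij; apply/seteqP; split=> // x [/= xi xj].
by apply: ij; rewrite -xi -xj.
Qed.

Lemma cellE h (m : 'rV[int]_n.+1) : 0 < h ->
  cell h (pickle m) = [set x : V | forall i,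
    x 0 i \in `[h * (m 0 i)%:~R, h * (m 0 i)%:~R + h[].
Proof.
move=> h0; have floorE (t : R) (z : int) :
    (Num.floor (t / h) == z) = (t \in `[h * z%:~R, h * z%:~R + h[).
  rewrite in_itv/= floor_eq.
  rewrite ler_pdivlMr// ltr_pdivrMr// [z%:~R * h]mulrC intrD mulrDl mul1r.
  by rewrite [z%:~R * h]mulrC.
apply/seteqP; split=> x /=.
  move=> /(pcan_inj pickleK) /rowP e i; rewrite -floorE; have := e i; rewrite mxE.
  by move=> ->.
move=> e; congr pickle; apply/rowP => i; rewrite mxE; apply/eqP.
by rewrite floorE.
Qed.

Lemma cell0 h k : @unpickle 'rV[int]_n.+1 k = None -> cell h k = set0.
Proof.
by move=> uk; apply/seteqP; split=> // x /= xk; rewrite -xk pickleK in uk.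
Qed.

Lemma cellS h k (m : 'rV[int]_n.+1) : 0 < h -> unpickle k = Some m ->
  cell h k !=set0 -> k = pickle m.
Proof. by move=> h0 uk [x /= xk]; rewrite -xk pickleK in uk *; case: uk => <-. Qed.

Lemma measurable_cell h k : 0 < h -> measurable (cell h k : set (Rn R n.+1)).
Proof.
move=> h0; have [->|/set0P ne] := eqVneq (cell h k) set0; first exact: measurable0.
case uk : (@unpickle 'rV[int]_n.+1 k) => [m|]; last by rewrite cell0.
by rewrite (cellS h0 uk ne) cellE//; exact: measurable_prodset.
Qed.

Lemma cell_sub_cube h k : 0 < h -> cell h k `<=` cube (cell_center h k) (h / 2).
Proof.
move=> h0 x xk; case uk : (@unpickle 'rV[int]_n.+1 k) => [m|]; last first.
  by move: xk; rewrite cell0.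
rewrite /cell_center uk => i; rewrite mxE.
have ne : cell h k !=set0 by exists x.
move: xk; rewrite (cellS h0 uk ne) cellE// => /(_ i); rewrite in_itv/= ler_distl.
move=> /andP[? ?]; lra.
Qed.

Lemma lebn_cell h k : 0 < h -> cell h k !=set0 -> L (cell h k) = (h ^+ n.+1)%:E.
Proof.
move=> h0 ne; case uk : (@unpickle 'rV[int]_n.+1 k) => [m|]; last first.
  by case: ne => x; rewrite cell0.
rewrite (cellS h0 uk ne) cellE//.
pose a : V := \row_i (h * (m 0 i)%:~R).
rewrite (@lebn_between a (a + const_mx h)).
- rewrite (eq_bigr (fun=> h)) ?prodr_const ?card_ord// => i _.
  by rewrite !mxE; ring.
- by move=> i; rewrite !mxE; lra.
- by move=> x + i => /(_ i); rewrite !mxE in_itv/= => /andP[/ltW-> ->].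
- by move=> x + i => /(_ i); rewrite !mxE in_itv/= => /andP[-> /ltW->].
Qed.

(** The set is the union of the cells of mesh [j.+1%:R^-1], for all [j], that it
    contains. *)
Lemma measurable_ball_open (U : set V) :
  (forall x, U x -> exists2 r, 0 < r & cube x r `<=` U) ->
  measurable (U : set (Rn R n.+1)).
Proof.
move=> oU; pose h (j : nat) : R := j.+1%:R^-1.
have h0 j : 0 < h j by rewrite invr_gt0.
pose B j k : set V := if pselect (cell (h j) k `<=` U) then cell (h j) k else set0.
rewrite (_ : U = \bigcup_j \bigcup_k B j k); last first.
  apply/seteqP; split=> [x Ux|x [j _ [k _]]]; last by rewrite /B; case: pselect => // s /s.
  have [r r0 rU] := oU x Ux.
  exists (Num.truncn r^-1) => //; set j := Num.truncn _.
  exists (grid_index (h j) x) => //; rewrite /B; case: pselect => // -[].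
  move=> y /(cell_sub_cube (h0 j)) yc; apply: rU => i.
  have /(cell_sub_cube (h0 j)) xc : cell (h j) (grid_index (h j) x) x by [].
  have hr : h j <= r.
    rewrite /h invf_ple ?posrE// ltW// truncnS_gt//.
  apply: le_trans hr; have := xc i; have := yc i.
  set c := cell_center _ _ 0 i => hy hx.
  have -> : y 0 i - x 0 i = (y 0 i - c) - (x 0 i - c) by ring.
  by apply: (le_trans (ler_normB _ _)); lra.
apply: bigcup_measurable => j _; apply: bigcup_measurable => k _.
rewrite /B; case: (pselect (cell (h j) k `<=` U)) => _ /=; last exact: measurable0.
exact: measurable_cell.
Qed.

Lemma measurable_ev (P : mpoly n.+1 R) (D : set (Rn R n.+1)) :
  measurable_fun D (fun x : Rn R n.+1 => ev P (x : V)).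
Proof.
have mc i : measurable_fun D (fun x : Rn R n.+1 => (x : V) 0 i).
  exact: (measurable_funS measurableT (@subsetT _ _) (measurable_coord i)).
under eq_fun do rewrite mevalE.
apply: (@measurable_sum _ _ _ _ _ _ (fun m (x : Rn R n.+1) =>
  coef P m * \prod_i (x : V) 0 i ^+ (m : multinom n.+1) i)) => m.
apply: measurable_funM; first exact: measurable_cst.
apply: (@measurable_prod _ _ _ _ _ _ (fun i (x : Rn R n.+1) =>
  (x : V) 0 i ^+ (m : multinom n.+1) i)) => i _.
exact: measurable_funX (mc i).
Qed.

End lebesgue.

(** * Polynomial approximation on nested cubes *)

Section covering_measure.

(** Stated for bare set functions so that it serves the Lebesgue and the
    Hausdorff measure alike. *)
Lemma le_sum_cover (R : realType) (T : Type) (I : eqType) (m : set T -> \bar R)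
    (F : I -> set T) (s : seq I) (E : set T) :
  m set0 = 0%E -> {homo m : A B / A `<=` B >-> (A <= B)%E} ->
  (forall A B, m (A `|` B) <= m A + m B)%E ->
  (forall y, E y -> exists2 i, i \in s & F i y) ->
  (m E <= \sum_(i <- s) m (F i))%E.
Proof.
move=> m0 mono sub; elim: s E => [|i s IH] E cov.
  rewrite big_nil (_ : E = set0) ?m0//.
  by apply/seteqP; split=> // y /cov[].
rewrite big_cons (le_trans _ (leeD2l _ (IH (E `\` F i) _)))//; last first.
  move=> y [Ey nFy]; have [j] := cov y Ey; rewrite inE => /predU1P[->//|js Fj].
  by exists j.
apply: le_trans (sub _ _); apply: mono => y Ey.
by have [Fy|Fy] := pselect (F i y); [left|right].
Qed.

End covering_measure.

Section poly_mean.
Context {R : realType} {n : nat}.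
Local Notation V := 'rV[R]_n.+1.
Local Notation L := (lebn R n.+1).
Implicit Types (x y z w : V) (P Q : mpoly n.+1 R) (G : V -> \bar R).

Lemma cube_center x (r : R) : 0 <= r -> cube x r x.
Proof. by move=> r0 i; rewrite subrr normr0. Qed.

Lemma cube_sub x y (r s : R) : (forall i, `|x 0 i - y 0 i| + r <= s) ->
  cube x r `<=` cube y s.
Proof.
move=> h z zx i; apply: le_trans (h i).
have -> : z 0 i - y 0 i = (x 0 i - y 0 i) + (z 0 i - x 0 i) by ring.
by apply: (le_trans (ler_normD _ _)); rewrite lerD2l zx.
Qed.

Lemma lebn_setU (A B : set V) : (L (A `|` B) <= L A + L B)%E.
Proof. exact: (outer_measureU2 lebesgue_outer_measure). Qed.

Lemma lebn_mono (A B : set V) : A `<=` B -> (L A <= L B)%E.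
Proof. exact: le_lebesgue_outer. Qed.

Lemma lebn0 : L set0 = 0%E.
Proof. exact: lebesgue_outer0. Qed.

Lemma measurable_abs_ev P (D : set (Rn R n.+1)) :
  measurable_fun D (fun x : Rn R n.+1 => `|ev P (x : V)|%:E).
Proof.
apply/measurable_EFinP.
apply: (measurableT_comp (@normr_measurable R setT)).
exact: measurable_ev.
Qed.

(** For the exponent [n.+1], [remez] says that the polynomial is comparable to
    its maximum on at least half of the volume of the cube. *)
Lemma poly_sup_le_mean (k : nat) (lam : R) : 1 <= lam -> exists2 C, 0 < C &
  forall P x (r : R), (msz P <= k)%N -> 0 < r -> forall z, cube x (lam * r) z ->
    ((`|ev P z| * r ^+ n.+1)%:E <=
      C%:E * \int[L]_(y in cube x r) `|ev P y|%:E)%E.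
Proof.
move=> lam1.
have n1 : n%:R < n.+1%:R :> R by rewrite ltr_nat.
have e0 : 0 < 2^-1 :> R by [].
have [c c0 Hc] := remez k n1 lam1 e0.
exists (c^-1 * 2); first by rewrite mulr_gt0 ?invr_gt0.
move=> P x r sP r0 z zx; have [A [A0 PA] [cs [ct csum] ccov]] := Hc P x r sP r0.
pose E : set V := cube x r `&` [set y | (`|ev P y|%:E < (c * A)%:E)%E].
pose Q : set V := cube x r.
have mQ : measurable (Q : set (Rn R n.+1)) by exact: measurable_cube.
have mE : measurable (E : set (Rn R n.+1)).
  apply: emeasurable_fun_infty_o; first exact: mQ.
  exact: measurable_abs_ev.
have LQ : L Q = ((2 * r) ^+ n.+1)%:E by rewrite lebn_cube// ltW.
have r20 : 0 <= (2 * r) ^+ n.+1 by rewrite exprn_ge0//; lra.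
have LE : (L E <= ((2 * r) ^+ n.+1 / 2)%:E)%E.
  apply: (le_trans (le_sum_cover (F := fun e => cube (x + r *: e.1) (r * e.2))
    (s := cs) lebn0 lebn_mono lebn_setU _)).
    by move=> y [yx]; rewrite /= lte_fin => /(ccov y yx).
  rewrite big_seq (eq_bigr (fun e => ((2 * r) ^+ n.+1 * e.2 `^ n.+1%:R)%:E)); last first.
    move=> e /ct /andP[e0' _]; rewrite lebn_cube ?mulr_ge0 ?(ltW r0) ?(ltW e0')//.
    by rewrite powR_mulrn ?(ltW e0')// mulrA exprMn.
  by rewrite -big_seq sumEFin lee_fin -mulr_sumr ler_wpM2l.
have LD : (((2 * r) ^+ n.+1 / 2)%:E <= L (Q `\` E))%E.
  have : (L Q <= L (Q `\` E) + L E)%E.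
    apply: le_trans (lebn_setU _ _); apply: lebn_mono => y Qy.
    by have [Ey|Ey] := pselect (E y); [right|left].
  rewrite LQ => h; have := le_trans h (leeD2l _ LE).
  case: (L (Q `\` E)) => [l| |]; rewrite ?leey// -?EFinD ?lee_fin; lra.
have cA : (((c * A) * ((2 * r) ^+ n.+1 / 2))%:E <= \int[L]_(y in Q) `|ev P y|%:E)%E.
  have mD : measurable (Q `\` E : set (Rn R n.+1)) by exact: measurableD.
  apply: (@le_trans _ _ (\int[L]_(y in Q `\` E) `|ev P y|%:E)%E); last first.
    apply: ge0_subset_integral; [exact: mD|exact: mQ|exact: measurable_abs_ev| |].
      by move=> y _; rewrite lee_fin.
    by move=> y [].
  apply: (@le_trans _ _ (\int[L]_(y in Q `\` E) (cst (c * A)%:E y))%E).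
    rewrite (integral_cst _ mD) EFinM; apply: lee_wpmul2l; last exact: LD.
    by rewrite lee_fin mulr_ge0// ltW.
  apply: ge0_le_integral; first exact: mD.
  - by move=> y _; rewrite lee_fin mulr_ge0// ltW.
  - exact: measurable_cst.
  - exact: measurable_abs_ev.
  - by move=> y [Qy nE]; rewrite leNgt; apply/negP => lt; apply: nE; split.
apply: (@le_trans _ _ ((c^-1 * 2)%:E * ((c * A) * ((2 * r) ^+ n.+1 / 2))%:E)%E).
  rewrite -EFinM lee_fin.
  have -> : c^-1 * 2 * (c * A * ((2 * r) ^+ n.+1 / 2)) = A * (2 * r) ^+ n.+1.
    by field; rewrite gt_eqF.
  rewrite ler_pM ?exprn_ge0 ?(ltW r0)//; first exact: PA.
  by rewrite lerXn2r ?nnegrE ?(ltW r0)//; lra.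
by rewrite lee_wpmul2l// lee_fin mulr_ge0// invr_ge0 ltW.
Qed.

Definition Lmeasurable (f : V -> R) :=
  measurable_fun [set: Rn R n.+1] (f : Rn R n.+1 -> R).

Definition errint (f : V -> R) P x (r : R) : \bar R :=
  (\int[L]_(y in cube x r) `|f y - ev P y|%:E)%E.

Lemma measurable_err f P (D : set (Rn R n.+1)) : Lmeasurable f ->
  measurable_fun D (fun y : Rn R n.+1 => `|f y - ev P (y : V)|%:E).
Proof.
move=> mf; apply/measurable_EFinP.
apply: (measurableT_comp (@normr_measurable R setT)).
apply: measurable_funB; last exact: measurable_ev.
exact: (measurable_funS measurableT (@subsetT _ _) mf).
Qed.

(** [poly_sup_le_mean] turns closeness in mean into uniform closeness. *)
Lemma poly_diff (k : nat) : exists2 C, 0 < C &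
  forall f, Lmeasurable f ->
  forall P Q x y (r r' a b : R), (msz P <= k)%N -> (msz Q <= k)%N -> 0 < r' ->
  cube y r' `<=` cube x r ->
  (errint f P x r <= a%:E)%E -> (errint f Q y r' <= b%:E)%E ->
  forall z, cube y r' z -> `|ev P z - ev Q z| * r' ^+ n.+1 <= C * (a + b).
Proof.
have [C C0 HC] := poly_sup_le_mean k (lexx 1).
exists C => // f mf P Q x y r r' a b sP sQ r'0 sub Pa Qb z zy.
have sPQ : (msz (P - Q) <= k)%N.
  by rewrite (leq_trans (mmeasureD_le _ _ _))// geq_max sP mmeasureN.
have := HC _ y r' sPQ r'0 z; rewrite mul1r mevalB => /(_ zy) h.
rewrite -lee_fin (le_trans h)// EFinM lee_wpmul2l ?lee_fin ?(ltW C0)//.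
have mc := @measurable_cube R n.
apply: (@le_trans _ _ (\int[L]_(t in cube y r') (`|f t - ev P t|%:E + `|f t - ev Q t|%:E))%E).
  apply: ge0_le_integral; first exact: mc.
  - by move=> t _; rewrite lee_fin.
  - exact: measurable_abs_ev.
  - by apply: emeasurable_funD; exact: measurable_err.
  - move=> t _; rewrite -EFinD lee_fin mevalB distrC.
    have -> : ev Q t - ev P t = (f t - ev P t) - (f t - ev Q t) by ring.
    exact: ler_normB.
rewrite ge0_integralD; [|exact: mc|by move=> *; rewrite lee_fin|
  exact: measurable_err|by move=> *; rewrite lee_fin|exact: measurable_err].
rewrite EFinD; apply: leeD; last exact: Qb.
apply: le_trans Pa; apply: ge0_subset_integral;
  [exact: mc|exact: mc|exact: measurable_err| |exact: sub].
by move=> *; rewrite lee_fin.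
Qed.

(** The differences of consecutive polynomials are bounded by the errors at the
    larger scale, which form a geometric series. *)
Lemma poly_chain (k : nat) (th : R) : 0 < th -> th < 1 -> exists2 K, 0 < K &
  forall f, Lmeasurable f ->
  forall (Ps : nat -> mpoly n.+1 R) (cs : nat -> V) (r a : R), 0 < r -> 0 <= a ->
  (forall j, msz (Ps j) <= k)%N ->
  (forall j, cube (cs j.+1) (r / 2 ^+ j.+1) `<=` cube (cs j) (r / 2 ^+ j)) ->
  (forall j, errint f (Ps j) (cs j) (r / 2 ^+ j)
     <= ((r / 2 ^+ j) ^+ n.+1 * (a * th ^+ j))%:E)%E ->
  forall J z, cube (cs J) (r / 2 ^+ J) z -> `|ev (Ps J) z - ev (Ps 0%N) z| <= K * a.
Proof.
move=> th0 th1; have [C C0 HC] := poly_diff k.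
pose D := C * (2 ^+ n.+1 + 1).
have D0 : 0 < D by rewrite mulr_gt0// addr_gt0// exprn_gt0.
have t10 : 0 < 1 - th by lra.
exists (D / (1 - th)); first by rewrite divr_gt0.
move=> f mf Ps cs r a r0 a0 sP nest err J z zJ.
suff : `|ev (Ps J) z - ev (Ps 0%N) z| <= D * a * ((1 - th ^+ J) / (1 - th)).
  move=> /le_trans; apply; rewrite -mulrA [a * _]mulrC !mulrA.
  rewrite ler_wpM2r// ler_wpM2r ?invr_ge0 ?(ltW t10)//.
  by rewrite ler_piMr ?(ltW D0)// gerBl exprn_ge0 ?(ltW th0).
elim: J z zJ => [|J IH] z zJ; first by rewrite subrr normr0 expr0 subrr mul0r mulr0.
have zJ' := nest J z zJ.
have rJ (j : nat) : 0 < r / 2 ^+ j by rewrite divr_gt0// exprn_gt0.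
have := HC _ mf _ _ _ _ _ _ _ _ (sP J) (sP J.+1) (rJ J.+1) (nest J) (err J) (err J.+1) z zJ.
have -> : (r / 2 ^+ J) = 2 * (r / 2 ^+ J.+1).
  by rewrite exprS; field; rewrite gt_eqF// exprn_gt0.
move: (r / 2 ^+ J.+1) (rJ J.+1) => q q0'.
have q0 : 0 < q ^+ n.+1 by rewrite exprn_gt0.
rewrite exprMn.
have -> : C * (2 ^+ n.+1 * q ^+ n.+1 * (a * th ^+ J) + q ^+ n.+1 * (a * th ^+ J.+1))
   = (C * (2 ^+ n.+1 + th) * (a * th ^+ J)) * q ^+ n.+1.
  by rewrite [th ^+ J.+1]exprS; ring.
rewrite ler_pM2r// => h1.
have -> : ev (Ps J.+1) z - ev (Ps 0%N) z =
   (ev (Ps J) z - ev (Ps 0%N) z) - (ev (Ps J) z - ev (Ps J.+1) z) by ring.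
apply: (le_trans (ler_normB _ _)); apply: (le_trans (lerD (IH z zJ') h1)).
have -> : (1 - th ^+ J.+1) / (1 - th) = (1 - th ^+ J) / (1 - th) + th ^+ J.
  by rewrite exprS; field; rewrite gt_eqF.
rewrite [leRHS]mulrDr lerD2l -[leRHS]mulrA /D -!mulrA ler_wpM2l ?(ltW C0)//.
rewrite ler_wpM2r ?mulr_ge0 ?exprn_ge0 ?(ltW th0)//; lra.
Qed.

Lemma ev_continuous P w (e : R) : 0 < e ->
  exists2 r, 0 < r & forall y, cube w r y -> `|ev P y - ev P w| <= e.
Proof.
have cc (c : R) : (fun y : V => c) @ w --> c by refine (@cvg_cst R c _ (nbhs w) _).
have cM (g h : V -> R) (a b : R) : g @ w --> a -> h @ w --> b ->
    (fun y => g y * h y) @ w --> a * b.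
  by move=> ga hb; exact: (@cvgM R V (nbhs w) (nbhs_filter w) g h a b ga hb).
have cD (g h : V -> R) (a b : R) : g @ w --> a -> h @ w --> b ->
    (fun y => g y + h y) @ w --> a + b.
  by move=> ga hb; exact: (@cvgD R R V (nbhs w) (nbhs_filter w) g h a b ga hb).
have cP : (fun y : V => ev P y) @ w --> ev P w.
  elim/mpolyind: P => [|c m P _ _ IH].
    under eq_fun do rewrite meval0.
    by rewrite meval0; exact: cc.
  under eq_fun do rewrite mevalD mevalZ.
  rewrite mevalD mevalZ; apply: (cD); last exact: IH.
  apply: (cM); first exact: cc.
  rewrite mpolyXE_id.
  elim/big_ind : _ => [|A B cA cB|i _].
  - under eq_fun do rewrite meval1.
    by rewrite meval1; exact: cc.
  - under eq_fun do rewrite mevalM.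
    by rewrite mevalM; exact: (cM).
  elim: (m i) => [|j IHj].
    under eq_fun do rewrite expr0 meval1.
    by rewrite expr0 meval1; exact: cc.
  under eq_fun do rewrite exprS mevalM mevalXU.
  rewrite exprS mevalM mevalXU; apply: (cM); last exact: IHj.
  exact: coord_continuous.
move=> e0; move/cvgrPdist_le : cP => /(_ e e0) /nbhs_ballP[r /= r0 rP].
exists (r / 2) => [|y yw]; first by rewrite divr_gt0.
rewrite distrC; apply: rP; split=> // a b /=; rewrite (ord1 a) -ball_normE /= distrC.
by apply: le_lt_trans (yw b) _; lra.
Qed.

Lemma small_pow (z c e : R) : 0 <= z -> z < 1 -> 0 < e ->
  \forall J \near \oo, c * z ^+ J <= e.
Proof.
move=> z0 z1 e0.
have : (fun J => z ^+ J) @ \oo --> (0 : R) by apply: cvg_expr; rewrite ger0_norm.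
have e'0 : 0 < e / (`|c| + 1) by rewrite divr_gt0// ltr_wpDl.
move/cvgrPdist_le => /(_ _ e'0) h; near=> J.
have : `|0 - z ^+ J| <= e / (`|c| + 1) by near: J.
rewrite sub0r normrN ger0_norm ?exprn_ge0// ler_pdivlMr ?ltr_wpDl// => h1.
apply: le_trans h1; rewrite mulrC ler_wpM2l ?exprn_ge0//.
by rewrite (le_trans (ler_norm c))// lerDl.
Unshelve. all: by end_near. Qed.

Definition Lintegrable (f : V -> R) :=
  forall x (r : R), L.-integrable (cube x r) (EFin \o f).

(** Only the averages of [f] are known to converge, so the value of the first
    polynomial at the centre is compared with the average of [f] over a small
    cube of the chain, on which that polynomial is almost constant. *)
Lemma trace_poly_le (k : nat) (th : R) : 0 < th -> th < 1 -> exists2 K, 0 < K &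
  forall f, Lmeasurable f -> Lintegrable f ->
  forall (Ps : nat -> mpoly n.+1 R) w (r a : R), 0 < r -> 0 <= a ->
  (forall j, msz (Ps j) <= k)%N ->
  (forall j, errint f (Ps j) w (r / 2 ^+ j)
     <= ((r / 2 ^+ j) ^+ n.+1 * (a * th ^+ j))%:E)%E ->
  cube_average f w t @[t --> 0^'+] --> (0 : R) ->
  `|ev (Ps 0%N) w| <= K * a.
Proof.
move=> th0 th1; have [K K0 HK] := poly_chain k th0 th1.
exists K => // f mf If Ps w r a r0 a0 sP err avg0.
have rJ (j : nat) : 0 < r / 2 ^+ j by rewrite divr_gt0// exprn_gt0.
have nest j : cube w (r / 2 ^+ j.+1) `<=` cube w (r / 2 ^+ j).
  apply: cube_sub => i; rewrite subrr normr0 add0r.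
  rewrite ler_wpM2l ?(ltW r0)// lef_pV2 ?posrE ?exprn_gt0//.
  by rewrite exprS ler_peMl ?exprn_ge0//; lra.
have HJ := HK f mf Ps (fun=> w) r a r0 a0 sP nest err.
apply/ler_addgt0Pr => e e0.
have e30 : 0 < e / 3 by rewrite divr_gt0.
have [r1 r10 Pc] := ev_continuous (Ps 0%N) w e30.
have avgn : \forall t \near 0^'+, `|cube_average f w t| <= e / 3.
  move/cvgrPdist_le : avg0 => /(_ _ e30); apply: filterS => t.
  by rewrite sub0r normrN.
have [d /= d0 avgd] : exists2 d : R, 0 < d &
    forall t, 0 < t -> t < d -> `|cube_average f w t| <= e / 3.
  move: avgn => [d /= d0 dP]; exists d => // t t0 td; apply: dP => //=.
  by rewrite sub0r normrN gtr0_norm.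
have [J [hJ1 hJ2]] : exists J, a * th ^+ J <= e / 3 /\
    r / 2 ^+ J <= Num.min r1 (d / 2).
  have A1 := small_pow a (ltW th0) th1 e30.
  have m0 : 0 < Num.min r1 (d / 2) by rewrite lt_min r10 divr_gt0.
  have h0 : 0 <= 2^-1 :> R by [].
  have h1 : 2^-1 < 1 :> R by rewrite invf_lt1//; lra.
  have A2 := small_pow r h0 h1 m0.
  have [J [b1 b2]] := filter_ex (filterI A1 A2).
  by exists J; split=> //; rewrite -exprVn.
move: hJ2; rewrite le_min => /andP[hr1 hd].
have := HJ J; move: (err J) (rJ J) hr1 hd.
move: (r / 2 ^+ J) => q errJ q0 qr1 qd chainJ.
have mQ : measurable (cube w q : set (Rn R n.+1)) by exact: measurable_cube.
have LQ : L (cube w q) = ((2 * q) ^+ n.+1)%:E by rewrite lebn_cube// ltW.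
have q2 : 0 < (2 * q) ^+ n.+1 by rewrite exprn_gt0// mulr_gt0.
pose c0 := ev (Ps 0%N) w.
have Lfin : (L (cube w q) < +oo)%E by rewrite LQ ltry.
have Icst : L.-integrable (cube w q) (EFin \o (fun=> c0)).
  apply/integrableP; split; first exact: measurable_cst.
  by rewrite (integral_cst L mQ `|c0%:E|%E) LQ -EFinM ltry.
have DE : \int[L]_(y in cube w q) (c0 - f y) =
    (2 * q) ^+ n.+1 * (c0 - cube_average f w q).
  rewrite (RintegralB mQ Icst (If w q)).
  rewrite Rintegral_cst// LQ/= /cube_average LQ/= mulrBr [c0 * _]mulrC.
  by rewrite mulrA divff ?mul1r// gt_eqF.
have ID : L.-integrable (cube w q) (EFin \o (fun y => c0 - f y)).
  exact: (integrableB mQ Icst (If w q)).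
have nDE : (`|(2 * q) ^+ n.+1 * (c0 - cube_average f w q)|%:E <=
    \int[L]_(y in cube w q) `|c0 - f y|%:E)%E.
  rewrite -DE (EFin_normr_Rintegral mQ ID).
  apply: (@le_trans _ _ _ _ _ (le_abse_integral L mQ (measurable_int _ ID))).
  by rewrite le_eqVlt; apply/orP; left; apply/eqP; apply: eq_integral.
have up : (\int[L]_(y in cube w q) `|c0 - f y|%:E <=
   ((e / 3 + K * a) * (2 * q) ^+ n.+1 + q ^+ n.+1 * (a * th ^+ J))%:E)%E.
  apply: (@le_trans _ _ (\int[L]_(y in cube w q)
      ((e / 3 + K * a)%:E + `|f y - ev (Ps J) y|%:E))%E).
    apply: ge0_le_integral; first exact: mQ.
    - by move=> y _; rewrite lee_fin.
    - apply/measurable_EFinP; apply: (measurableT_comp (@normr_measurable R setT)).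
      apply: measurable_funB; first exact: measurable_cst.
      exact: (measurable_funS measurableT (@subsetT _ _) mf).
    - apply: emeasurable_funD; first exact: measurable_cst.
      exact: measurable_err.
    move=> y yQ; rewrite -EFinD lee_fin.
    have -> : c0 - f y = (c0 - ev (Ps 0%N) y) + ((ev (Ps 0%N) y - ev (Ps J) y)
       + (ev (Ps J) y - f y)) by ring.
    apply: (le_trans (ler_normD _ _)); rewrite -[leRHS]addrA; apply: lerD.
      by rewrite distrC; apply: Pc => i; apply: le_trans (yQ i) _.
    apply: (le_trans (ler_normD _ _)); apply: lerD; last by rewrite distrC.
    by rewrite distrC; exact: chainJ.
  rewrite ge0_integralD; [|exact: mQ| |exact: measurable_cst| |exact: measurable_err].
  - rewrite [leRHS]EFinD; apply: leeD; last exact: errJ.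
    by rewrite (integral_cst _ mQ) LQ EFinM.
  - by move=> y _; rewrite lee_fin addr_ge0 ?mulr_ge0// ltW.
  - by move=> y _; rewrite lee_fin.
have := le_trans nDE up; rewrite lee_fin normrM gtr0_norm// => fin.
have qq : q ^+ n.+1 * (a * th ^+ J) <= (2 * q) ^+ n.+1 * (e / 3).
  apply: ler_pM => //; rewrite ?exprn_ge0 ?(ltW q0)//.
    by rewrite mulr_ge0// exprn_ge0// ltW.
  have q0' := ltW q0.
  by rewrite lerXn2r ?nnegrE// ?mulr_ge0// ler_peMl// ler1n.
have h2 : `|c0 - cube_average f w q| <= e / 3 + K * a + e / 3.
  rewrite -(ler_pM2l q2); apply: (le_trans fin); lra.
have h3 : `|cube_average f w q| <= e / 3 by apply: avgd => //; lra.
rewrite -/c0; have -> : c0 = (c0 - cube_average f w q) + cube_average f w q by ring.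
by apply: (le_trans (ler_normD _ _)); lra.
Qed.

(** The form in which the smoothness of [f] enters the estimates. *)
Definition controls (k : nat) (s t0 : R) (f : V -> R) (G : V -> \bar R) :=
  forall x t, 0 < t -> t <= t0 -> exists2 P, (msz P <= k)%N &
    forall y, cube x t y -> (errint f P x t <= (t ^+ n.+1 * t `^ s)%:E * G y)%E.

(** The piecewise polynomial approximations on finer and finer grids converge
    to [f] in mean, and stay within a multiple of [G] of the initial polynomial.
    This avoids a differentiation theorem for [f]. *)
Lemma ae_poly_le (k : nat) (s : R) : 0 < s -> exists2 K, 0 < K &
  forall f G t0, Lmeasurable f -> measurable_fun [set: Rn R n.+1] (G : Rn R n.+1 -> \bar R) ->
  (forall y, 0 <= G y)%E -> controls k s t0 f G ->
  forall P x0 (r : R), 0 < r -> r <= t0 -> (msz P <= k)%N ->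
  (forall y, cube x0 r y -> (errint f P x0 r <= (r ^+ n.+1 * r `^ s)%:E * G y)%E) ->
  (\int[L]_(y in cube x0 r) G y < +oo)%E ->
  exists2 Z : set (Rn R n.+1), measurable Z /\ L Z = 0%E &
    forall x, cube x0 (r / 4) x -> ~ Z x ->
      (`|f x - ev P x|%:E <= (K * r `^ s)%:E * G x)%E.
Proof.
move=> s0; pose th := 2^-1 `^ s.
have th0 : 0 < th by rewrite powR_gt0.
have th1 : th < 1 by exact: powR_half_lt1.
have [K K0 HK] := poly_chain k th0 th1.
exists K => // f G t0 mf mG G0 ctl P x0 r r0 rt0 sP err0 IG.
pose rho j := r / 2 ^+ j.
have rho0 j : 0 < rho j by rewrite divr_gt0// exprn_gt0.
have rho_le j : rho j <= r.
  by rewrite ler_piMr ?(ltW r0)// invf_le1 ?exprn_gt0// exprn_ege1//; lra.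
have rhoS j : rho j = 2 * rho j.+1.
  by rewrite /rho exprS; field; rewrite gt_eqF// exprn_gt0.
have rho_s j : rho j `^ s = r `^ s * th ^+ j.
  rewrite /rho powRM ?(ltW r0)// ?invr_ge0 ?exprn_ge0//; congr (_ * _).
  by rewrite /th -powR_mulrn ?powR_ge0// -powRrM mulrC powRrM powR_mulrn// exprVn.
pose h j := rho j / 2.
have h0 j : 0 < h j by rewrite divr_gt0.
have hr j : h j = rho j / 2 by [].
pose c j m := cell_center (h j) m : V.
have /choice[Q HQ] (jm : nat * nat) : exists Q, (msz Q <= k)%N /\
    forall y, cube (c jm.1 jm.2) (rho jm.1) y ->
      (errint f Q (c jm.1 jm.2) (rho jm.1) <=
       (rho jm.1 ^+ n.+1 * rho jm.1 `^ s)%:E * G y)%E.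
  have [Q sQ HQ] := ctl (c jm.1 jm.2) _ (rho0 jm.1) (le_trans (rho_le _) rt0).
  by exists Q.
have xc j x : cube (c j (grid_index (h j) x)) (h j / 2) x by apply: cell_sub_cube.
have near J x : cube x0 (r / 4) x -> (G x < +oo)%E ->
    (`|ev (Q (J.+1, grid_index (h J.+1) x)) x - ev P x|%:E <= (K * r `^ s)%:E * G x)%E.
  move=> xx0 Gx; have Gf : G x \is a fin_num by rewrite ge0_fin_numE.
  rewrite -(fineK Gf) -EFinM lee_fin.
  have g0 : 0 <= fine (G x) by rewrite fine_ge0.
  (* The chain starts from [P] and descends through the cells around [x]. *)
  pose Ps j := if j is j'.+1 then Q (j, grid_index (h j) x) else P.
  pose cs j : V := if j is j'.+1 then c j (grid_index (h j) x) else x0.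
  have xcs j : forall i, `|x 0 i - cs j 0 i| <= rho j / 4.
    case: j => [|j] i; first by rewrite /rho expr0 divr1; exact: xx0.
    by have := xc j.+1 x i; rewrite /h; lra.
  have xin j : cube (cs j) (rho j) x.
    by move=> i; apply: le_trans (xcs j i) _; have := rho0 j; lra.
  rewrite -mulrA; apply: (HK f mf Ps cs r (r `^ s * fine (G x)) r0 _ _ _ _ J.+1 x).
  - by rewrite mulr_ge0// powR_ge0.
  - by case=> [//|j]; exact: (HQ (j.+1, _)).1.
  - move=> j; apply: cube_sub => i; rewrite -!/(rho _).
    have -> : cs j.+1 0 i - cs j 0 i = (x 0 i - cs j 0 i) - (x 0 i - cs j.+1 0 i) by ring.
    have := ler_normB (x 0 i - cs j 0 i) (x 0 i - cs j.+1 0 i).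
    have := xcs j i; have := xcs j.+1 i; rewrite (rhoS j); have := rho0 j.+1; lra.
  - move=> j; rewrite -!/(rho _).
    have -> : rho j ^+ n.+1 * (r `^ s * fine (G x) * th ^+ j) =
      rho j ^+ n.+1 * rho j `^ s * fine (G x) by rewrite rho_s; ring.
    rewrite EFinM (fineK Gf); case: j (xin j) => [|j] xj.
      by move: xj; rewrite /rho expr0 divr1; exact: err0.
    exact: (HQ (j.+1, _)).2.
  - exact: (xin J.+1).
pose B m : set V := cube x0 (r / 4) `&`
  [set x | ((K * r `^ s)%:E * G x + (m.+1%:R^-1)%:E <= `|f x - ev P x|%:E)%E].
have mQ x r' : measurable (cube x r' : set (Rn R n.+1)) by exact: measurable_cube.
have mGD (D : set (Rn R n.+1)) : measurable_fun D (G : Rn R n.+1 -> \bar R).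
  exact: (measurable_funS measurableT (@subsetT _ _) mG).
have mB m : measurable (B m : set (Rn R n.+1)).
  apply: measurable_lee; first exact: mQ.
    apply: emeasurable_funD; last exact: measurable_cst.
    apply: emeasurable_funM; first exact: measurable_cst.
    exact: mGD.
  exact: measurable_err.
have LB m : L (B m) = 0%E.
  have m0 : 0 < m.+1%:R^-1 :> R by rewrite invr_gt0.
  set M := (\int[L]_(y in cube x0 r) G y)%E in IG.
  have M0 : (0 <= M)%E by apply: integral_ge0 => y _.
  have Mf : M \is a fin_num by rewrite ge0_fin_numE.
  (* At the points of [B m] the approximation on the cell of level [J.+1] is at
     distance at least [m.+1%:R^-1] from [f], whereas its mean error is small. *)
  have key J : ((m.+1%:R^-1)%:E * L (B m) <= (2 ^+ n.+1 * rho J.+1 `^ s)%:E * M)%E.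
    set j := J.+1.
    have mc l : measurable (cell (h j) l : set (Rn R n.+1)) by exact: measurable_cell.
    have mBc l : measurable (B m `&` cell (h j) l : set (Rn R n.+1)) by exact: measurableI.
    have tri : trivIset setT (fun l => cube x0 r `&` cell (h j) l).
      exact/trivIset_setIl/cell_trivIset.
    have LBE : L (B m) = (\sum_(l <oo) L (B m `&` cell (h j) l))%E.
      have E : \bigcup_l (B m `&` cell (h j) l) = B m.
        by rewrite -setI_bigcupr cell_bigcup setIT.
      transitivity (\int[L]_(y in B m) cst 1%E y)%E.
        by rewrite (integral_cst L (mB m)) mul1e.
      rewrite -{1}E ge0_integral_bigcup; last 4 first.
      - exact: mBc.
      - exact: measurable_cst.
      - by move=> y _; rewrite lee01.
      - exact/trivIset_setIl/cell_trivIset.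
      by apply: eq_eseriesr => l _; rewrite (integral_cst L (mBc l)) mul1e.
    have ME : M = (\sum_(l <oo) \int[L]_(y in cube x0 r `&` cell (h j) l) G y)%E.
      have E : \bigcup_l (cube x0 r `&` cell (h j) l) = cube x0 r.
        by rewrite -setI_bigcupr cell_bigcup setIT.
      rewrite /M -{1}E ge0_integral_bigcup//.
      by move=> l; exact: measurableI.
    rewrite LBE ME -nneseriesZl; last by move=> l _; exact: measure_ge0.
    rewrite -nneseriesZl; last by move=> l _; apply: integral_ge0.
    apply: lee_nneseries => [l _ _|l _].
      by rewrite mule_ge0 ?lee_fin ?(ltW m0)//; exact: measure_ge0.
    have [->|/set0P[x [[xx0 _] xl]]] := eqVneq (B m `&` cell (h j) l) set0.
      rewrite measure0 mule0 mule_ge0//; first by rewrite lee_fin mulr_ge0// powR_ge0.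
      by apply: integral_ge0.
    set I := errint f (Q (j, l)) (c j l) (rho j).
    have cc : cell (h j) l `<=` cube (c j l) (h j / 2) by apply: cell_sub_cube.
    have lQ : cell (h j) l `<=` cube x0 r.
      move=> y yl i; have -> : y 0 i - x0 0 i =
         (x 0 i - x0 0 i) + ((y 0 i - c j l 0 i) - (x 0 i - c j l 0 i)) by ring.
      apply: (le_trans (ler_normD _ _)); apply: (le_trans (lerD (xx0 i) (ler_normB _ _))).
      have := cc _ yl i; have := cc _ xl i; have := rho_le j; rewrite hr; lra.
    have lc : cell (h j) l `<=` cube (c j l) (rho j).
      by move=> y /cc yc i; apply: le_trans (yc i) _; have := rho0 j; rewrite hr; lra.
    have I0 : (0 <= I)%E by apply: integral_ge0 => y _; rewrite lee_fin.
    have s1 : ((m.+1%:R^-1)%:E * L (B m `&` cell (h j) l) <= I)%E.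
      rewrite -(integral_cst L (mBc l)).
      apply: (@le_trans _ _ (\int[L]_(y in B m `&` cell (h j) l) `|f y - ev (Q (j, l)) y|%:E)%E).
        apply: ge0_le_integral; first exact: mBc.
        - by move=> y _; rewrite lee_fin ltW.
        - exact: measurable_cst.
        - exact: measurable_err.
        move=> y [[yx0 /= yB] yl].
        have [Gy|Gy] := ltP (G y) +oo%E; last first.
          have Gy' : G y = +oo%E by apply/eqP; rewrite -leye_eq.
          by move: yB; rewrite Gy' gt0_muley ?lte_fin ?mulr_gt0 ?powR_gt0.
        have := near J y yx0 Gy; rewrite -/j (_ : grid_index _ y = l)//.
        have Gf : G y \is a fin_num by rewrite ge0_fin_numE.
        move: yB; rewrite -(fineK Gf) -EFinM -EFinD !lee_fin => h1 h2.
        have e : f y - ev P y = (f y - ev (Q (j, l)) y) + (ev (Q (j, l)) y - ev P y).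
          by rewrite addrA subrK.
        rewrite e in h1; have := le_trans h1 (le_trans (ler_normD _ _) (lerD (lexx _) h2)).
        by rewrite addrC lerD2r.
      apply: ge0_subset_integral; [exact: mBc|exact: mQ|exact: measurable_err| |].
        by move=> y _; rewrite lee_fin.
      by move=> y [_ /lc].
    have s2 : (I * (h j ^+ n.+1)%:E <= (rho j ^+ n.+1 * rho j `^ s)%:E *
        \int[L]_(y in cube x0 r `&` cell (h j) l) G y)%E.
      rewrite (_ : cube x0 r `&` cell (h j) l = cell (h j) l); last exact/setIidr.
      rewrite -(lebn_cell (h0 j) (ex_intro _ x xl)) -(integral_cst L (mc l)).
      rewrite -ge0_integralZl; [|exact: mc|exact: mGD|by move=> y _; exact: G0|]; last first.
        by rewrite lee_fin mulr_ge0 ?powR_ge0// exprn_ge0// ltW.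
      apply: ge0_le_integral; first exact: mc.
      - by move=> y _; exact: I0.
      - exact: measurable_cst.
      - by apply: emeasurable_funM; [exact: measurable_cst|exact: mGD].
      by move=> y yl; apply: (HQ (j, l)).2; exact: lc.
    apply: (le_trans s1).
    have hj0 : 0 < h j ^+ n.+1 by rewrite exprn_gt0.
    have -> : (2 ^+ n.+1 * rho j `^ s) = (h j ^+ n.+1)^-1 * (rho j ^+ n.+1 * rho j `^ s).
      have -> : rho j = 2 * h j by rewrite /h; field.
      rewrite [(2 * h j) ^+ n.+1]exprMn; field.
      by rewrite gt_eqF.
    rewrite EFinM -muleA.
    apply: (@le_trans _ _ ((h j ^+ n.+1)^-1%:E * (I * (h j ^+ n.+1)%:E))%E).
      by rewrite muleCA -EFinM mulVf ?mule1// gt_eqF.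
    by rewrite lee_wpmul2l// lee_fin invr_ge0 ltW.
  apply/eqP; rewrite eq_le measure_ge0 andbT.
  have : ((m.+1%:R^-1)%:E * L (B m) <= 0)%E.
    apply/lee_addgt0Pr => e e0; rewrite add0e.
    have [J hJ] := filter_ex (small_pow (2 ^+ n.+1 * r `^ s * fine M) (ltW th0) th1 e0).
    apply: (le_trans (key J)); rewrite -(fineK Mf) -EFinM lee_fin; apply: le_trans hJ.
    rewrite rho_s [th ^+ J.+1]exprS.
    have -> : 2 ^+ n.+1 * (r `^ s * (th * th ^+ J)) * fine M =
      th * (2 ^+ n.+1 * r `^ s * fine M * th ^+ J) by ring.
    rewrite ler_piMl ?(ltW th1)//.
    by rewrite !mulr_ge0 ?fine_ge0 ?powR_ge0// exprn_ge0// ltW.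
  by rewrite pmule_rle0// lte_fin.
exists (\bigcup_m B m); first split.
- by apply: bigcup_measurable => m _; exact: mB.
- apply/eqP; rewrite eq_le measure_ge0 andbT.
  apply: (le_trans (lebesgue_outer_sigma_subadditive B)).
  by rewrite eseries0// => m _ _; exact: LB.
move=> x xx0 nZ; have [Gx|Gx] := ltP (G x) +oo%E; last first.
  have -> : G x = +oo%E by apply/eqP; rewrite -leye_eq.
  by rewrite gt0_muley ?leey// lte_fin mulr_gt0// powR_gt0.
have Gf : G x \is a fin_num by rewrite ge0_fin_numE.
rewrite leNgt -(fineK Gf) -EFinM lte_fin; apply/negP => lt.
have d0 : 0 < `|f x - ev P x| - K * r `^ s * fine (G x) by lra.
have [m hm] := filter_ex (near_infty_natSinv_lt (PosNum d0)).
apply: nZ; exists m => //; split=> //=.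
by rewrite -(fineK Gf) -EFinM -EFinD lee_fin ltW// -ltrBrDl.
Qed.

End poly_mean.

(** * Hausdorff measure and [d]-sets *)

Lemma powRXn (R : realType) (x a : R) m : 0 <= x ->
  (x ^+ m) `^ a = (x `^ a) ^+ m.
Proof.
move=> x0; rewrite -[x ^+ m]powR_mulrn// -powRrM mulrC powRrM.
by rewrite powR_mulrn ?powR_ge0.
Qed.

Lemma powR_invl (R : realType) (x a : R) : 0 <= x -> x^-1 `^ a = (x `^ a)^-1.
Proof. by move=> x0; rewrite -[x^-1]powR_inv1// -powRrM mulN1r powRN. Qed.

Section hausdorff.
Context {R : realType} {n : nat}.
Local Notation V := 'rV[R]_n.+1.
Variable d : R.
Hypothesis d0 : 0 < d.
Local Notation content := (@hausdorff_content R n.+1 d).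
Local Notation H := (@hausdorff_measure R n.+1 d).
Implicit Types (A B : set V) (x y w z : V) (delta : R).

Lemma diameter_ge0 A : (0 <= diameter A)%E.
Proof. by apply: ereal_sup_ubound; left. Qed.

Lemma diameter0 : diameter (set0 : set V) = 0%E.
Proof.
apply/eqP; rewrite eq_le diameter_ge0 andbT.
by apply: ge_ereal_sup => _ [->//|[x []]].
Qed.

Lemma edist_le_diameter A x y : A x -> A y -> (edist (x, y) <= diameter A)%E.
Proof.
by move=> Ax Ay; apply: ereal_sup_ubound; right; exists x => //; exists y.
Qed.

Lemma content_ge0 delta A : (0 <= content delta A)%E.
Proof.
apply: le_ereal_inf_tmp => _ [E _ <-].
by apply: nneseries_ge0 => k _ _; exact: poweR_ge0.
Qed.

Lemma content_le_hausdorff delta A : 0 < delta -> (content delta A <= H A)%E.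
Proof. by move=> delta0; apply: ereal_sup_ubound; exists delta. Qed.

Lemma le_content delta A B : A `<=` B -> (content delta A <= content delta B)%E.
Proof.
move=> AB; apply: ereal_inf_le_tmp => _ [E [BE Ed] <-]; exists E => //; split=> //.
exact: subset_trans BE.
Qed.

Lemma content_antimono delta delta' A : delta <= delta' ->
  (content delta' A <= content delta A)%E.
Proof.
move=> dd; apply: ereal_inf_le_tmp => _ [E [BE Ed] <-]; exists E => //; split=> // k.
by apply: le_trans (Ed k) _; rewrite lee_fin.
Qed.

Lemma hausdorff_ge0 A : (0 <= H A)%E.
Proof.
by apply: le_trans (content_ge0 1 A) _; exact: content_le_hausdorff.
Qed.

Lemma le_hausdorff : {homo H : A B / A `<=` B >-> (A <= B)%E}.
Proof.
move=> A B AB; apply: ge_ereal_sup => _ [delta delta0 <-].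
by apply: le_trans (le_content delta AB) _; exact: content_le_hausdorff.
Qed.

Lemma hausdorff0 : H set0 = 0%E.
Proof.
apply/eqP; rewrite eq_le hausdorff_ge0 andbT.
apply: ge_ereal_sup => _ [delta /= delta0 <-]; apply: ereal_inf_lbound.
exists (fun=> set0).
  by split=> // k; rewrite diameter0 lee_fin ltW.
by rewrite eseries0// => k _ _; rewrite diameter0 poweR0r// gt_eqF.
Qed.

Lemma content_sigma_subadditive delta (A : nat -> set V) :
  (content delta (\bigcup_k A k) <= \sum_(k <oo) content delta (A k))%E.
Proof.
have [[i ioo]|] := pselect (exists i, content delta (A i) = +oo%E).
  rewrite (eseries_pinfty _ _ ioo) ?leey// => k _.
  by rewrite -ltNye (lt_le_trans _ (content_ge0 _ _)).
rewrite -forallNE => Aoo.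
apply/lee_addgt0Pr => e e0.
rewrite (le_trans _ (epsilon_trick _ _ (ltW e0)))//; last first.
  by move=> k; exact: content_ge0.
pose P k (E : nat -> set V) := (A k `<=` \bigcup_j E j /\
    forall j, (diameter (E j) <= delta%:E)%E) /\
  (\sum_(j <oo) diameter (E j) `^ d <=
   content delta (A k) + (e / (2 ^ k.+1)%:R)%:E)%E.
have [G PG] : {G : nat -> nat -> set V & forall k, P k (G k)}.
  apply: (@choice _ _ P) => k; rewrite /P.
  have e1 : 0 < e / (2 ^ k.+1)%:R by rewrite divr_gt0// ltr0n expn_gt0.
  have fA : content delta (A k) \is a fin_num.
    by rewrite ge0_fin_numE ?content_ge0// ltey; apply/eqP/Aoo.
  have [_ [E EA <-] /ltW EAe] := lb_ereal_inf_adherent e1 fA.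
  by exists E; split.
have /card_set_bijP[p pbij] : ([set: nat] #= [set: nat * nat])%card.
  by rewrite card_eq_sym card_nat2.
pose a (q : nat * nat) : \bar R := (diameter (G q.1 q.2) `^ d)%E.
have a0 q : (0 <= a q)%E by exact: poweR_ge0.
apply: (@le_trans _ _ (\sum_(k <oo) a (p k))%E).
  apply: ereal_inf_lbound; exists (fun k => G (p k).1 (p k).2) => //; split.
    move=> x [i _ /(PG i).1.1[j _ Gx]].
    have [_ _ /(_ (i, j) I)[k _ pk]] := pbij.
    by exists k => //; rewrite pk.
  by move=> k; exact: (PG _).1.2.
rewrite nneseries_esumT// -(@reindex_esum _ _ _ _ _ p a pbij).
rewrite (_ : [set: nat * nat] = [set: nat] `*`` (fun=> [set: nat])); last first.
  by apply/seteqP; split.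
rewrite -(@esum_esum _ _ _ _ _ (fun i j => diameter (G i j) `^ d)%E); last first.
  by move=> i j _ _; exact: poweR_ge0.
rewrite nneseries_esumT; last first.
  by move=> k; rewrite adde_ge0 ?content_ge0// lee_fin divr_ge0// ltW.
apply: le_esum => k _; rewrite -nneseries_esumT; first exact: (PG k).2.
by move=> j; exact: poweR_ge0.
Qed.

Lemma hausdorff_sigma_subadditive (A : nat -> set V) :
  (H (\bigcup_k A k) <= \sum_(k <oo) H (A k))%E.
Proof.
apply: ge_ereal_sup => _ [delta delta0 <-].
apply: le_trans (content_sigma_subadditive _ _) _.
apply: lee_nneseries => [k _ _|k _]; first exact: content_ge0.
exact: content_le_hausdorff.
Qed.

Lemma hausdorffU A B : (H (A `|` B) <= H A + H B)%E.
Proof.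
have := hausdorff_sigma_subadditive (fun k => if k is 0%N then A else if k is 1%N then B else set0).
rewrite (_ : \bigcup_k _ = A `|` B); last first.
  apply/seteqP; split=> [x [[|[|k]] _]//|x [Ax|Bx]]; [by left|by right| |].
    by exists 0%N.
  by exists 1%N.
move=> /le_trans; apply; rewrite (nneseries_split 0 2); last by move=> *; exact: hausdorff_ge0.
rewrite add0n !big_nat_recl// big_nil/= adde0 eseries0 ?adde0// => k /=.
by case: k => [|[|k]]// _ _; exact: hausdorff0.
Qed.

(** A set of diameter at most [eta] cannot meet both of two sets that are more
    than [eta] apart, so that every fine cover splits. *)
Lemma hausdorff_superadditive (eta : R) A B : 0 < eta ->
  (forall x y, A x -> B y -> (eta%:E < edist (x, y))%E) ->
  (H A + H B <= H (A `|` B))%E.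
Proof.
move=> eta0 sep.
have key delta : 0 < delta -> delta <= eta ->
    (content delta A + content delta B <= content delta (A `|` B))%E.
  move=> delta0 de; apply: le_ereal_inf_tmp => _ [E [AE Ed] <-].
  pose cut (X : set V) k := if pselect (E k `&` X !=set0) then E k else set0.
  have cutE X : (content delta X <= \sum_(k <oo) diameter (cut X k) `^ d)%E \/ ~ X `<=` A `|` B.
    have [XE|] := pselect (X `<=` A `|` B); last by right.
    left; apply: ereal_inf_lbound; exists (cut X) => //; split.
      move=> x Xx; have [k _ Ekx] := AE x (XE x Xx); exists k => //.
      by rewrite /cut; case: pselect => // -[]; exists x.
    move=> k; rewrite /cut; case: (pselect (E k `&` X !=set0)) => _ /=; first exact: Ed.
    by rewrite diameter0 lee_fin ltW.
  have cA : (content delta A <= \sum_(k <oo) diameter (cut A k) `^ d)%E.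
    by have [//|[]] := cutE A; exact: subsetUl.
  have cB : (content delta B <= \sum_(k <oo) diameter (cut B k) `^ d)%E.
    by have [//|[]] := cutE B; exact: subsetUr.
  apply: le_trans (leeD cA cB) _.
  rewrite -nneseriesD; [|by move=> *; exact: poweR_ge0..].
  apply: lee_nneseries => [k _ _|k _]; first by rewrite adde_ge0// poweR_ge0.
  have z0 : ((diameter (set0 : set V) `^ d) = 0)%E by rewrite diameter0 poweR0r// gt_eqF.
  rewrite /cut; case: (pselect (E k `&` A !=set0)) => hA /=; last first.
    rewrite z0 add0e; case: (pselect (E k `&` B !=set0)) => _ //=.
    by rewrite z0 poweR_ge0.
  case: (pselect (E k `&` B !=set0)) => hB /=; last by rewrite z0 adde0.
  have [[x [Ex Ax]] [y [Ey By]]] := (hA, hB).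
  have := lt_le_trans (sep x y Ax By) (edist_le_diameter Ex Ey).
  by rewrite ltNge (le_trans (Ed k))// lee_fin.
have [HU|HU] := ltP (H (A `|` B)) +oo%E; last first.
  by have -> : H (A `|` B) = +oo%E; [apply/eqP; rewrite -leye_eq|rewrite leey].
have finU (X : set V) : X `<=` A `|` B -> H X \is a fin_num.
  move=> XU; rewrite ge0_fin_numE ?hausdorff_ge0//.
  by apply: le_lt_trans (le_hausdorff XU) HU.
have fA : H A \is a fin_num by apply: finU; exact: subsetUl.
have fB : H B \is a fin_num by apply: finU; exact: subsetUr.
apply/lee_addgt0Pr => e e0.
have e20 : 0 < e / 2 by rewrite divr_gt0.
have [_ [d1 /= d10 <-] h1] := ub_ereal_sup_adherent e20 fA.
have [_ [d2 /= d20 <-] h2] := ub_ereal_sup_adherent e20 fB.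
pose delta := Num.min (Num.min d1 d2) eta.
have delta0 : 0 < delta by rewrite !lt_min d10 d20 eta0.
have le1 : delta <= d1 by rewrite !ge_min lexx.
have le2 : delta <= d2 by rewrite !ge_min lexx orbT.
have le3 : delta <= eta by rewrite ge_min lexx orbT.
have := le_trans (key delta delta0 le3) (content_le_hausdorff (A `|` B) delta0).
have := lt_le_trans h1 (content_antimono A le1).
have := lt_le_trans h2 (content_antimono B le2).
have := content_ge0 delta A; have := content_ge0 delta B.
have fU : H (A `|` B) \is a fin_num by exact: finU.
rewrite -/(H A) -/(H B) -(fineK fA) -(fineK fB) -(fineK fU).
case: (content delta A) => [a| |]; case: (content delta B) => [b| |] //.
  by rewrite -!EFinB -!EFinD !lte_fin !lee_fin; lra.
Qed.

Lemma edist_gt x y (eta : R) i : eta < `|x 0 i - y 0 i| -> (eta%:E < edist (x, y))%E.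
Proof.
move=> h; rewrite ltNge; apply/negP => le.
have : (edist (x, y) < `|x 0 i - y 0 i|%:E)%E by apply: le_lt_trans le _; rewrite lte_fin.
move=> /edist_lt_ball [_ /(_ 0 i)]/=; rewrite -ball_normE/=.
by rewrite ltxx.
Qed.

Definition separated (l : R) z z' : bool := [exists i, l < `|z 0 i - z' 0 i|].

Lemma separatedC l z z' : separated l z z' = separated l z' z.
Proof. by apply: eq_existsb => i; rewrite distrC. Qed.

(** Cubes whose radius is a quarter of the separation stay apart. *)
Lemma hausdorff_sum_separated (S : set V) (l : R) (zs : seq V) : 0 < l ->
  pairwise (separated l) zs ->
  (\sum_(z <- zs) H (cube z (l / 4) `&` S) <=
     H (\bigcup_(z in [set` zs]) (cube z (l / 4) `&` S)))%E.
Proof.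
move=> l0; elim: zs => [|z zs IH]; first by rewrite big_nil hausdorff_ge0.
rewrite pairwise_cons => /andP[zsep /IH {}IH]; rewrite big_cons.
apply: (le_trans (leeD2l _ IH)).
have l40 : 0 < l / 4 by rewrite divr_gt0.
apply: le_trans (hausdorff_superadditive l40 _) _.
  move=> x y [xz _] [z' /= z'zs [yz' _]].
  have /existsP[i hi] := allP zsep _ z'zs; apply: (@edist_gt _ _ _ i).
  have := ler_distD (x 0 i) (z 0 i) (z' 0 i).
  have := ler_distD (y 0 i) (x 0 i) (z' 0 i).
  by have := xz i; have := yz' i; rewrite [`|x 0 i - z 0 i|]distrC; lra.
apply: le_hausdorff => x [xz|[z' /= z'zs xz']].
  by exists z => //=; rewrite inE eqxx.
by exists z' => //=; rewrite inE z'zs orbT.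
Qed.

(** A separated family of maximal size is a net. *)
Lemma separated_net (B : set V) (l : R) (M : nat) :
  (forall zs, pairwise (separated l) zs -> {in zs, forall z, B z} -> (size zs <= M)%N) ->
  exists zs, [/\ pairwise (separated l) zs, {in zs, forall z, B z} &
    forall y, B y -> exists2 z, z \in zs & cube z l y].
Proof.
move=> bnd.
pose Pm m := `[< exists zs, [/\ pairwise (separated l) zs, {in zs, forall z, B z} &
  size zs = m] >].
have exP : exists m, Pm m by exists 0%N; apply/asboolP; exists [::].
have ubP m : Pm m -> (m <= M)%N by move=> /asboolP[zs [z1 z2 <-]]; exact: bnd.
case: (ex_maxnP exP ubP) => m /asboolP[zs [z1 z2 zm]] mmax.
exists zs; split=> // y By; apply: contrapT => nc.
have : Pm m.+1.
  apply/asboolP; exists (y :: zs); split; last by rewrite /= zm.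
    rewrite pairwise_cons z1 andbT; apply/allP => z zzs; apply/existsP.
    apply: contrapT => /forallNP ns; apply: nc; exists z => // i.
    by have /negP := ns i; rewrite -leNgt.
  by move=> z; rewrite inE => /predU1P[->//|/z2].
by move=> /mmax; rewrite ltnn.
Qed.

Section dset.
Variables (S : set V) (C : R).
Hypothesis C1 : 1 < C.
Hypothesis HS : forall w (r : R), S w -> 0 < r <= 1 ->
  ((C^-1 * r `^ d)%:E <= H (cube w r `&` S) <= (C * r `^ d)%:E)%E.

(** The cubes of radius [l / 4] around the points carry masses comparable to
    [l `^ d] of the set, and these masses add up. *)
Lemma dset_packing w (l rad : R) zs : S w -> 0 < l -> l <= rad -> rad <= 2^-1 ->
  pairwise (separated l) zs -> {in zs, forall z, (S `&` cube w rad) z} ->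
  (size zs)%:R <= C ^+ 2 * (8 * rad / l) `^ d.
Proof.
move=> Sw l0 lr r12 zsep zS.
have C0 : 0 < C by exact: lt_trans ltr01 C1.
have rad0 : 0 < rad by lra.
have l40 : 0 < l / 4 <= 1 by apply/andP; split; [rewrite divr_gt0|lra].
have h1 : (((size zs)%:R * (C^-1 * (l / 4) `^ d))%:E <= (C * (2 * rad) `^ d)%:E)%E.
  have r21 : 0 < 2 * rad <= 1 by apply/andP; lra.
  have /andP[_] := HS Sw r21; apply: le_trans.
  apply: (@le_trans _ _ (\sum_(z <- zs) H (cube z (l / 4) `&` S))%E); last first.
    apply: le_trans (hausdorff_sum_separated S l0 zsep) _.
    apply: le_hausdorff => x [z /= /zS[Sz zw] [xz Sx]]; split=> // i.
    have := ler_distD (z 0 i) (x 0 i) (w 0 i).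
    by have := xz i; have := zw i; lra.
  apply: (@le_trans _ _ (\sum_(z <- zs) (C^-1 * (l / 4) `^ d)%:E)%E).
    by rewrite sumEFin big_const_seq count_predT iter_addr addr0 mulr_natl.
  rewrite big_seq [leRHS]big_seq; apply: lee_sum => z /zS[Sz _].
  by have /andP[] := HS Sz l40.
have p0 : 0 < (l / 4) `^ d by rewrite powR_gt0//; lra.
have -> : C ^+ 2 * (8 * rad / l) `^ d = C * (2 * rad) `^ d / (C^-1 * (l / 4) `^ d).
  have -> : 8 * rad / l = (2 * rad) / (l / 4) by field; rewrite gt_eqF.
  rewrite powRM; [|by lra|by rewrite invr_ge0; lra].
  have -> : (l / 4)^-1 `^ d = ((l / 4) `^ d)^-1.
    by rewrite powR_invl//; lra.
  by field; rewrite !gt_eqF.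
by rewrite ler_pdivlMr// mulr_gt0// invr_gt0.
Qed.

(** The neighbourhood is covered by the cubes of radius [2 * t] around a maximal
    [t]-separated subset, which has at most about [(rho / t) `^ d] points. *)
Lemma nbhd_measure : exists2 K, 0 < K & forall w (rho t : R), S w -> 0 < t ->
  t <= rho -> rho <= 4^-1 ->
  (lebn R n.+1 (cube w rho `&` [set y | exists2 z, S z & cube z t y]) <=
   (K * rho ^+ n.+1 * (t / rho) `^ (n.+1%:R - d))%:E)%E.
Proof.
have C0 : 0 < C by exact: lt_trans ltr01 C1.
exists (C ^+ 2 * 16 `^ d * 4 ^+ n.+1).
  by rewrite !mulr_gt0 ?powR_gt0 ?exprn_gt0.
move=> w rho t Sw t0 trho rho4.
have rho0 : 0 < rho by lra.
have tr2 : t <= 2 * rho by lra.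
have rr2 : 2 * rho <= 2^-1 by lra.
have pack zs : pairwise (separated t) zs -> {in zs, forall z, (S `&` cube w (2 * rho)) z} ->
    (size zs)%:R <= C ^+ 2 * (8 * (2 * rho) / t) `^ d.
  by move=> h1 h2; apply: (dset_packing Sw).
have bnd zs : pairwise (separated t) zs -> {in zs, forall z, (S `&` cube w (2 * rho)) z} ->
    (size zs <= Num.truncn (C ^+ 2 * (8 * (2 * rho) / t) `^ d))%N.
  move=> h1 h2; rewrite truncn_ge_nat ?pack//.
  by rewrite mulr_ge0 ?exprn_ge0 ?powR_ge0 ?(ltW C0).
have [zs [z1 z2 z3]] := separated_net bnd.
apply: (le_trans (le_sum_cover (F := fun z => cube z (2 * t)) (s := zs)
    lebn0 lebn_mono lebn_setU _)).
  move=> y [yw [z Sz zy]].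
  have zw : cube w (2 * rho) z.
    move=> i; have := ler_distD (y 0 i) (z 0 i) (w 0 i); have := yw i.
    by have := zy i; rewrite [`|y 0 i - _|]distrC; lra.
  have [z' z's zz'] := z3 z (conj Sz zw); exists z' => // i.
  by have := ler_distD (z 0 i) (y 0 i) (z' 0 i); have := zy i; have := zz' i; lra.
rewrite (eq_bigr (fun=> ((4 * t) ^+ n.+1)%:E)); last first.
  by move=> z _; rewrite lebn_cube ?mulr_ge0 ?(ltW t0)//; congr ((_ ^+ _)%:E); ring.
rewrite sumEFin big_const_seq count_predT iter_addr addr0 lee_fin -[leLHS]mulr_natl.
apply: (@le_trans _ _ (C ^+ 2 * (8 * (2 * rho) / t) `^ d * (4 * t) ^+ n.+1)).
  by rewrite ler_wpM2r ?exprn_ge0 ?mulr_ge0 ?(ltW t0)//; exact: pack.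
have [u u0 tE] : exists2 u : R, 0 < u & t = u * rho.
  by exists (t / rho); [rewrite divr_gt0|rewrite divfK// gt_eqF].
have -> : t / rho = u by rewrite tE mulfK// gt_eqF.
have -> : 8 * (2 * rho) / t = 16 * u^-1 by rewrite tE; field; rewrite !gt_eqF.
rewrite powRDp// powR_mulrn ?(ltW u0)// powRN.
rewrite powRM//; last by rewrite invr_ge0 ltW.
have -> : u^-1 `^ d = (u `^ d)^-1.
  by rewrite powR_invl// ltW.
rewrite tE !exprMn le_eqVlt; apply/orP; left; apply/eqP; field.
by rewrite gt_eqF// powR_gt0.
Qed.

Hypothesis dn : d < n.+1%:R.

(** The bound in [nbhd_measure] tends to zero with [t / rho], because the
    exponent [n.+1%:R - d] is positive. *)
Lemma dset_porous : exists m, forall w (rho : R), S w -> 0 < rho -> rho <= 4^-1 ->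
  (lebn R n.+1 (cube w rho `&` [set y | exists2 z, S z & cube z (rho / 2 ^+ m) y]) <=
   (rho ^+ n.+1)%:E)%E.
Proof.
have [K K0 HK] := nbhd_measure.
pose q := 2^-1 `^ (n.+1%:R - d).
have q1 : q < 1 by apply: powR_half_lt1; rewrite subr_gt0.
have [m hm] := filter_ex (small_pow K (powR_ge0 _ _ : 0 <= q) q1 ltr01).
exists m => w rho Sw rho0 rho4.
have t0 : 0 < rho / 2 ^+ m by rewrite divr_gt0// exprn_gt0.
have trho : rho / 2 ^+ m <= rho.
  by rewrite ler_piMr ?(ltW rho0)// invf_le1 ?exprn_gt0// exprn_ege1//; lra.
apply: (le_trans (HK _ _ _ Sw t0 trho rho4)); rewrite lee_fin.
have -> : rho / 2 ^+ m / rho = 2^-1 ^+ m.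
  by rewrite exprVn; field; rewrite !gt_eqF ?exprn_gt0.
have -> : (2^-1 ^+ m) `^ (n.+1%:R - d) = q ^+ m.
  by rewrite powRXn.
by rewrite mulrAC ler_piMl// exprn_ge0// ltW.
Qed.

Lemma dset_null : lebn R n.+1 S = 0%E.
Proof.
have [K K0 HK] := nbhd_measure.
have loc w : S w -> lebn R n.+1 (cube w 4^-1 `&` S) = 0%E.
  move=> Sw; apply/eqP; rewrite eq_le lebesgue_outer_ge0 andbT.
  apply/lee_addgt0Pr => e e0; rewrite add0e.
  pose q := 2^-1 `^ (n.+1%:R - d).
  have q1 : q < 1 by apply: powR_half_lt1; rewrite subr_gt0.
  have [m hm] := filter_ex (small_pow (K * 4^-1 ^+ n.+1) (powR_ge0 _ _ : 0 <= q) q1 e0).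
  have t0 : 0 < 4^-1 / 2 ^+ m :> R by rewrite divr_gt0// exprn_gt0.
  have trho : 4^-1 / 2 ^+ m <= 4^-1 :> R.
    by rewrite ler_piMr// invf_le1 ?exprn_gt0// exprn_ege1//; lra.
  apply: le_trans (_ : ((K * 4^-1 ^+ n.+1 * q ^+ m)%:E <= _)%E); last by rewrite lee_fin.
  have -> : q ^+ m = (4^-1 / 2 ^+ m / 4^-1) `^ (n.+1%:R - d).
    have -> : 4^-1 / 2 ^+ m / 4^-1 = 2^-1 ^+ m :> R.
      by rewrite exprVn; field; rewrite !gt_eqF ?exprn_gt0.
    by rewrite powRXn.
  apply: le_trans (HK w _ _ Sw t0 trho (lexx _)); apply: lebn_mono => y [yw Sy].
  by split=> //; exists y => //; apply: cube_center; rewrite ltW.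
apply/eqP; rewrite eq_le lebesgue_outer_ge0 andbT.
have h0 : 0 < 4^-1 :> R by [].
have -> : S = \bigcup_k (cell 4^-1 k `&` S) by rewrite -setI_bigcupl cell_bigcup setTI.
apply: (le_trans (lebesgue_outer_sigma_subadditive _)).
rewrite eseries0// => k _ _.
have [->|/set0P[w [wk Sw]]] := eqVneq (cell 4^-1 k `&` S) set0; first exact: lebesgue_outer0.
apply/eqP; rewrite eq_le lebesgue_outer_ge0 andbT -(loc w Sw).
apply: lebn_mono => y [yk Sy]; split=> // i.
have := ler_distD (cell_center 4^-1 k 0 i) (y 0 i) (w 0 i).
have := cell_sub_cube h0 yk i; have := cell_sub_cube h0 wk i.
by rewrite [`|w 0 i - _|]distrC; lra.
Qed.

End dset.
End hausdorff.

Section distance.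
Context {R : realType} {n : nat}.
Local Notation V := 'rV[R]_n.+1.
Variable S : set V.
Implicit Types (y z : V).

Lemma edist_inf_lt_cube y (t : R) : (edist_inf S y < t%:E)%E ->
  exists2 z, S z & cube z t y.
Proof.
move=> /ereal_inf_lt[_ [z Sz <-]] /edist_lt_ball [_ /(_ 0) h]; exists z => // i.
by have := h i; rewrite -ball_normE/= => /ltW.
Qed.

Lemma edist_inf_le_cube y z (t : R) : 0 <= t -> S z -> cube z t y ->
  (edist_inf S y <= t%:E)%E.
Proof.
move=> t0 Sz yz; apply: (@le_trans _ _ (edist (y, z))).
  by apply: ereal_inf_lbound; exists z.
apply/lee_addgt0Pr => e e0; rewrite -EFinD.
apply: edist_fin; first by rewrite ltr_wpDl.
split=> [|i j /=]; first by rewrite ltr_wpDl.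
by rewrite (ord1 i) -ball_normE/= (le_lt_trans (yz j))// ltrDl.
Qed.

Lemma measurable_edist_inf (D : set (Rn R n.+1)) :
  measurable_fun D (edist_inf S : Rn R n.+1 -> \bar R).
Proof.
apply: (measurable_funS measurableT (@subsetT _ _)) => mT.
apply: (measurability _ (ErealGenOInfty.measurableE R)) => //.
move=> _ [_ [t ->] <-]; rewrite setTI.
apply: measurable_ball_open => y /=; rewrite in_itv/= andbT => ty.
have [r r0 tr] : exists2 r : R, 0 < r & ((t + r)%:E < edist_inf S y)%E.
  case: (edist_inf S y) ty => [b| |]//.
    by rewrite lte_fin => tb; exists ((b - t) / 2); rewrite ?lte_fin; lra.
  by exists 1; rewrite // ltry.
exists (r / 2); first by rewrite divr_gt0.
move=> x xy /=; rewrite in_itv/= andbT ltNge; apply/negP => xt.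
have : (edist_inf S x < (t + r / 2)%:E)%E.
  by apply: le_lt_trans xt _; rewrite lte_fin; lra.
move=> /edist_inf_lt_cube[z Sz xz].
have [tr0|tr0] := ltP (t + r) 0.
  have tr20 : t + r / 2 < 0 by lra.
  by have := xz ord0; have := normr_ge0 (x 0 ord0 - z 0 ord0); lra.
move: tr; rewrite ltNge => /negP; apply; apply: (edist_inf_le_cube tr0 Sz) => i.
have := ler_distD (x 0 i) (y 0 i) (z 0 i); have := xz i; have := xy i.
by rewrite [`|x 0 i - y 0 i|]distrC; lra.
Qed.

End distance.

(** * Polynomials and the trace on a [d]-set *)

Lemma pairwise_in (T : eqType) (r : rel T) (s : seq T) :
  (forall x y, r x y = r y x) ->
  pairwise r s -> {in s &, forall x y, x != y -> r x y}.
Proof.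
move=> rC; elim: s => // z s IH; rewrite pairwise_cons => /andP[/allP zs /IH {}IH].
move=> x y; rewrite !inE => /predU1P[->|xs] /predU1P[->|ys].
- by rewrite eqxx.
- by move=> _; exact: zs.
- by move=> _; rewrite rC; exact: zs.
- exact: IH.
Qed.

Lemma dist_le2 (R : realType) (a b c e : R) :
  `|a - b| <= e -> `|c - b| <= e -> `|a - c| <= 2 * e.
Proof.
by move=> h1 h2; have := ler_distD b a c; rewrite [`|b - c|]distrC; lra.
Qed.

Lemma lee_of_double (R : realType) (u : R) (l : \bar R) :
  ((2 * u)%:E <= l + u%:E)%E -> (u%:E <= l)%E.
Proof. by case: l => [l| |]; rewrite ?leey// -?EFinD ?lee_fin//; lra. Qed.

Section estimates.
Context {R : realType} {n : nat}.
Local Notation V := 'rV[R]_n.+1.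
Local Notation L := (lebn R n.+1).
Variables (d p s : R) (k : nat) (S : set V) (C : R).
Hypotheses (nd : n%:R < d) (dn : d < n.+1%:R) (C1 : 1 < C).
Hypothesis HS : forall w (r : R), S w -> 0 < r <= 1 ->
  ((C^-1 * r `^ d)%:E <= hausdorff_measure d (cube w r `&` S) <= (C * r `^ d)%:E)%E.
Hypotheses (p1 : 1 < p) (ps : (n.+1%:R - d) / p < s).
Local Notation H := (@hausdorff_measure R n.+1 d).
Implicit Types (f : V -> R) (G : V -> \bar R) (w x y z : V).

Let d0 : 0 < d.
Proof. by apply: le_lt_trans nd; rewrite ler0n. Qed.

Let C0 : 0 < C.
Proof. exact: lt_trans ltr01 C1. Qed.

Let p0 : 0 < p.
Proof. exact: lt_trans ltr01 p1. Qed.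

Let s0 : 0 < s.
Proof. by apply: lt_trans ps; rewrite divr_gt0// subr_gt0. Qed.

(** The lower bound for the distance is the one for which, by porosity, a shell
    fills a fixed part of the cubes of radius [r / 2 ^+ j] around points of [S]. *)
Definition shell (m : nat) w (r : R) (j : nat) : set V := cube w (2 * r) `&`
  [set y | ((r / 2 ^+ (j + m))%:E <= edist_inf S y)%E] `&`
  [set y | (edist_inf S y <= (r / 2 ^+ j)%:E)%E].

Lemma measurable_shell m w r j : measurable (shell m w r j : set (Rn R n.+1)).
Proof.
have mc : measurable (cube w (2 * r) : set (Rn R n.+1)) by exact: measurable_cube.
have m1 := emeasurable_fun_c_infty mc (@measurable_edist_inf R n S _).
exact: (emeasurable_fun_infty_c (m1 _) (@measurable_edist_inf R n S _)).
Qed.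

Lemma measurable_poweRfun G (D : set (Rn R n.+1)) :
  measurable_fun [set: Rn R n.+1] (G : Rn R n.+1 -> \bar R) ->
  measurable_fun D (fun y : Rn R n.+1 => (G y `^ p)%E).
Proof.
move=> mG; apply: (measurableT_comp (measurable_poweR p)).
exact: (measurable_funS measurableT (@subsetT _ _) mG).
Qed.

(** Points of [S] around which [G] is large on the scale [rho]: a maximal
    [rho]-separated family of them is small, since [G] is large on the parts of
    disjoint cubes that stay away from [S]. *)
Lemma level_hausdorff : exists m, exists2 K, 0 < K &
  forall G, measurable_fun [set: Rn R n.+1] (G : Rn R n.+1 -> \bar R) ->
  (forall y, 0 <= G y)%E -> forall w0 (r lam : R) j (B : set V),
  S w0 -> 0 < r -> r <= 4^-1 -> 0 < lam -> B `<=` S `&` cube w0 r ->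
  (forall w, B w -> forall y, cube w (r / 2 ^+ j) y -> (lam%:E <= G y)%E) ->
  (H B <= (K * (r / 2 ^+ j) `^ (d - n.+1%:R) * lam `^ (- p))%:E *
     \int[L]_(y in shell m w0 r j) (G y `^ p))%E.
Proof.
have [m0 Hm0] := dset_porous d0 C1 HS dn.
(* The net is [rho]-separated and the cubes of radius [rho / 4] around it are
   disjoint: the factor 4 costs the two additional dyadic scales. *)
exists (2 + m0)%N, (C * 4 ^+ n.+1); first by rewrite mulr_gt0// exprn_gt0.
move=> G mG G0 w0 r lam j B Sw0 r0 r4 lam0 BS BG.
have rho0 : 0 < r / 2 ^+ j by rewrite divr_gt0// exprn_gt0.
have rho_r : r / 2 ^+ j <= r.
  by rewrite ler_piMr ?(ltW r0)// invf_le1 ?exprn_gt0// exprn_ege1//; lra.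
have shE : r / 2 ^+ (j + (2 + m0)) = r / 2 ^+ j / 4 / 2 ^+ m0.
  by rewrite !exprD; field; rewrite !gt_eqF// exprn_gt0.
have shS : shell (2 + m0) w0 r j = cube w0 (2 * r) `&`
    [set y | ((r / 2 ^+ j / 4 / 2 ^+ m0)%:E <= edist_inf S y)%E] `&`
    [set y | (edist_inf S y <= (r / 2 ^+ j)%:E)%E] by rewrite /shell shE.
have msh := measurable_shell (2 + m0) w0 r j.
move: shS msh; set T := shell _ _ _ _.
move: (r / 2 ^+ j) rho0 rho_r BG => rho rho0 rho_r BG TE mT.
have r12 : r <= 2^-1 by lra.
have bnd zs : pairwise (separated rho) zs -> {in zs, forall z, B z} ->
    (size zs <= Num.truncn (C ^+ 2 * (8 * r / rho) `^ d))%N.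
  move=> h1 h2; rewrite truncn_ge_nat; last first.
    by rewrite mulr_ge0 ?exprn_ge0 ?powR_ge0 ?(ltW C0).
  apply: (dset_packing d0 C1 HS Sw0 rho0 rho_r r12 h1) => z /h2 /BS.
  by [].
have [zs [zsep zB zcov]] := separated_net bnd.
have HB : (H B <= ((size zs)%:R * (C * rho `^ d))%:E)%E.
  apply: (le_trans (le_sum_cover (F := fun z => cube z rho `&` S) (s := zs)
    (hausdorff0 d0) (@le_hausdorff R n d) (@hausdorffU R n d d0) _)).
    move=> y By; have [z zzs yz] := zcov y By; exists z => //; split=> //.
    by have [] := BS y By.
  apply: (@le_trans _ _ (\sum_(z <- zs) (C * rho `^ d)%:E)%E).
    rewrite big_seq [leRHS]big_seq; apply: lee_sum => z /zB /BS[Sz _].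
    by have /andP[] := @HS z rho Sz ltac:(apply/andP; lra).
  by rewrite sumEFin big_const_seq count_predT iter_addr addr0 mulr_natl.
pose Y z : set V := cube z (rho / 4) `&` T.
have mY z : measurable (Y z : set (Rn R n.+1)).
  by apply: measurableI => //; exact: measurable_cube.
have G00 y : (0 <= G y `^ p)%E by exact: poweR_ge0.
have q0 : 0 < (rho / 4) ^+ n.+1 by rewrite exprn_gt0// divr_gt0.
have LY z : z \in zs -> (((rho / 4) ^+ n.+1)%:E <= L (Y z))%E.
  move=> /zB /BS[Sz zw0].
  have rho4 : 0 < rho / 4 by rewrite divr_gt0.
  have small4 : rho / 4 <= 4^-1 by lra.
  have hp := Hm0 z (rho / 4) Sz rho4 small4.
  have : (L (cube z (rho / 4)) <= L (Y z) + L (cube z (rho / 4) `&`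
      [set y | exists2 z, S z & cube z (rho / 4 / 2 ^+ m0) y]))%E.
    apply: le_trans (lebn_setU _ _); apply: lebn_mono => y yz.
    have [lt|ge] := ltP (edist_inf S y) (rho / 4 / 2 ^+ m0)%:E.
      by right; split=> //; exact: edist_inf_lt_cube lt.
    left; split=> //; rewrite TE; split; first split=> //.
      move=> i; have := ler_distD (z 0 i) (y 0 i) (w0 0 i).
      by have := yz i; have := zw0 i; lra.
    apply: (edist_inf_le_cube (ltW rho0) Sz) => i; apply: le_trans (yz i) _; lra.
  rewrite lebn_cube ?(ltW rho4)// => h; have := le_trans h (leeD2l _ hp).
  have e2 : 2 * (rho / 4) ^+ n.+1 <= (2 * (rho / 4)) ^+ n.+1.
    rewrite [leRHS]exprMn ler_wpM2r ?(ltW q0)//.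
    by rewrite exprS ler_peMr// exprn_ege1//; lra.
  case: (L (Y z)) => [l| |]; rewrite ?leey// -?EFinD ?lee_fin//; lra.
have sum_le : (((size zs)%:R * (lam `^ p * (rho / 4) ^+ n.+1))%:E <=
    \int[L]_(y in T) (G y `^ p))%E.
  have tri : trivIset [set` zs] Y.
    apply/trivIsetP => z z' /= zzs z'zs zz'.
    have /existsP[i hi] := pairwise_in (@separatedC R n rho) zsep zzs z'zs zz'.
    apply/seteqP; split=> // y [[yz _] [yz' _]].
    have := ler_distD (y 0 i) (z 0 i) (z' 0 i).
    by have := yz i; have := yz' i; rewrite [`|z 0 i - y 0 i|]distrC; lra.
  have uzs : uniq zs.
    apply: pairwise_uniq zsep => z; apply/negbTE/existsPn => i.
    by rewrite subrr normr0 -leNgt ltW.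
  apply: (@le_trans _ _ (\int[L]_(y in \big[setU/set0]_(z <- zs) Y z) (G y `^ p))%E); last first.
    apply: ge0_subset_integral; [|exact: mT|exact: measurable_poweRfun| |].
    - by apply: bigsetU_measurable => z _; exact: mY.
    - by move=> y _; exact: G00.
    - rewrite -bigcup_seq => y [z _ [_ Ty]]; exact: Ty.
  rewrite ge0_integral_bigsetU; [|exact: mY|exact: uzs|exact: tri|exact: measurable_poweRfun|by move=> y _; exact: G00].
  apply: (@le_trans _ _ (\sum_(z <- zs) (lam `^ p * (rho / 4) ^+ n.+1)%:E)%E).
    by rewrite sumEFin big_const_seq count_predT iter_addr addr0 mulr_natl.
  rewrite big_seq [leRHS]big_seq; apply: lee_sum => z zzs.
  apply: (@le_trans _ _ (\int[L]_(y in Y z) (cst (lam `^ p)%:E y))%E).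
    rewrite (integral_cst L (mY z)) EFinM; apply: lee_wpmul2l; last exact: LY.
    by rewrite lee_fin powR_ge0.
  apply: ge0_le_integral; first exact: mY.
  - by move=> y _; rewrite lee_fin powR_ge0.
  - exact: measurable_cst.
  - exact: measurable_poweRfun.
  move=> y [yz _]; rewrite -poweR_EFin; apply: (gt0_ler_poweR (ltW p0)).
  - by rewrite in_itv/= lee_fin (ltW lam0) leey.
  - by rewrite in_itv/= G0 leey.
  apply: (BG z (zB z zzs)) => i; apply: le_trans (yz i) _; lra.
apply: (le_trans HB).
have lp0 : 0 < lam `^ p by rewrite powR_gt0.
have -> : (size zs)%:R * (C * rho `^ d) = (C * 4 ^+ n.+1 * rho `^ (d - n.+1%:R) * lam `^ (- p))
    * ((size zs)%:R * (lam `^ p * (rho / 4) ^+ n.+1)).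
  rewrite powRDp// !powRN powR_mulrn ?(ltW rho0)// expr_div_n; field.
  by rewrite !gt_eqF// ?exprn_gt0.
rewrite EFinM; apply: lee_wpmul2l => //.
by rewrite lee_fin !mulr_ge0 ?powR_ge0 ?exprn_ge0 ?(ltW C0).
Qed.

(** One half of the surplus in [s * p > n.+1%:R - d] makes the thresholds of
    [trace_estimate] summable along a chain of cubes, and the other half remains
    as the decay of the weights of the shells. *)
Definition sobolev_gap : R := (s * p - (n.+1%:R - d)) / 2.

Lemma sobolev_gap_gt0 : 0 < sobolev_gap.
Proof. by rewrite divr_gt0// subr_gt0 -ltr_pdivrMr. Qed.

Local Notation alpha := sobolev_gap.

(** If [P] approximates [f] on a cube centred on [S] and is large somewhere, then
    it is large on a big part of [S], because [d > n]. At almost all of these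
    points the averages of [f] tend to zero, so the approximation error of [f]
    must be large at some scale around each of them. *)
Lemma trace_estimate : exists m, exists2 K, 0 < K & forall f G t0,
  Lmeasurable f -> Lintegrable f ->
  measurable_fun [set: Rn R n.+1] (G : Rn R n.+1 -> \bar R) ->
  (forall y, 0 <= G y)%E -> controls k s t0 f G ->
  hausdorff_ae d S (fun x => trace_defined f x /\ trace f x = 0) ->
  forall P w0 (r : R), (msz P <= k)%N -> S w0 -> 0 < r -> r <= 4^-1 -> r <= t0 ->
  (forall y, cube w0 (2 * r) y ->
     (errint f P w0 (2 * r) <= ((2 * r) ^+ n.+1 * (2 * r) `^ s)%:E * G y)%E) ->
  exists2 A, 0 <= A /\ (forall z, cube w0 r z -> `|ev P z| <= A) &
   ((A `^ p * r ^+ n.+1)%:E <= (K * r `^ (s * p))%:E *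
     \sum_(j <oo) (2^-1 `^ alpha ^+ j)%:E * \int[L]_(y in shell m w0 r j) (G y `^ p))%E.
Proof.
have [m [K1 K10 HK1]] := level_hausdorff.
have a0 := sobolev_gap_gt0.
pose th := 2^-1 `^ (alpha / p).
have th0 : 0 < th by rewrite powR_gt0.
have th1 : th < 1 by apply: powR_half_lt1; exact: divr_gt0 a0 p0.
have [Kt Kt0 HKt] := @trace_poly_le R n k th th0 th1.
pose eps := (2 `^ d * (2 * C ^+ 2))^-1.
have eps0 : 0 < eps by rewrite invr_gt0 !mulr_gt0 ?powR_gt0 ?exprn_gt0.
have [c c0 Hc] := remez k nd (lexx 1) eps0.
pose D := K1 * (2 ^+ n.+1 * 2 `^ s) `^ p.
have D0 : 0 < D by rewrite mulr_gt0// powR_gt0// mulr_gt0 ?exprn_gt0 ?powR_gt0.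
pose K := 2 * C * D * (2 * Kt / c) `^ p.
have K0 : 0 < K by rewrite !mulr_gt0 ?powR_gt0 ?divr_gt0 ?mulr_gt0.
exists m, K => // f G t0 mf If mG G0 ctl tr0 P w0 r sP Sw0 r0 r4 rt0 err0.
have [A [A0 PA] [cs [ct csum] ccov]] := Hc P w0 r sP r0.
exists A; first by split=> // z; rewrite -[r in cube _ r]mul1r; exact: PA.
set I := fun j => (\int[L]_(y in shell m w0 r j) (G y `^ p))%E.
have I0 j : (0 <= I j)%E by apply: integral_ge0 => y _; exact: poweR_ge0.
have thj0 j : 0 <= 2^-1 `^ alpha ^+ j by rewrite exprn_ge0// powR_ge0.
have [A00|A_neq0] := eqVneq A 0.
  rewrite A00 powR0 ?(gt_eqF p0)// mul0r; apply: mule_ge0.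
    by rewrite lee_fin mulr_ge0 ?powR_ge0// ltW.
  by apply: nneseries_ge0 => j _ _; apply: mule_ge0; [rewrite lee_fin|exact: I0].
have Ap : 0 < A by rewrite lt_def A_neq0.
pose a := c * A / (2 * Kt).
have ap : 0 < a by rewrite divr_gt0 ?mulr_gt0.
pose rho j := r / 2 ^+ j.
have rho0 j : 0 < rho j by rewrite divr_gt0// exprn_gt0.
have rho_le j : rho j <= r.
  by rewrite ler_piMr ?(ltW r0)// invf_le1 ?exprn_gt0// exprn_ege1//; lra.
have rho_p j (b : R) : rho j `^ b = r `^ b * 2^-1 `^ b ^+ j.
  by rewrite /rho powRM ?(ltW r0)// -exprVn powRXn.
(* The errors below these thresholds form a geometric series of sum about [a].
   The last factor accounts for the cube of [P], of twice the radius. *)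
pose lam j := a * th ^+ j / (rho j `^ s * (2 ^+ n.+1 * 2 `^ s)).
have lam0 j : 0 < lam j.
  have rs0 : 0 < rho j `^ s by rewrite powR_gt0.
  have t0' : 0 < th ^+ j by rewrite exprn_gt0.
  have n0' : 0 < 2 ^+ n.+1 * 2 `^ s by rewrite mulr_gt0// ?exprn_gt0// powR_gt0.
  by apply: divr_gt0; exact: mulr_gt0.
pose bad : set V := S `&` [set x | ~ (trace_defined f x /\ trace f x = 0)].
pose Gj j : set V := S `&` cube w0 r `&`
   [set w | forall y, cube w (rho j) y -> ((lam j)%:E <= G y)%E].
pose good : set V := S `&` cube w0 r `&` [set w | c * A <= `|ev P w|].
(* If [G] were below the thresholds somewhere at each scale, then [P w] would be
   at most [Kt * a], which is half of [c * A]. *)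
have goodE : good `<=` bad `|` \bigcup_j Gj j.
  move=> w [[Sw ww0] Pw]; apply: contrapT => /not_orP[nbad nG].
  have [td tz] : trace_defined f w /\ trace f w = 0.
    by apply: contrapT => h; apply: nbad.
  have avg0 : cube_average f w t @[t --> 0^'+] --> (0 : R).
    have td' : cube_average f w t @[t --> 0^'+] --> trace f w by exact: td.
    by rewrite tz in td'.
  have /choice[y Hy] j : exists y, cube w (rho j) y /\ (G y < (lam j)%:E)%E.
    apply: contrapT => /forallNP h; apply: nG; exists j => //; split=> // y yw.
    by rewrite leNgt; apply/negP => lt; apply: (h y).
  have /choice[Q HQ] j : exists Q, (msz Q <= k)%N /\
      (errint f Q w (rho j) <= (rho j ^+ n.+1 * (a * th ^+ j))%:E)%E.
    have [Q sQ HQ] := ctl w (rho j) (rho0 j) (le_trans (rho_le j) rt0).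
    exists Q; split=> //; have [yw Gy] := Hy j.
    apply: (le_trans (HQ _ yw)).
    apply: (@le_trans _ _ ((rho j ^+ n.+1 * rho j `^ s)%:E * (lam j)%:E)%E).
      by apply: lee_wpmul2l; [rewrite lee_fin mulr_ge0 ?powR_ge0 ?exprn_ge0 ?(ltW (rho0 j))|exact: ltW].
    rewrite -EFinM lee_fin -mulrA ler_wpM2l ?exprn_ge0 ?(ltW (rho0 j))//.
    have rs0 : 0 < rho j `^ s by rewrite powR_gt0.
    have c20 : 0 < 2 ^+ n.+1 * 2 `^ s by rewrite mulr_gt0// ?exprn_gt0// powR_gt0.
    have -> : rho j `^ s * lam j = a * th ^+ j / (2 ^+ n.+1 * 2 `^ s).
      by rewrite /lam; field; rewrite !gt_eqF// ?powR_gt0// exprn_gt0.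
    rewrite ler_pdivrMr// ler_peMr//.
      by rewrite mulr_ge0 ?exprn_ge0 ?(ltW ap) ?(ltW th0).
    rewrite mulr_ege1 ?exprn_ege1 ?ler1n//.
    rewrite [leLHS](_ : 1 = 2 `^ 0); last by rewrite powRr0.
    by rewrite ler_powR ?ler1n// ltW.
  pose Ps j := if j is j'.+1 then Q j else P.
  have : `|ev (Ps 0%N) w| <= Kt * a.
    apply: (HKt f mf If Ps w r a r0 (ltW ap) _ _ avg0).
      by case=> [//|j]; exact: (HQ j.+1).1.
    case=> [|j]; last exact: (HQ j.+1).2.
    rewrite !expr0 divr1 mulr1; have [yw Gy] := Hy 0%N.
    have rho00 : rho 0%N = r by rewrite /rho expr0 divr1.
    have sub : cube w r `<=` cube w0 (2 * r).
      by apply: cube_sub => i; rewrite mulrDl mul1r lerD2r; exact: ww0.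
    apply: (@le_trans _ _ (errint f P w0 (2 * r))).
      apply: ge0_subset_integral; [exact: measurable_cube|exact: measurable_cube|
        exact: measurable_err| |exact: sub].
      by move=> z _; rewrite lee_fin.
    have yw' : cube w0 (2 * r) (y 0%N) by apply: sub; rewrite -[r in cube _ r]rho00.
    apply: (le_trans (err0 _ yw')).
    apply: (@le_trans _ _ (((2 * r) ^+ n.+1 * (2 * r) `^ s)%:E * (lam 0%N)%:E)%E).
      apply: lee_wpmul2l; last exact: ltW.
      by rewrite lee_fin mulr_ge0 ?powR_ge0 ?exprn_ge0 ?mulr_ge0 ?(ltW r0).
    rewrite -EFinM lee_fin /lam rho00 expr0 exprMn powRM// ?(ltW r0)//.
    rewrite le_eqVlt; apply/orP; left; apply/eqP; field.
    by rewrite !gt_eqF ?powR_gt0 ?exprn_gt0.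
  rewrite /= leNgt => /negP; apply; apply: lt_le_trans Pw.
  rewrite /a [Kt * _](_ : _ = c * A / 2); last by field; rewrite gt_eqF.
  by rewrite ltr_pdivrMr// ltr_pMr ?mulr_gt0//; lra.
(* The exponents of [2^-1] add up to [d - n.+1%:R + s * p - alpha = alpha]. *)
have HG j : (H (Gj j) <= (D * a `^ (- p) * r `^ (2 * alpha))%:E *
    ((2^-1 `^ alpha ^+ j)%:E * I j))%E.
  apply: (le_trans (HK1 G mG G0 w0 r (lam j) j (Gj j) Sw0 r0 r4 (lam0 j) _ _)).
  - by move=> w [].
  - by move=> w [].
  rewrite muleA -EFinM; apply: lee_wpmul2r; first exact: I0.
  rewrite lee_fin le_eqVlt; apply/orP; left; apply/eqP.
  have c20 : 0 < 2 ^+ n.+1 * 2 `^ s by rewrite mulr_gt0// ?exprn_gt0// powR_gt0.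
  have rs0 : 0 < rho j `^ s by rewrite powR_gt0.
  have lamp : lam j `^ p = a `^ p * (2^-1 `^ alpha) ^+ j /
      (rho j `^ (s * p) * (2 ^+ n.+1 * 2 `^ s) `^ p).
    have thj : 0 <= th ^+ j by rewrite exprn_ge0// ltW.
    have X0 : 0 <= rho j `^ s * (2 ^+ n.+1 * 2 `^ s) by rewrite ltW// mulr_gt0.
    have X1 : 0 <= (rho j `^ s * (2 ^+ n.+1 * 2 `^ s))^-1 by rewrite invr_ge0.
    have t1 : 0 <= a * th ^+ j by rewrite mulr_ge0// ltW.
    rewrite /lam (powRM _ t1 X1) (powR_invl _ X0) (powRM _ (ltW ap) thj) (powRM _ (ltW rs0) (ltW c20)).
    rewrite powRXn ?(ltW th0)// -[rho j `^ s `^ p]powRrM.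
    by rewrite /th -powRrM divfK// gt_eqF.
  rewrite -/(rho j) powRN lamp !rho_p /D powRN.
  have e1 : 2^-1 `^ (d - n.+1%:R) * 2^-1 `^ (s * p) = 2^-1 `^ alpha * 2^-1 `^ alpha.
    by rewrite -!powRDp//; congr (_ `^ _); rewrite /sobolev_gap; field.
  have e2 : r `^ (d - n.+1%:R) * r `^ (s * p) = r `^ (2 * alpha).
    by rewrite -!powRDp//; congr (_ `^ _); rewrite /sobolev_gap; field.
  rewrite -e2.
  have e3 : (2^-1 `^ (d - n.+1%:R)) ^+ j * (2^-1 `^ (s * p)) ^+ j = (2^-1 `^ alpha) ^+ j * (2^-1 `^ alpha) ^+ j.
    by rewrite -!exprMn e1.
  have x0 : 0 < (2^-1 `^ alpha) ^+ j by rewrite exprn_gt0// powR_gt0.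
  have x1 : 0 < a `^ p by rewrite powR_gt0.
  move: e3 x0 x1; set u := _ ^+ j; set v := _ ^+ j; set x := _ ^+ j.
  move=> e3 x0 x1; rewrite invf_div.
  set b := a `^ p in x1 *; set E := _ `^ p; set g := r `^ _; set h := r `^ _.
  have -> : K1 * (g * u) * (h * v * E / (b * x)) = K1 * g * h * E * (u * v) / (b * x).
    by field; rewrite !gt_eqF.
  by rewrite e3; field; rewrite !gt_eqF.
have Hgood : ((2^-1 * C^-1 * r `^ d)%:E <= H good)%E.
  have r1 : 0 < r <= 1 by apply/andP; lra.
  have /andP[lowS _] := HS Sw0 r1.
  pose rest : set V := S `&` cube w0 r `&` [set w | `|ev P w| < c * A].
  have Hrest : (H rest <= (2^-1 * C^-1 * r `^ d)%:E)%E.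
    apply: (le_trans (le_sum_cover (F := fun e => cube (w0 + r *: e.1) (r * e.2) `&` S)
      (s := cs) (hausdorff0 d0) (@le_hausdorff R n d) (@hausdorffU R n d d0) _)).
      move=> y [[Sy yw0] Py]; have [e ecs ey] := ccov y yw0 Py.
      by exists e.
    apply: (@le_trans _ _ (\sum_(e <- cs) (C * 2 `^ d * r `^ d * e.2 `^ d)%:E)%E).
      rewrite big_seq [leRHS]big_seq; apply: lee_sum => e /ct /andP[e0 e1].
      (* A cube of the cover is not centred on [S]. If it meets [S], it lies in a
         cube of twice the radius that is. *)
      have [->|/set0P[w [we Sw]]] := eqVneq (cube (w0 + r *: e.1) (r * e.2) `&` S) set0.
        by rewrite (hausdorff0 d0) lee_fin !mulr_ge0 ?powR_ge0 ?(ltW C0).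
      have re : 0 < 2 * (r * e.2) <= 1.
        apply/andP; split; first by rewrite !mulr_gt0.
        have : r * e.2 <= r by rewrite ler_piMr// ltW.
        move=> h; rewrite -ler_pdivlMl// mulr1 (le_trans h)// (le_trans r4)//.
        by rewrite lef_pV2 ?posrE// ler_nat.
      have /andP[_ up] := HS Sw re.
      apply: le_trans (_ : (H (cube w (2 * (r * e.2)) `&` S) <= _)%E).
        apply: le_hausdorff => y [ye Sy]; split=> // i.
        exact: dist_le2 (ye i) (we i).
      apply: (le_trans up); rewrite lee_fin !powRM// ?mulr_ge0 ?(ltW r0) ?(ltW e0)//.
      by rewrite !mulrA.
    rewrite sumEFin lee_fin -mulr_sumr.
    apply: (@le_trans _ _ (C * 2 `^ d * r `^ d * eps)).
      by rewrite ler_wpM2l// !mulr_ge0 ?powR_ge0 ?(ltW C0).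
    rewrite /eps le_eqVlt; apply/orP; left; apply/eqP; field.
    by rewrite !gt_eqF ?powR_gt0.
  have : (H (cube w0 r `&` S) <= H good + H rest)%E.
    apply: le_trans (hausdorffU d0 _ _); apply: le_hausdorff => y [yw0 Sy].
    by have [lt|ge] := ltP `|ev P y| (c * A); [right|left].
  move=> /(le_trans lowS) h; have := le_trans h (leeD2l _ Hrest).
  have -> : C^-1 * r `^ d = 2 * (2^-1 * C^-1 * r `^ d) by field; rewrite gt_eqF.
  exact: lee_of_double.
have main : ((2^-1 * C^-1 * r `^ d)%:E <= (D * a `^ (- p) * r `^ (2 * alpha))%:E *
    \sum_(j <oo) ((2^-1 `^ alpha ^+ j)%:E * I j))%E.
  apply: (le_trans Hgood); apply: (le_trans (@le_hausdorff R n d _ _ goodE)).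
  apply: (le_trans (hausdorffU d0 _ _)); rewrite (_ : H bad = 0%E) ?add0e//.
  apply: (le_trans (hausdorff_sigma_subadditive d Gj)).
  rewrite -nneseriesZl; last by move=> j _; rewrite mule_ge0// lee_fin.
  by apply: lee_nneseries => [j _ _|j _]; [exact: hausdorff_ge0|exact: HG].
pose M := 2 * C * a `^ p * (2 * Kt / c) `^ p * r `^ (n.+1%:R - d).
have M0 : 0 < M by rewrite !mulr_gt0 ?powR_gt0 ?divr_gt0 ?mulr_gt0.
have ap0 : 0 < a `^ p by rewrite powR_gt0.
have -> : A `^ p * r ^+ n.+1 = M * (2^-1 * C^-1 * r `^ d).
  have -> : A `^ p = a `^ p * (2 * Kt / c) `^ p.
    rewrite -powRM ?(ltW ap) ?divr_ge0 ?mulr_ge0 ?(ltW c0) ?(ltW Kt0)//.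
    by congr (_ `^ _); rewrite /a; field; rewrite !gt_eqF.
  have -> : r ^+ n.+1 = r `^ (n.+1%:R - d) * r `^ d.
    by rewrite -powRDp// subrK powR_mulrn// ltW.
  by rewrite /M; field; rewrite gt_eqF.
have -> : K * r `^ (s * p) = M * (D * a `^ (- p) * r `^ (2 * alpha)).
  have -> : r `^ (s * p) = r `^ (n.+1%:R - d) * r `^ (2 * alpha).
    by rewrite -powRDp//; congr (_ `^ _); rewrite /sobolev_gap; field.
  by rewrite /K /M powRN; field; rewrite gt_eqF.
rewrite EFinM [in leRHS]EFinM -muleA; apply: lee_wpmul2l; first by rewrite lee_fin ltW.
exact: main.
Qed.

End estimates.

(** * The local inequality *)

Lemma powR_add_le (R : realType) (u v p : R) : 0 <= u -> 0 <= v -> 0 <= p ->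
  (u + v) `^ p <= 2 `^ p * (u `^ p + v `^ p).
Proof.
move=> u0 v0 p0; have p2 : 0 <= 2 `^ p :> R by exact: powR_ge0.
wlog uv : u v u0 v0 / v <= u.
  by move=> h; have [/h|/ltW/h] := leP v u; [exact|rewrite addrC [_ `^ p + _]addrC; exact].
apply: (@le_trans _ _ ((2 * u) `^ p)).
  by apply: ge0_ler_powR; rewrite ?nnegrE ?addr_ge0 ?mulr_ge0//; lra.
by rewrite powRM// ler_wpM2l// lerDl powR_ge0.
Qed.

Lemma poweR_add_le (R : realType) (x : \bar R) (v p : R) : (0 <= x)%E ->
  0 <= v -> 0 < p ->
  ((x + v%:E) `^ p <= (2 `^ p)%:E * (x `^ p + (v `^ p)%:E))%E.
Proof.
move=> + v0 p0; case: x => [x| |]//.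
  by rewrite lee_fin => x0; rewrite -EFinD !poweR_EFin -EFinD -EFinM lee_fin powR_add_le// ltW.
move=> _; rewrite addye// poweRyr ?gt_eqF// addye// gt0_muley// lte_fin powR_gt0//.
Qed.

Lemma geometric_eseries_le (R : realType) (q : R) : 0 <= q -> q < 1 ->
  (\sum_(j <oo) (q ^+ j)%:E <= ((1 - q)^-1)%:E)%E.
Proof.
move=> q0 q1; have q10 : 0 < 1 - q by rewrite subr_gt0.
apply: lime_le.
  by apply: is_cvg_nneseries => j _ _; rewrite lee_fin exprn_ge0.
apply: nearW => j; rewrite sumEFin lee_fin.
have -> : \sum_(0 <= i < j) q ^+ i = (1 - q ^+ j) / (1 - q).
  elim: j => [|j IH]; first by rewrite big_nil expr0 subrr mul0r.
  by rewrite big_nat_recr//= IH exprS; field; rewrite gt_eqF.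
by rewrite ler_pdivrMr// mulVf ?gt_eqF// gerBl exprn_ge0.
Qed.

Section local.
Context {R : realType} {n : nat}.
Local Notation V := 'rV[R]_n.+1.
Local Notation L := (lebn R n.+1).
Variables (d p s : R) (k : nat) (S : set V) (C : R).
Hypotheses (nd : n%:R < d) (dn : d < n.+1%:R) (C1 : 1 < C).
Hypothesis HS : forall w (r : R), S w -> 0 < r <= 1 ->
  ((C^-1 * r `^ d)%:E <= hausdorff_measure d (cube w r `&` S) <= (C * r `^ d)%:E)%E.
Hypotheses (p1 : 1 < p) (ps : (n.+1%:R - d) / p < s).
Implicit Types (f : V -> R) (G g : V -> \bar R) (w x y z : V).
Local Notation q := (2^-1 `^ (@sobolev_gap R n d p s)).

Let p0 : 0 < p.
Proof. exact: lt_trans ltr01 p1. Qed.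

Let s0 : 0 < s.
Proof. by apply: lt_trans ps; rewrite divr_gt0// subr_gt0. Qed.

Lemma measurable_powR_abs f (D : set (Rn R n.+1)) : Lmeasurable f ->
  measurable_fun D (fun y : Rn R n.+1 => (`|f y| `^ p)%:E).
Proof.
move=> mf; apply/measurable_EFinP; apply: (measurableT_comp (measurable_powR p)).
apply: (measurableT_comp (@normr_measurable R setT)).
exact: (measurable_funS measurableT (@subsetT _ _) mf).
Qed.

(** In [f = (f - P) + P] the first summand is bounded by [ae_poly_le] and the
    second one by [trace_estimate]. *)
Lemma local_estimate : exists m, exists2 K, 0 < K & forall f G t0,
  Lmeasurable f -> Lintegrable f ->
  measurable_fun [set: Rn R n.+1] (G : Rn R n.+1 -> \bar R) ->
  (forall y, 0 <= G y)%E -> controls k s t0 f G ->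
  (forall x (r : R), \int[L]_(y in cube x r) G y < +oo)%E ->
  hausdorff_ae d S (fun x => trace_defined f x /\ trace f x = 0) ->
  forall w0 (r : R) (E : set (Rn R n.+1)), S w0 -> 0 < r -> r <= 4^-1 -> 2 * r <= t0 ->
  measurable E -> E `<=` cube w0 (r / 2) ->
  (\int[L]_(y in E) (`|f y| `^ p)%:E <= (K * r `^ (s * p))%:E *
    (\int[L]_(y in E) (G y `^ p) +
     \sum_(j <oo) (q ^+ j)%:E * \int[L]_(y in shell S m w0 r j) (G y `^ p)))%E.
Proof.
have [m [K1 K10 HK1]] := trace_estimate k nd dn C1 HS p1 ps.
have [K2 K20 HK2] := @ae_poly_le R n k s s0.
pose c2 := (K2 * 2 `^ s) `^ p.
have c20 : 0 < c2 by rewrite powR_gt0// mulr_gt0// powR_gt0.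
exists m, (2 `^ p * (c2 + K1)); first by rewrite mulr_gt0 ?powR_gt0// addr_gt0.
move=> f G t0 mf If mG G0 ctl IG tr0 w0 r E Sw0 r0 r4 rt0 mE Ew0.
have r20 : 0 < 2 * r by rewrite mulr_gt0.
have [P sP HP] := ctl w0 (2 * r) r20 rt0.
have rt0' : r <= t0 by apply: le_trans rt0; rewrite ler_peMl ?ler1n// ltW.
have [A [A0 PA] HA] := HK1 f G t0 mf If mG G0 ctl tr0 P w0 r sP Sw0 r0 r4 rt0' HP.
have [Z [mZ Z0] HZ] := HK2 f G t0 mf mG G0 ctl P w0 (2 * r) r20 rt0 sP HP (IG _ _).
have r2E : 2 * r / 4 = r / 2 by field.
have rs0 : 0 <= r `^ (s * p) by exact: powR_ge0.
have rhsE : (K2 * (2 * r) `^ s) `^ p = c2 * r `^ (s * p).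
  by rewrite powRM ?(ltW r0)// mulrA powRM ?mulr_ge0 ?powR_ge0 ?(ltW K20)// -powRrM.
set F2 := fun y => ((2 `^ p)%:E * ((c2 * r `^ (s * p))%:E * G y `^ p + (A `^ p)%:E))%E.
have Gp0 y : (0 <= G y `^ p)%E by exact: poweR_ge0.
have cG0 y : (0 <= (c2 * r `^ (s * p))%:E * G y `^ p)%E.
  by apply: mule_ge0 => //; rewrite lee_fin mulr_ge0// ltW.
have F20 y : (0 <= F2 y)%E.
  by apply: mule_ge0; [rewrite lee_fin powR_ge0|apply: adde_ge0 => //; rewrite lee_fin powR_ge0].
have mGp : measurable_fun E (fun y : Rn R n.+1 => G y `^ p)%E by exact: measurable_poweRfun.
have mcG : measurable_fun E (fun y : Rn R n.+1 => (c2 * r `^ (s * p))%:E * G y `^ p)%E.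
  by apply: emeasurable_funM => //; exact: measurable_cst.
apply: (@le_trans _ _ (\int[L]_(y in E) F2 y)%E).
  apply: ae_ge0_le_integral; first exact: mE.
  - by move=> y _; rewrite lee_fin powR_ge0.
  - exact: measurable_powR_abs.
  - by move=> y _; exact: F20.
  - apply: emeasurable_funM; first exact: measurable_cst.
    by apply: emeasurable_funD => //; exact: measurable_cst.
  exists Z; split=> // y /= /not_implyP[Ey nle]; apply: contrapT => nZ; apply: nle.
  have yw0 := Ew0 y Ey.
  have := HZ y; rewrite r2E => /(_ yw0 nZ) h.
  have PyA : `|ev P y| <= A.
    apply: PA => i; apply: le_trans (yw0 i) _.
    by rewrite ler_pdivrMr// ler_peMr ?ler1n// ltW.
  have [Gy|Gy] := ltP (G y) +oo%E; last first.
    have Gy' : G y = +oo%E by apply/eqP; rewrite -leye_eq.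
    have rp : 0 < r `^ (s * p) by rewrite powR_gt0.
    rewrite /F2 Gy' poweRyr ?gt_eqF// gt0_muley; last by rewrite lte_fin mulr_gt0.
    by rewrite addye// gt0_muley ?leey// lte_fin powR_gt0.
  have Gf : G y \is a fin_num by rewrite ge0_fin_numE.
  have g0 : 0 <= fine (G y) by rewrite fine_ge0.
  move: h; rewrite /F2 -(fineK Gf) -EFinM lee_fin poweR_EFin -!(EFinM, EFinD) lee_fin => h.
  have b0 : 0 <= K2 * (2 * r) `^ s by rewrite mulr_ge0 ?powR_ge0// ltW.
  apply: (@le_trans _ _ ((K2 * (2 * r) `^ s * fine (G y) + A) `^ p)).
    apply: ge0_ler_powR; [exact: ltW|by rewrite nnegrE|
      by rewrite nnegrE; exact: addr_ge0 (mulr_ge0 b0 g0) A0|].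
    have -> : f y = (f y - ev P y) + ev P y by rewrite subrK.
    by apply: (le_trans (ler_normD _ _)); exact: lerD.
  apply: (le_trans (powR_add_le (mulr_ge0 b0 g0) A0 (ltW p0))).
  by rewrite (powRM _ b0 g0) rhsE.
have LE : (L E <= (r ^+ n.+1)%:E)%E.
  apply: (le_trans (lebn_mono Ew0)); rewrite lebn_cube ?divr_ge0 ?(ltW r0)//.
  by rewrite [2 * _]mulrC divfK.
have F2E : (\int[L]_(y in E) F2 y = (2 `^ p)%:E * ((c2 * r `^ (s * p))%:E *
    \int[L]_(y in E) (G y `^ p) + (A `^ p)%:E * L E))%E.
  rewrite ge0_integralZl; [|exact: mE| | |by rewrite lee_fin powR_ge0]; last 2 first.
  - by apply: emeasurable_funD => //; exact: measurable_cst.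
  - by move=> y _; apply: adde_ge0 => //; rewrite lee_fin powR_ge0.
  rewrite ge0_integralD; [|exact: mE|by move=> y _; exact: cG0|exact: mcG|
    by move=> y _; rewrite lee_fin powR_ge0|exact: measurable_cst].
  rewrite (integral_cst L mE) ge0_integralZl; [by []|exact: mE|exact: mGp|
    by move=> y _; exact: Gp0|by rewrite lee_fin mulr_ge0// ltW].
rewrite F2E -[2 `^ p * _ * _]mulrA [in leRHS]EFinM -muleA; apply: lee_wpmul2l.
  by rewrite lee_fin powR_ge0.
set I := (\int[L]_(y in E) (G y `^ p))%E; set J := (\sum_(j <oo) _)%E.
have I0 : (0 <= I)%E by apply: integral_ge0 => y _; exact: Gp0.
have J0 : (0 <= J)%E.
  apply: nneseries_ge0 => j _ _; apply: mule_ge0; first by rewrite lee_fin exprn_ge0// powR_ge0.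
  by apply: integral_ge0 => y _; exact: Gp0.
have AL : ((A `^ p)%:E * L E <= (K1 * r `^ (s * p))%:E * J)%E.
  apply: le_trans HA; rewrite EFinM; apply: lee_wpmul2l => //.
  by rewrite lee_fin powR_ge0.
apply: (le_trans (leeD2l _ AL)); clearbody I J.
rewrite mulrDl EFinD ge0_muleDr//.
have u0 : (0 <= (c2 * r `^ (s * p))%:E)%E by rewrite lee_fin mulr_ge0// ltW.
have v0 : (0 <= (K1 * r `^ (s * p))%:E)%E by rewrite lee_fin mulr_ge0// ltW.
apply: leeD; rewrite ge0_muleDl//.
  by rewrite leeDl// mule_ge0.
by rewrite leeDr// mule_ge0.
Qed.

(** The function [G] of [local_estimate] has to be positive in order to dominate
    near-best approximations; the added constant is then sent to zero. *)
Lemma local_estimate_lim (K0 : R) : 0 < K0 -> exists m, exists2 K, 0 < K & forall f g t0,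
  Lmeasurable f -> Lintegrable f ->
  measurable_fun [set: Rn R n.+1] (g : Rn R n.+1 -> \bar R) ->
  (forall y, 0 <= g y)%E ->
  (forall eta, 0 < eta -> controls k s t0 f (fun y => K0%:E * (g y + eta%:E))%E) ->
  (\int[L]_y (g y `^ p) < +oo)%E ->
  hausdorff_ae d S (fun x => trace_defined f x /\ trace f x = 0) ->
  forall w0 (r : R) (E : set (Rn R n.+1)), S w0 -> 0 < r -> r <= 4^-1 -> 2 * r <= t0 ->
  measurable E -> E `<=` cube w0 (r / 2) ->
  (\int[L]_(y in E) (`|f y| `^ p)%:E <= (K * r `^ (s * p))%:E *
    (\int[L]_(y in E) (g y `^ p) +
     \sum_(j <oo) (q ^+ j)%:E * \int[L]_(y in shell S m w0 r j) (g y `^ p)))%E.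
Proof.
move=> K00; have [m [K Kp HK]] := local_estimate.
pose D := K0 `^ p * 2 `^ p.
have D0 : 0 < D by rewrite mulr_gt0// powR_gt0.
exists m, (K * D); first by rewrite mulr_gt0.
move=> f g t0 mf If mg g0 ctl Ig tr0 w0 r E Sw0 r0 r4 rt0 mE Ew0.
have q0 : 0 <= q by exact: powR_ge0.
have q1 : q < 1 by apply: powR_half_lt1; exact: sobolev_gap_gt0.
have gp0 y : (0 <= g y `^ p)%E by exact: poweR_ge0.
have mgp (A : set (Rn R n.+1)) : measurable_fun A (fun y : Rn R n.+1 => g y `^ p)%E.
  exact: measurable_poweRfun.
set I := (\int[L]_(y in E) (g y `^ p))%E.
set J := (\sum_(j <oo) _)%E.
pose M := (4 * r) ^+ n.+1.
have M0 : 0 <= M by rewrite exprn_ge0// mulr_ge0// ltW.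
pose W := M + (1 - q)^-1 * M.
have W0 : 0 <= W by rewrite addr_ge0// mulr_ge0// invr_ge0 subr_ge0 ltW.
have Kr0 : 0 < K * D * r `^ (s * p) by rewrite !mulr_gt0// powR_gt0.
have step eta : 0 < eta -> (\int[L]_(y in E) (`|f y| `^ p)%:E <=
    (K * D * r `^ (s * p))%:E * (I + J + (eta `^ p * W)%:E))%E.
  move=> eta0; pose G y := (K0%:E * (g y + eta%:E))%E.
  have mG : measurable_fun [set: Rn R n.+1] (G : Rn R n.+1 -> \bar R).
    apply: emeasurable_funM; first exact: measurable_cst.
    by apply: emeasurable_funD => //; exact: measurable_cst.
  have ge0' y : (0 <= g y + eta%:E)%E by apply: adde_ge0 => //; rewrite lee_fin ltW.
  have G0 y : (0 <= G y)%E by apply: mule_ge0 => //; rewrite lee_fin ltW.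
  have IG x (r' : R) : (\int[L]_(y in cube x r') G y < +oo)%E.
    have mc : measurable (cube x r' : set (Rn R n.+1)) by exact: measurable_cube.
    have mgc : measurable_fun (cube x r' : set (Rn R n.+1)) (g : Rn R n.+1 -> \bar R).
      exact: (measurable_funS measurableT (@subsetT _ _) mg).
    have Lc : (L (cube x r') < +oo)%E.
      have sub : cube x r' `<=` cube x `|r'|.
        by move=> y yx i; apply: le_trans (yx i) (ler_norm _).
      by apply: le_lt_trans (lebn_mono sub) _; rewrite lebn_cube// ltry.
    rewrite ge0_integralZl; [|exact: mc| |by move=> y _; exact: ge0'|by rewrite lee_fin ltW]; last first.
      by apply: emeasurable_funD => //; exact: measurable_cst.
    apply: lte_mul_pinfty; [by rewrite lee_fin ltW|by []|].
    apply: (@le_lt_trans _ _ (\int[L]_(y in cube x r') ((g y `^ p) + (1 + eta)%:E))%E).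
      apply: ge0_le_integral; first exact: mc.
      - by move=> y _; exact: ge0'.
      - by apply: emeasurable_funD => //; exact: measurable_cst.
      - by apply: emeasurable_funD => //; exact: measurable_cst.
      move=> y _; rewrite EFinD addeA leeD2r//.
      have := g0 y; case: (g y) => [u| |]//; last first.
        by move=> _; rewrite poweRyr ?gt_eqF// addye.
      rewrite !lee_fin => u0; have [u1|u1] := leP u 1.
        by rewrite (le_trans u1)// lerDr powR_ge0.
      rewrite (@le_trans _ _ (u `^ p))//; last by rewrite lerDl.
      by rewrite -[leLHS]powRr1// ler_powR ?(ltW u1)// ltW.
    rewrite ge0_integralD; [|exact: mc|by move=> y _; exact: gp0|exact: mgp|
      by move=> y _; rewrite lee_fin addr_ge0// ltW|exact: measurable_cst].
    rewrite (integral_cst L mc); apply: lte_add_pinfty.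
      apply: le_lt_trans Ig; apply: ge0_subset_integral;
        [exact: mc|exact: measurableT|exact: mgp|by move=> y _; exact: gp0|by []].
    by apply: lte_mul_pinfty; [rewrite lee_fin addr_ge0// ltW|by []|].
  apply: (le_trans (HK f G t0 mf If mG G0 (ctl eta eta0) IG tr0 w0 r E Sw0 r0 r4 rt0 mE Ew0)).
  have bound (A : set (Rn R n.+1)) : measurable A -> A `<=` cube w0 (2 * r) ->
      (\int[L]_(y in A) (G y `^ p) <= D%:E * (\int[L]_(y in A) (g y `^ p) + (eta `^ p * M)%:E))%E.
    move=> mA Aw0.
    have mgD : measurable_fun A (fun y : Rn R n.+1 => g y `^ p + (eta `^ p)%:E)%E.
      by apply: emeasurable_funD => //; exact: measurable_cst.
    have gD0 y : (0 <= g y `^ p + (eta `^ p)%:E)%E by apply: adde_ge0 => //; rewrite lee_fin powR_ge0.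
    apply: (@le_trans _ _ (\int[L]_(y in A) (D%:E * (g y `^ p + (eta `^ p)%:E)))%E).
      apply: ge0_le_integral; first exact: mA.
      - by move=> y _; exact: poweR_ge0.
      - exact: measurable_poweRfun.
      - by apply: emeasurable_funM => //; exact: measurable_cst.
      move=> y _; rewrite /G poweRM ?lee_fin ?(ltW K00)// poweR_EFin /D EFinM -muleA.
      by apply: lee_wpmul2l; [rewrite lee_fin powR_ge0|apply: poweR_add_le => //; rewrite ltW].
    rewrite ge0_integralZl; [|exact: mA|exact: mgD|by move=> y _; exact: gD0|by rewrite lee_fin ltW].
    apply: lee_wpmul2l; first by rewrite lee_fin ltW.
    rewrite ge0_integralD; [|exact: mA|by move=> y _; exact: gp0|exact: mgp|
      by move=> y _; rewrite lee_fin powR_ge0|exact: measurable_cst].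
    rewrite leeD2l// (integral_cst L mA) EFinM; apply: lee_wpmul2l.
      by rewrite lee_fin powR_ge0.
    apply: (le_trans (lebn_mono Aw0)); rewrite lebn_cube ?mulr_ge0 ?(ltW r0)//.
    by rewrite mulrA -natrM.
  have Esub : E `<=` cube w0 (2 * r).
    apply: (subset_trans Ew0); apply: cube_sub => i; rewrite subrr normr0 add0r; lra.
  have shsub j : shell S m w0 r j `<=` cube w0 (2 * r) by move=> y [[]].
  rewrite -mulrA [D * _]mulrC mulrA [leRHS](_ : _ = ((K * r `^ (s * p))%:E *
     (D%:E * (I + J + (eta `^ p * W)%:E)))%E); last by rewrite EFinM -muleA.
  apply: lee_wpmul2l; first by rewrite lee_fin mulr_ge0 ?powR_ge0// ltW.
  have sJ : (\sum_(j <oo) (q ^+ j)%:E * \int[L]_(y in shell S m w0 r j) (G y `^ p) <=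
     D%:E * (J + (eta `^ p * ((1 - q)^-1 * M))%:E))%E.
    apply: (@le_trans _ _ (\sum_(j <oo) D%:E * ((q ^+ j)%:E * (\int[L]_(y in shell S m w0 r j) (g y `^ p)) + (eta `^ p * M)%:E * (q ^+ j)%:E))%E).
      apply: lee_nneseries => [j _ _|j _].
        by apply: mule_ge0; [rewrite lee_fin exprn_ge0|apply: integral_ge0 => y _; exact: poweR_ge0].
      have ms := measurable_shell S m w0 r j.
      apply: (@le_trans _ _ ((q ^+ j)%:E * (D%:E * (\int[L]_(y in shell S m w0 r j) (g y `^ p) + (eta `^ p * M)%:E)))%E).
        by apply: lee_wpmul2l; [rewrite lee_fin exprn_ge0|exact: bound].
      rewrite muleCA; apply: lee_wpmul2l; first by rewrite lee_fin ltW.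
      rewrite ge0_muleDr//; last 2 first.
      - by apply: integral_ge0 => y _; exact: gp0.
      - by rewrite lee_fin mulr_ge0 ?powR_ge0.
      by rewrite leeD2l// muleC.
    have t0' j : (0 <= (q ^+ j)%:E * (\int[L]_(y in shell S m w0 r j) (g y `^ p)))%E.
      by apply: mule_ge0; [rewrite lee_fin exprn_ge0|apply: integral_ge0 => y _; exact: gp0].
    have t1' j : (0 <= (eta `^ p * M)%:E * (q ^+ j)%:E)%E.
      by apply: mule_ge0; rewrite lee_fin ?exprn_ge0// mulr_ge0 ?powR_ge0.
    rewrite nneseriesZl; last by move=> j _; exact: adde_ge0.
    apply: lee_wpmul2l; first by rewrite lee_fin ltW.
    rewrite nneseriesD; [|by move=> j _ _; exact: t0'|by move=> j _ _; exact: t1'].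
    rewrite leeD2l// nneseriesZl; last by move=> j _; rewrite lee_fin exprn_ge0.
    have -> : eta `^ p * ((1 - q)^-1 * M) = (eta `^ p * M) * (1 - q)^-1 by ring.
    rewrite [leRHS]EFinM; apply: lee_wpmul2l; first by rewrite lee_fin mulr_ge0 ?powR_ge0.
    exact: geometric_eseries_le.
  apply: (le_trans (leeD (bound E mE Esub) sJ)).
  have I0 : (0 <= I)%E by apply: integral_ge0 => y _; exact: gp0.
  have J0 : (0 <= J)%E.
    apply: nneseries_ge0 => j _ _.
    by apply: mule_ge0; [rewrite lee_fin exprn_ge0|apply: integral_ge0 => y _; exact: gp0].
  rewrite -ge0_muleDr; last 2 first.
  - by apply: adde_ge0 => //; rewrite lee_fin mulr_ge0 ?powR_ge0.
  - by apply: adde_ge0 => //; rewrite lee_fin !mulr_ge0 ?powR_ge0// invr_ge0 subr_ge0 ltW.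
  apply: lee_wpmul2l; first by rewrite lee_fin ltW.
  by rewrite addeACA -EFinD /W mulrDr.
have I0 : (0 <= I)%E by apply: integral_ge0 => y _; exact: gp0.
have J0 : (0 <= J)%E.
  apply: nneseries_ge0 => j _ _.
  by apply: mule_ge0; [rewrite lee_fin exprn_ge0|apply: integral_ge0 => y _; exact: gp0].
apply/lee_addgt0Pr => e e0.
pose B := K * D * r `^ (s * p) * (W + 1).
have B0 : 0 < B by rewrite mulr_gt0// ltr_wpDl.
have eta0 : 0 < (e / B) `^ p^-1 by rewrite powR_gt0// divr_gt0.
apply: (le_trans (step _ eta0)).
rewrite -powRrM mulVf ?gt_eqF// powRr1; last by rewrite divr_ge0// ltW.
rewrite ge0_muleDr; [|exact: adde_ge0|by rewrite lee_fin mulr_ge0// divr_ge0// ltW].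
rewrite leeD2l// -EFinM lee_fin.
have -> : K * D * r `^ (s * p) * (e / B * W) = e * (W / (W + 1)).
  by rewrite /B; field; rewrite !gt_eqF ?powR_gt0 ?ltr_wpDl.
by rewrite ler_piMr ?(ltW e0)// ler_pdivrMr ?ltr_wpDl// mul1r lerDl.
Qed.

End local.

(** * Approximation errors and the Triebel-Lizorkin function *)

(** The integrals compared here need not be of measurable functions: the
    integral of a nonnegative function is a supremum over simple functions. *)
Lemma ge0_le_integral_of_le d (T : measurableType d) (R : realType)
  (mu : {measure set T -> \bar R}) (D : set T) (f g : T -> \bar R) :
  (forall x, 0 <= f x)%E -> (forall x, D x -> (f x <= g x)%E) ->
  (\int[mu]_(x in D) f x <= \int[mu]_(x in D) g x)%E.
Proof.
move=> f0 fg.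
have fg' x : ((f \_ D) x <= (g \_ D) x)%E.
  by rewrite !patchE; case: ifPn => // /set_mem; exact: fg.
have f0' x : (0 <= (f \_ D) x)%E by rewrite patchE; case: ifPn.
have g0' x : (0 <= (g \_ D) x)%E by exact: le_trans (fg' x).
rewrite integral_mkcond [leRHS]integral_mkcond !ge0_integralTE//.
by apply: le_ereal_sup => _ [h hf <-]; exists h => // x; apply: le_trans (hf x) (fg' x).
Qed.

Lemma le_poweR (R : realType) (r : R) (x y : \bar R) : 0 <= r -> (0 <= x)%E ->
  (x <= y)%E -> (x `^ r <= y `^ r)%E.
Proof.
by move=> r0 x0 xy; apply: gt0_ler_poweR; rewrite ?in_itv/= ?leey ?andbT// (le_trans x0).
Qed.

Section approximation.
Context {R : realType} {n : nat}.
Local Notation V := 'rV[R]_n.+1.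
Local Notation L := (lebn R n.+1).
Implicit Types (f : V -> R) (x y : V).

Lemma measurable_err_powR f P (u : R) (D : set (Rn R n.+1)) : Lmeasurable f ->
  measurable_fun D (fun y : Rn R n.+1 => (`|f y - ev P (y : V)| `^ u)%:E).
Proof.
move=> mf; apply/measurable_EFinP; apply: (measurableT_comp (measurable_powR u)).
apply: (measurableT_comp (@normr_measurable R setT)).
apply: measurable_funB; last exact: measurable_ev.
exact: (measurable_funS measurableT (@subsetT _ _) mf).
Qed.

Lemma local_approximation_ge0 k (u : R) f (Q : set V) :
  (0 <= local_approximation k u f Q)%E.
Proof. by apply: le_ereal_inf_tmp => _ [P _ <-]; exact: poweR_ge0. Qed.

Lemma inv_lebn_cube x (r : R) : 0 < r -> ((L (cube x r))^-1 = ((2 * r) ^- n.+1)%:E)%E.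
Proof.
by move=> r0; rewrite lebn_cube ?(ltW r0)// inver gt_eqF// exprn_gt0// mulr_gt0.
Qed.

(** Passing to a cube of four times the side costs a factor independent of [u],
    because [u] is at least one. *)
Lemma local_approximation_subcube k (u : R) f x y (t t' : R) :
  Lmeasurable f -> 1 <= u -> 0 < t -> 2 * t <= t' -> t' <= 4 * t -> cube x t y ->
  (local_approximation k u f (cube x t) <=
     (4 ^+ n.+1)%:E * local_approximation k u f (cube y t'))%E.
Proof.
move=> mf u1 t0 tt' t't yx.
have t'0 : 0 < t' by lra.
have u0 : 0 < u by lra.
have c0 : 0 < 4 ^+ n.+1 :> R by rewrite exprn_gt0.
rewrite muleC -lee_pdivrMr// muleC; apply: le_ereal_inf_tmp => _ [P sP <-].
rewrite muleC lee_pdivrMr//.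
apply: (@le_trans _ _ (((L (cube x t))^-1 *
    \int[L]_(z in cube x t) (`|f z - meval (z 0) P| `^ u)%:E) `^ u^-1)%E).
  by apply: ereal_inf_lbound; exists P.
have mQ := @measurable_cube R n.
have I0 (Q : set (Rn R n.+1)) : (0 <= \int[L]_(z in Q) (`|f z - meval ((z : V) 0) P| `^ u)%:E)%E.
  by apply: integral_ge0 => z _; rewrite lee_fin powR_ge0.
set I := (\int[L]_(z in cube x t) _)%E; set I' := (\int[L]_(z in cube y t') _)%E.
have II' : (I <= I')%E.
  apply: ge0_subset_integral; [exact: mQ|exact: mQ|exact: measurable_err_powR| |].
    by move=> z _; rewrite lee_fin powR_ge0.
  apply: cube_sub => i; rewrite distrC.
  have := yx i; lra.
have cu : (4 ^+ n.+1) `^ u^-1 <= 4 ^+ n.+1 :> R.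
  have c1 : 1 <= 4 ^+ n.+1 :> R by rewrite exprn_ege1// ler1n.
  by rewrite -[leRHS]powRr1 ?ler_powR ?invf_le1// ltW.
have I0' := I0 (cube y t'); have I0x := I0 (cube x t).
rewrite !inv_lebn_cube// -/I -/I'.
apply: (@le_trans _ _ (((4 ^+ n.+1)%:E * (((2 * t') ^- n.+1)%:E * I')) `^ u^-1)%E).
  apply: le_poweR; first by rewrite invr_ge0 ltW.
    by rewrite mule_ge0// lee_fin invr_ge0 exprn_ge0// mulr_ge0// ltW.
  rewrite muleA -EFinM; apply: (le_trans (lee_wpmul2l _ II')).
    by rewrite lee_fin invr_ge0 exprn_ge0// mulr_ge0// ltW.
  rewrite lee_wpmul2r// lee_fin -exprVn -[in leRHS]exprVn -exprMn.
  rewrite lerXn2r ?nnegrE ?mulr_ge0 ?invr_ge0 ?mulr_ge0 ?(ltW t0) ?(ltW t'0)//.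
  rewrite -ler_pdivrMl// -invfM lef_pV2 ?posrE ?mulr_gt0//; lra.
rewrite poweRM ?lee_fin ?(ltW c0)//; last first.
  by rewrite mule_ge0// lee_fin invr_ge0 exprn_ge0// mulr_ge0// ltW.
rewrite muleC poweR_EFin; apply: lee_wpmul2l; first exact: poweR_ge0.
by rewrite lee_fin.
Qed.

(** On the scales between [2 * t] and [4 * t] the cubes centred at [y] contain
    [cube x t], and this range of scales has a fixed logarithmic length. *)
Lemma local_approximation_le_TL_function k (s : R) : 0 < s -> exists2 K, 0 < K &
  forall (q : \bar R) (u : R) f x y (t : R), Lmeasurable f -> (1 <= q)%E -> 1 <= u ->
  0 < t -> t <= 4^-1 -> cube x t y ->
  (local_approximation k u f (cube x t) <= (K * t `^ s)%:E * TL_function s q k u f y)%E.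
Proof.
move=> s0; have c0 : 0 < 4 ^+ n.+1 :> R by rewrite exprn_gt0.
have p4 : 0 < 4 `^ s :> R by rewrite powR_gt0.
exists (2 * (4 ^+ n.+1 * 4 `^ s)); first by rewrite !mulr_gt0.
move=> q u f x y t mf q1 u1 t0 t4 yx.
pose e := local_approximation k u f (cube x t).
have e0 : (0 <= e)%E by exact: local_approximation_ge0.
pose h t' := ((t' `^ (- s))%:E * local_approximation k u f (cube y t'))%E.
have h0 t' : (0 <= h t')%E.
  by apply: mule_ge0; [rewrite lee_fin powR_ge0|exact: local_approximation_ge0].
pose b := (((4 ^+ n.+1)^-1 * (4 * t) `^ (- s))%:E * e)%E.
have b0 : (0 <= b)%E by rewrite mule_ge0// lee_fin mulr_ge0 ?powR_ge0// invr_ge0 ltW.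
have bh t' : 2 * t <= t' -> t' <= 4 * t -> (b <= h t')%E.
  move=> h1 h2; have t'0 : 0 < t' by lra.
  rewrite /b mulrC EFinM -muleA; apply: lee_pmul.
  - by rewrite lee_fin powR_ge0.
  - by rewrite mule_ge0// lee_fin invr_ge0 ltW.
  - rewrite lee_fin !powRN lef_pV2 ?posrE ?powR_gt0 ?mulr_gt0//.
    by apply: ge0_ler_powR; rewrite ?nnegrE; lra.
  - rewrite (lee_pdivrMl _ _ c0).
    exact: (@local_approximation_subcube k u f x y t t' mf u1 t0 h1 h2 yx).
suff : (2^-1%:E * b <= TL_function s q k u f y)%E.
  rewrite -lee_pdivrMl; last by rewrite !mulr_gt0// powR_gt0.
  apply: le_trans; rewrite /b muleA -EFinM lee_wpmul2r// lee_fin.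
  rewrite powRN powRM ?(ltW t0)// !invfM !mulrA lexx//.
have b2 : (2^-1%:E * b <= b)%E.
  by rewrite -[leRHS]mul1e lee_wpmul2r// lee_fin invf_le1//; lra.
rewrite /TL_function; case: q q1 => [q| |]//.
  rewrite lee_fin => q1; have q0 : 0 < q by lra.
  pose D : set R := `[2 * t, 4 * t]%classic.
  have mD : measurable D by exact: measurable_itv.
  have I1 : ((2^-1)%:E * b `^ q <= \int[lebesgue_measure]_(t' in `]0%R, 1%R]) (h t' `^ q * t'^-1%:E))%E.
    apply: (@le_trans _ _ (\int[lebesgue_measure]_(t' in `]0%R, 1%R]) (((fun=> ((4 * t)^-1)%:E * b `^ q) \_ D) t'))%E); last first.
      apply: ge0_le_integral_of_le => [t'|t'].
        rewrite patchE; case: ifPn => // _.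
        by rewrite mule_ge0 ?poweR_ge0// lee_fin invr_ge0 mulr_ge0// ltW.
      rewrite /= in_itv/= => /andP[t'0 t'1]; rewrite patchE; case: ifPn => [|_]; last first.
        by rewrite mule_ge0 ?poweR_ge0// lee_fin invr_ge0 ltW.
      move=> /set_mem; rewrite /D/= in_itv/= => /andP[h1 h2].
      rewrite muleC; apply: lee_pmul; [exact: poweR_ge0|by rewrite lee_fin invr_ge0; lra| |].
        by apply: le_poweR; [exact: ltW|exact: b0|exact: bh].
      by rewrite lee_fin lef_pV2// posrE; lra.
    rewrite -integral_mkcondr (_ : _ `&` _ = D); last first.
      apply/seteqP; split=> [z []//|z Dz]; split=> //.
      by move: Dz; rewrite /D/= !in_itv/= => /andP[h1 h2]; lra.
    have LD : lebesgue_measure D = (2 * t)%:E.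
      rewrite /D lebesgue_measure_itv/= lte_fin ltr_pM2r// ltr_nat/= -EFinB.
      by congr _%:E; ring.
    apply: (@le_trans _ _ (((4 * t)^-1)%:E * b `^ q * (2 * t)%:E)%E); last first.
      rewrite -LD le_eqVlt; apply/orP; left; apply/eqP/esym.
      exact: (integral_cst lebesgue_measure mD).
    rewrite muleAC -EFinM lee_wpmul2r ?poweR_ge0// lee_fin.
    by rewrite le_eqVlt; apply/orP; left; apply/eqP; field; rewrite gt_eqF.
  have qV0 : 0 <= q^-1 by rewrite invr_ge0 ltW.
  apply: (@le_trans _ _ ((2^-1%:E * b `^ q) `^ q^-1)%E); last first.
    by apply: le_poweR => //; rewrite mule_ge0// poweR_ge0.
  rewrite poweRM ?poweR_ge0// -poweRrM divff ?gt_eqF// poweRe1// poweR_EFin.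
  rewrite lee_wpmul2r// lee_fin -[leLHS]powRr1//.
  apply: ger_powR; first by rewrite invr_gt0 invf_le1//; lra.
  by rewrite invf_le1.
move=> _; apply: (le_trans b2); apply: (@le_trans _ _ (h (4 * t))).
  by apply: bh; lra.
by apply: ereal_sup_ubound; exists (4 * t) => //=; rewrite in_itv/=; lra.
Qed.

Lemma TL_function_ge0 (s : R) q k (u : R) f x : (0 <= TL_function s q k u f x)%E.
Proof.
rewrite /TL_function; case: q => [q| |]//; first exact: poweR_ge0.
apply: (@le_trans _ _ ((1 `^ (- s))%:E * local_approximation k u f (cube x 1))%E).
  by rewrite mule_ge0 ?local_approximation_ge0// lee_fin powR_ge0.
by apply: ereal_sup_ubound; exists 1 => //=; rewrite in_itv/=; lra.
Qed.

(** Instead of Hoelder's inequality, [a <= lam + lam `^ (1 - u) * a `^ u] is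
    integrated, with [lam] slightly above the approximation error. *)
Lemma TL_function_controls k (s : R) : 0 < s -> exists2 K, 0 < K &
  forall (q : \bar R) (u : R) f, Lmeasurable f -> (1 <= q)%E -> 1 <= u ->
  forall eta, 0 < eta ->
  controls k s 4^-1 f (fun y => K%:E * (TL_function s q k u f y + eta%:E))%E.
Proof.
move=> s0; have [K K0 HK] := @local_approximation_le_TL_function k s s0.
exists (2 * 2 ^+ n.+1 * K); first by rewrite !mulr_gt0// exprn_gt0.
move=> q u f mf q1 u1 eta eta0 x t t0 t4.
have u0 : 0 < u by lra.
have ts0 : 0 < t `^ s by rewrite powR_gt0.
have tn0 : 0 < t ^+ n.+1 by rewrite exprn_gt0.
have e0 := local_approximation_ge0 k u f (cube x t).
have He y : cube x t y -> _ := fun yx => HK q u f x y t mf q1 u1 t0 t4 yx.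
have [ei|ef] := eqVneq (local_approximation k u f (cube x t)) +oo%E.
  exists 0; first by rewrite mmeasure0.
  move=> y yx; have := He y yx; rewrite ei leye_eq => /eqP Kg.
  have -> : TL_function s q k u f y = +oo%E.
    have := TL_function_ge0 s q k u f y.
    by case: (TL_function _ _ _ _ _ _) Kg => [g| |]//; rewrite -EFinM.
  rewrite addye// !gt0_muley ?leey// ?gt0_muley ?lte_fin ?mulr_gt0 ?exprn_gt0//.
pose e := fine (local_approximation k u f (cube x t)).
have eE : local_approximation k u f (cube x t) = e%:E.
  by rewrite fineK// ge0_fin_numE// ltey.
rewrite eE lee_fin in e0 He.
pose lam := e + K * t `^ s * eta.
have kt0 : 0 < K * t `^ s * eta by rewrite !mulr_gt0.
have elam : e < lam by rewrite ltrDl.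
have lam0 : 0 < lam by exact: le_lt_trans elam.
have : (local_approximation k u f (cube x t) < lam%:E)%E by rewrite eE lte_fin.
move=> /ereal_inf_lt[_ [P sP <-]] Plam.
exists P => // y yx.
have mQ : measurable (cube x t : set (Rn R n.+1)) by exact: measurable_cube.
have LQ : L (cube x t) = (2 ^+ n.+1 * t ^+ n.+1)%:E by rewrite lebn_cube ?exprMn// ltW.
have Q0 : 0 < 2 ^+ n.+1 * t ^+ n.+1 :> R by rewrite mulr_gt0// exprn_gt0.
set I := (\int[L]_(z in cube x t) (`|f z - meval (z 0) P| `^ u)%:E)%E in Plam.
have I0 : (0 <= I)%E by apply: integral_ge0 => z _; rewrite lee_fin powR_ge0.
have HI : (I <= (lam `^ u * (2 ^+ n.+1 * t ^+ n.+1))%:E)%E.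
  rewrite EFinM -lee_pdivrMr// muleC.
  have := le_poweR (ltW u0) (poweR_ge0 _ _) (ltW Plam).
  rewrite -poweRrM mulVf ?gt_eqF// poweR_EFin; apply: le_trans.
  rewrite poweRe1 ?inv_lebn_cube ?exprMn//.
  by rewrite mule_ge0// lee_fin invr_ge0 ltW.
have HE : (errint f P x t <= (2 * lam * (2 ^+ n.+1 * t ^+ n.+1))%:E)%E.
  apply: (@le_trans _ _ (\int[L]_(z in cube x t)
      (lam%:E + (lam `^ (1 - u))%:E * (`|f z - ev P z| `^ u)%:E))%E).
    apply: ge0_le_integral_of_le => [z|z _]; first by rewrite lee_fin.
    rewrite -EFinM -EFinD lee_fin; move: `|_| (normr_ge0 (f z - ev P z)) => a a0 {He}.
    have [al|la] := leP a lam; first by rewrite (le_trans al)// lerDl mulr_ge0// powR_ge0.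
    apply: (@le_trans _ _ (lam `^ (1 - u) * a `^ u)); last by rewrite lerDr ltW.
    have au : a = a `^ (1 - u) * a `^ u.
      by rewrite -powRD ?subrK ?powRr1// (gt_eqF (lt_trans lam0 la)) implybT.
    rewrite [leLHS]au ler_wpM2r ?powR_ge0// -opprB !powRN lef_pV2 ?posrE ?powR_gt0//.
      by rewrite ge0_ler_powR ?nnegrE ?subr_ge0// ltW.
    exact: lt_trans la.
  have mu : measurable_fun (cube x t : set (Rn R n.+1))
     (fun z : Rn R n.+1 => (lam `^ (1 - u))%:E * (`|f z - ev P (z : V)| `^ u)%:E)%E.
    by apply: emeasurable_funM; [exact: measurable_cst|exact: measurable_err_powR].
  rewrite ge0_integralD; [|exact: mQ|by move=> z _; rewrite lee_fin ltW|exact: measurable_cst| |exact: mu]; last first.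
    by move=> z _; rewrite -EFinM lee_fin mulr_ge0// powR_ge0.
  rewrite (integral_cst L mQ) ge0_integralZl; [|exact: mQ|exact: measurable_err_powR| |by rewrite lee_fin powR_ge0]; last first.
    by move=> z _; rewrite lee_fin powR_ge0.
  rewrite LQ -/I; apply: (@le_trans _ _ (lam%:E * (2 ^+ n.+1 * t ^+ n.+1)%:E +
     (lam `^ (1 - u))%:E * (lam `^ u * (2 ^+ n.+1 * t ^+ n.+1))%:E)%E).
    by rewrite leeD2l// lee_wpmul2l// lee_fin powR_ge0.
  have lamE : lam `^ (1 - u) * lam `^ u = lam.
    by rewrite -powRD ?subrK ?powRr1 ?(ltW lam0)// (gt_eqF lam0) implybT.
  rewrite -!EFinM -EFinD lee_fin [_ `^ (1 - u) * _]mulrA lamE.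
  by rewrite le_eqVlt; apply/orP; left; apply/eqP; ring.
apply: (le_trans HE).
set g := TL_function s q k u f y.
have g0 : (0 <= g)%E by exact: TL_function_ge0.
apply: (@le_trans _ _ ((2 * 2 ^+ n.+1 * t ^+ n.+1)%:E * ((K * t `^ s)%:E * (g + eta%:E)))%E).
  rewrite (_ : 2 * lam * _ = 2 * 2 ^+ n.+1 * t ^+ n.+1 * lam); last by ring.
  rewrite EFinM; apply: lee_wpmul2l; first by rewrite lee_fin !mulr_ge0 ?exprn_ge0// ltW.
  rewrite ge0_muleDr ?lee_fin ?(ltW eta0)// /lam EFinD leeD ?He//.
rewrite !muleA -!EFinM lee_wpmul2r ?adde_ge0 ?lee_fin ?(ltW eta0)//.
by rewrite le_eqVlt; apply/orP; left; apply/eqP; ring.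
Qed.
End approximation.

(** * Summation over the layers around the set *)

(** The indices satisfying [P] lie in the window that starts at the least one. *)
Lemma window_count (P : pred nat) (m M : nat) :
  (forall a b, P a -> P b -> (b <= a + m)%N) -> (count P (iota 0 M) <= m.+1)%N.
Proof.
move=> Pm; have [/hasP[a aM Pa]|] := boolP (has P (iota 0 M)); last first.
  by rewrite has_count -leqNgt leqn0 => /eqP->.
have exP : exists a, P a by exists a.
case: (ex_minnP exP) => a0 Pa0 amin.
rewrite -size_filter -[leqRHS](size_iota a0); apply: uniq_leq_size.
  exact/filter_uniq/iota_uniq.
move=> b; rewrite mem_filter => /andP[Pb _].
by rewrite mem_iota; apply/andP; split; [exact: amin|rewrite addnS ltnS Pm].
Qed.

Lemma sume_count (R : realType) (x : \bar R) (P : pred nat) (s : seq nat) : (0 <= x)%E ->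
  (\sum_(l <- s | P l) x = (count P s)%:R%:E * x)%E.
Proof.
move=> x0; elim: s => [|l s IH]; first by rewrite big_nil/= mul0e.
rewrite big_cons IH /=; case: (P l) => //=.
by rewrite add1n -natr1 EFinD addeC ge0_muleDl ?mul1e ?lee_fin.
Qed.

Lemma overlap_integral d (T : measurableType d) (R : realType)
  (mu : {measure set T -> \bar R}) (A : nat -> set T) (B : set T) (h : T -> \bar R) (N : nat) :
  (forall l, measurable (A l)) -> measurable B -> measurable_fun setT h ->
  (forall y, 0 <= h y)%E -> (forall l, A l `<=` B) ->
  (forall y M, (count (fun l => y \in A l) (iota 0 M) <= N)%N) ->
  (\sum_(l <oo) \int[mu]_(y in A l) h y <= N%:R%:E * \int[mu]_(y in B) h y)%E.
Proof.
move=> mA mB mh h0 AB cnt.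
have r0 (X : set T) y : (0 <= (h \_ X) y)%E by rewrite patchE; case: ifPn.
have mr (X : set T) : measurable X -> measurable_fun setT (h \_ X).
  move=> mX; apply/(measurable_restrictT _ mX).
  exact: (measurable_funS measurableT (@subsetT _ _) mh).
rewrite (eq_eseriesr (fun l _ => integral_mkcond (A l) h)).
rewrite -(integral_nneseries mu measurableT (fun l => mr _ (mA l)) (fun l y _ => r0 (A l) y)).
rewrite [in leRHS]integral_mkcond -(ge0_integralZl mu measurableT (mr B mB) (fun y _ => r0 B y)); last first.
  by rewrite lee_fin.
apply: ge0_le_integral_of_le => [y|y _]; first by apply: nneseries_ge0 => l _ _; exact: r0.
apply: lime_le; first by apply: is_cvg_nneseries => l _ _; exact: r0.
apply: nearW => M; under eq_bigr => l _ do rewrite patchE.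
rewrite -big_mkcond/= sume_count// patchE; case: ifPn => [_|nB].
  by rewrite lee_wpmul2r// lee_fin ler_nat /index_iota subn0.
rewrite mule0; apply: (@le_trans _ _ (0%:E * h y)%E); last by rewrite mul0e.
rewrite lee_wpmul2r// lee_fin lern0 eqn0Ngt -has_count; apply/hasPn => l _ /=.
by apply: contra nB => /set_mem yA; apply/mem_set; exact: AB yA.
Qed.

Section layers.
Context {R : realType} {n : nat}.
Local Notation V := 'rV[R]_n.+1.
Local Notation L := (lebn R n.+1).
Variables (S : set V).
Implicit Types (x y w z : V).

Definition layer (h : R) : set V :=
  [set y | (h%:E <= edist_inf S y)%E] `&` [set y | (edist_inf S y < (2 * h)%:E)%E].

Definition band (m : nat) (t : R) : set V :=
  [set y | ((t / 2 ^+ m)%:E <= edist_inf S y)%E] `&` [set y | (edist_inf S y <= t%:E)%E].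

(** A cube that contains all the cubes used in the estimate on the [l]-th cell
    of mesh [h]. The empty cells are set apart since they have no position. *)
Definition cell_hull (h : R) (l : nat) : set V :=
  if pselect ((cell h l : set V) !=set0) then cube (cell_center h l) (20 * h) else set0.

Lemma measurable_layer h : measurable (layer h : set (Rn R n.+1)).
Proof.
have md := @measurable_edist_inf R n S setT.
have m1 := emeasurable_fun_c_infty measurableT md h%:E; rewrite setTI in m1.
exact: (emeasurable_fun_infty_o m1 (@measurable_edist_inf R n S _)).
Qed.

Lemma measurable_band m t : measurable (band m t : set (Rn R n.+1)).
Proof.
have md := @measurable_edist_inf R n S setT.
have m1 := emeasurable_fun_c_infty measurableT md (t / 2 ^+ m)%:E; rewrite setTI in m1.
exact: (emeasurable_fun_infty_c m1 (@measurable_edist_inf R n S _)).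
Qed.

Lemma measurable_cell_hull h l : measurable (cell_hull h l : set (Rn R n.+1)).
Proof. by rewrite /cell_hull; case: pselect => _ //=; exact: measurable_cube. Qed.

(** The cells whose hulls contain a given point are disjoint and lie in a cube
    around it, so that their number is bounded by volume. *)
Lemma cell_hull_overlap (h : R) y M : 0 < h ->
  (count (fun l => y \in cell_hull h l) (iota 0 M) <= 42 ^ n.+1)%N.
Proof.
move=> h0; rewrite -size_filter.
pose s := [seq l <- iota 0 M | y \in cell_hull h l]; rewrite -/s.
have us : uniq s by exact/filter_uniq/iota_uniq.
have sP l : l \in s -> (cell h l : set V) !=set0 /\ cell h l `<=` cube y (21 * h).
  rewrite mem_filter => /andP[/set_mem + _]; rewrite /cell_hull.
  case: pselect => //= ne yl; split=> // z /(cell_sub_cube h0) zl i.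
  have := ler_distD (cell_center h l 0 i) (z 0 i) (y 0 i).
  have h1 := yl i; rewrite [`|cell_center _ _ _ _ - _|]distrC => h3; have h2 := zl i.
  by apply: (le_trans h3); lra.
have hn0 : 0 < h ^+ n.+1 by rewrite exprn_gt0.
have LU : L (\bigcup_(l in [set` s]) cell h l) = (h ^+ n.+1 *+ size s)%:E.
  rewrite measure_fin_bigcup; first last.
  - by move=> l _; exact: measurable_cell.
  - exact: sub_trivIset (@subsetT _ _) (@cell_trivIset R n h).
  - exact: finite_seq.
  rewrite -fsbig_seq// big_seq (eq_bigr (fun=> (h ^+ n.+1)%:E)); last first.
    by move=> l ls; exact: lebn_cell h0 (sP l ls).1.
  by rewrite -big_seq sumEFin big_const_seq count_predT iter_addr_0.
have : (L (\bigcup_(l in [set` s]) cell h l) <= L (cube y (21 * h)))%E.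
  by apply: lebn_mono => z [l ls]; exact: (sP l ls).2.
rewrite LU lebn_cube ?mulr_ge0 ?(ltW h0)// lee_fin -mulr_natl.
rewrite (_ : 2 * (21 * h) = 42 * h); last by ring.
by rewrite exprMn ler_pM2r// -natrX ler_nat.
Qed.

Lemma band_overlap m (t : R) y M : 0 < t ->
  (count (fun a => y \in band m (t / 2 ^+ a)) (iota 0 M) <= m.+1)%N.
Proof.
move=> t0; apply: window_count => a b /set_mem[/= h1 _] /set_mem[/= _ h2].
have := le_trans h1 h2; rewrite lee_fin -mulrA -invfM -exprD ler_pM2l//.
by rewrite lef_pV2 ?posrE ?exprn_gt0// ler_eXn2l// ltr1n.
Qed.

Lemma layer_overlap (t : R) y M : 0 < t ->
  (count (fun a => y \in layer (t / 2 ^+ a)) (iota 0 M) <= 1)%N.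
Proof.
move=> t0; apply: window_count => a b /set_mem[/= h1 _] /set_mem[/= _ h2].
have := le_lt_trans h1 h2; rewrite lte_fin mulrCA ltr_pM2l// addn0 => h3.
rewrite leqNgt; apply/negP => ab; move: h3; apply/negP; rewrite -leNgt.
rewrite -ler_pdivlMl// -invfM -exprS lef_pV2 ?posrE ?exprn_gt0//.
by rewrite ler_eXn2l// ltr1n.
Qed.

Lemma edist_inf_closed y : closed S -> (edist_inf S y <= 0)%E -> S y.
Proof.
move=> cS y0; apply: cS => B /nbhs_ballP[e /= e0 eB].
have : (edist_inf S y < (e / 2)%:E)%E by rewrite (le_lt_trans y0)// lte_fin divr_gt0.
move=> /edist_inf_lt_cube[z Sz zy]; exists z; split=> //; apply: eB; split=> // i j.
rewrite (ord1 i) -ball_normE/=; apply: le_lt_trans (zy j) _; lra.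
Qed.

Lemma layer_exists (t : R) y : 0 < t -> (0 < edist_inf S y)%E ->
  (edist_inf S y < (2 * t)%:E)%E -> exists i, layer (t / 2 ^+ i) y.
Proof.
move=> t0 y0 yt; have dE : edist_inf S y = (fine (edist_inf S y))%:E.
  by rewrite fineK// gt0_fin_numE// (lt_trans yt)// ltry.
rewrite dE in y0 yt; rewrite lte_fin in y0.
have ex : exists i, t / 2 ^+ i <= fine (edist_inf S y).
  have h0 : 0 <= 2^-1 :> R by [].
  have h1 : 2^-1 < 1 :> R by rewrite invf_lt1//; lra.
  have [i hi] := filter_ex (small_pow t h0 h1 y0).
  by exists i; rewrite -exprVn.
case: (ex_minnP ex) => i hi imin; exists i; split; rewrite /= dE ?lee_fin//.
case: i hi imin => [|i] hi imin; first by rewrite expr0 divr1.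
rewrite lte_fin exprS invfM mulrCA (mulrA 2) divff// mul1r ltNge; apply/negP => /imin.
by rewrite ltnn.
Qed.

End layers.

Lemma nneseries_ge_term (R : realType) (u : nat -> \bar R) k :
  (forall l, 0 <= u l)%E -> (u k <= \sum_(l <oo) u l)%E.
Proof.
move=> u0; rewrite (@nneseriesD1 _ u k xpredT)//; apply: leeDl.
exact: nneseries_ge0.
Qed.

Section assembly.
Context {R : realType} {n : nat}.
Local Notation V := 'rV[R]_n.+1.
Local Notation L := (lebn R n.+1).
Variables (d p s : R) (k : nat) (S : set V) (C : R).
Hypotheses (nd : n%:R < d) (dn : d < n.+1%:R) (C1 : 1 < C).
Hypothesis HS : forall w (r : R), S w -> 0 < r <= 1 ->
  ((C^-1 * r `^ d)%:E <= hausdorff_measure d (cube w r `&` S) <= (C * r `^ d)%:E)%E.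
Hypotheses (p1 : 1 < p) (ps : (n.+1%:R - d) / p < s).
Implicit Types (f : V -> R) (g : V -> \bar R) (w x y z : V).
Local Notation q := (2^-1 `^ (@sobolev_gap R n d p s)).

(** The mesh of the [i]-th grid; it is small enough for cubes of eight times
    this size to be in the range of [local_estimate_lim]. *)
Local Notation mesh i := (64^-1 / 2 ^+ i : R).

Definition piece i l : set V := layer S (mesh i) `&` cell (mesh i) l.

Let mesh_gt0 i : 0 < mesh i.
Proof. by rewrite divr_gt0// exprn_gt0. Qed.

Let mesh_le i : mesh i <= 64^-1.
Proof.
by rewrite ler_pdivrMr ?exprn_gt0// ler_peMr// exprn_ege1// ler1n.
Qed.

Lemma measurable_piece i l : measurable (piece i l : set (Rn R n.+1)).
Proof. by apply: measurableI; [exact: measurable_layer|exact: measurable_cell]. Qed.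

(** A nonempty piece has a point of [S] close to it; the shells around this point
    lie in the hull of the cell. *)
Lemma piece_estimate (K0 : R) : 0 < K0 -> exists m, exists2 K, 0 < K & forall f g,
  Lmeasurable f -> Lintegrable f ->
  measurable_fun [set: Rn R n.+1] (g : Rn R n.+1 -> \bar R) ->
  (forall y, 0 <= g y)%E ->
  (forall eta, 0 < eta -> controls k s 4^-1 f (fun y => K0%:E * (g y + eta%:E))%E) ->
  (\int[L]_y (g y `^ p) < +oo)%E ->
  hausdorff_ae d S (fun x => trace_defined f x /\ trace f x = 0) ->
  forall i l,
  (\int[L]_(y in piece i l) (`|f y| `^ p)%:E <= (K * mesh i `^ (s * p))%:E *
    (\int[L]_(y in piece i l) (g y `^ p) +
     \sum_(j <oo) (q ^+ j)%:E *
        \int[L]_(y in cell_hull (mesh i) l `&` band S m (8^-1 / 2 ^+ (i + j))) (g y `^ p)))%E.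
Proof.
move=> K00; have [m [K Kp HK]] := local_estimate_lim k nd dn C1 HS p1 ps K00.
exists m, (K * 8 `^ (s * p)); first by rewrite mulr_gt0// powR_gt0.
move=> f g mf If mg g0 ctl Ig tr0 i l.
have gp0 y : (0 <= g y `^ p)%E by exact: poweR_ge0.
have h0 := mesh_gt0 i; have h64 := mesh_le i.
have [E0|/set0P[y0 y0E]] := eqVneq (piece i l) set0.
  rewrite E0 integral_set0; apply: mule_ge0.
    by rewrite lee_fin !mulr_ge0 ?powR_ge0// ltW.
  apply: adde_ge0; first by apply: integral_ge0 => y _; exact: gp0.
  apply: nneseries_ge0 => j _ _; apply: mule_ge0; first by rewrite lee_fin exprn_ge0// powR_ge0.
  by apply: integral_ge0 => y _; exact: gp0.
have [[_ /= /edist_inf_lt_cube[w Sw y0w]] y0c] := y0E.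
have y0c' := cell_sub_cube h0 y0c.
have r0 : 0 < 8 * mesh i by rewrite mulr_gt0.
have r4 : 8 * mesh i <= 4^-1 by lra.
have rt0 : 2 * (8 * mesh i) <= 4^-1 by lra.
have Ew : piece i l `<=` cube w (8 * mesh i / 2).
  move=> y [_ /(cell_sub_cube h0) yc] a.
  have h1 := yc a; have h2 := y0c' a; have h3 := y0w a.
  have := dist_le2 h1 h2; have := ler_distD (y0 0 a) (y 0 a) (w 0 a); move: h0 h3.
  move: (mesh i) => h ? ? ? ?; lra.
apply: (le_trans (HK f g 4^-1 mf If mg g0 ctl Ig tr0 w _ _ Sw r0 r4 rt0 (measurable_piece i l) Ew)).
rewrite powRM ?(ltW h0)// mulrA; apply: lee_wpmul2l.
  by rewrite lee_fin !mulr_ge0 ?powR_ge0// ltW.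
rewrite leeD2l//; apply: lee_nneseries => [j _ _|j _].
  apply: mule_ge0; first by rewrite lee_fin exprn_ge0// powR_ge0.
  by apply: integral_ge0 => y _; exact: gp0.
apply: lee_wpmul2l; first by rewrite lee_fin exprn_ge0// powR_ge0.
apply: ge0_subset_integral.
- exact: measurable_shell.
- by apply: measurableI; [exact: measurable_cell_hull|exact: measurable_band].
- exact: measurable_poweRfun.
- by move=> y _; exact: gp0.
have rE a : 8 * mesh i / 2 ^+ a = 8^-1 / 2 ^+ (i + a).
  by rewrite exprD; field; rewrite !gt_eqF ?exprn_gt0.
move=> y [[yw /=]]; rewrite !rE => y1 y2; split; last first.
  by split=> //=; rewrite -mulrA -invfM -exprD -addnA.
rewrite /cell_hull; case: pselect => /= [_|[]]; last by exists y0.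
move=> a; have h1 := yw a; have h2 := y0w a; have h3 := y0c' a.
have := ler_distD (w 0 a) (y 0 a) (cell_center (mesh i) l 0 a).
have := ler_distD (y0 0 a) (w 0 a) (cell_center (mesh i) l 0 a).
move: h1 h2 h3 h0; rewrite [`|y0 0 a - w 0 a|]distrC.
move: (cell_center (mesh i) l 0 a) (mesh i) => c h ? ? ? ? ? ?; lra.
Qed.

(** Each scale of the sum over the cells sees a given point boundedly often:
    the hulls of the cells of one mesh overlap boundedly, the bands of the
    different meshes do so too, and the weights [q ^+ j] are summable. *)
Lemma layers_estimate (K0 : R) : 0 < K0 -> exists2 K, 0 < K & forall f g,
  Lmeasurable f -> Lintegrable f ->
  measurable_fun [set: Rn R n.+1] (g : Rn R n.+1 -> \bar R) ->
  (forall y, 0 <= g y)%E ->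
  (forall eta, 0 < eta -> controls k s 4^-1 f (fun y => K0%:E * (g y + eta%:E))%E) ->
  (\int[L]_y (g y `^ p) < +oo)%E ->
  hausdorff_ae d S (fun x => trace_defined f x /\ trace f x = 0) ->
  (\sum_(i <oo) \sum_(l <oo) (mesh i `^ (- (s * p)))%:E *
      \int[L]_(y in piece i l) (`|f y| `^ p)%:E <= K%:E * \int[L]_y (g y `^ p))%E.
Proof.
move=> K00; have [m [K Kp HK]] := piece_estimate K00.
have q0 : 0 <= q by exact: powR_ge0.
have q1 : q < 1 by apply: powR_half_lt1; exact: sobolev_gap_gt0.
pose N : R := (42 ^ n.+1)%:R.
pose B := N * (m.+1%:R * (1 - q)^-1).
have B0 : 0 <= B by rewrite !mulr_ge0// invr_ge0 subr_ge0 ltW.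
exists (K * (1 + B)); first by rewrite mulr_gt0// ltr_wpDr.
move=> f g mf If mg g0 ctl Ig tr0.
have Hp := HK f g mf If mg g0 ctl Ig tr0.
pose gam (y : Rn R n.+1) := (g y `^ p)%E.
have gam0 y : (0 <= gam y)%E by exact: poweR_ge0.
have mgam : measurable_fun [set: Rn R n.+1] gam by exact: measurable_poweRfun.
pose I (A : set (Rn R n.+1)) := (\int[L]_(y in A) gam y)%E.
have I0 A : (0 <= I A)%E by apply: integral_ge0 => y _; exact: gam0.
have qI0 j A : (0 <= (q ^+ j)%:E * I A)%E.
  by apply: mule_ge0 => //; rewrite lee_fin exprn_ge0.
pose T i l j := cell_hull (mesh i) l `&` band S m (8^-1 / 2 ^+ (i + j)) : set (Rn R n.+1).
have mT i l j : measurable (T i l j).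
  by apply: measurableI; [exact: measurable_cell_hull|exact: measurable_band].
have S0 i l : (0 <= \sum_(j <oo) (q ^+ j)%:E * I (T i l j))%E.
  by apply: nneseries_ge0 => j _ _; exact: qI0.
have one i l : ((mesh i `^ (- (s * p)))%:E * \int[L]_(y in piece i l) (`|f y| `^ p)%:E <=
    K%:E * (I (piece i l) + \sum_(j <oo) (q ^+ j)%:E * I (T i l j)))%E.
  rewrite powRN lee_pdivrMl ?powR_gt0// muleA -EFinM [_ * K]mulrC; exact: Hp.
have cells i : (\sum_(l <oo) (mesh i `^ (- (s * p)))%:E * \int[L]_(y in piece i l) (`|f y| `^ p)%:E <=
    K%:E * (I (layer S (mesh i)) + N%:E * \sum_(j <oo) (q ^+ j)%:E * I (band S m (8^-1 / 2 ^+ (i + j)))))%E.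
  apply: (@le_trans _ _ (\sum_(l <oo) K%:E * (I (piece i l) + \sum_(j <oo) (q ^+ j)%:E * I (T i l j)))%E).
    apply: lee_nneseries => [l _ _|l _]; last exact: one.
    apply: mule_ge0; first by rewrite lee_fin powR_ge0.
    by apply: integral_ge0 => y _; rewrite lee_fin powR_ge0.
  rewrite nneseriesZl; last by move=> l _; exact: adde_ge0.
  apply: lee_wpmul2l; first by rewrite lee_fin ltW.
  rewrite nneseriesD; [|by move=> l _ _; exact: I0|by move=> l _ _; exact: S0].
  apply: leeD.
    rewrite -[leRHS]mul1e; apply: (@overlap_integral _ _ _ L _ _ gam 1).
    - by move=> l; exact: measurable_piece.
    - exact: measurable_layer.
    - exact: mgam.
    - exact: gam0.
    - by move=> l y [].
    move=> y M; apply: window_count => a b /set_mem[_ /= <-] /set_mem[_ /= <-].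
    by rewrite addn0.
  rewrite (nneseries_interchange xpredT xpredT); last by move=> l j; exact: qI0.
  rewrite -nneseriesZl; last by move=> j _; exact: qI0.
  apply: lee_nneseries => [j _ _|j _]; first by apply: nneseries_ge0 => l _ _; exact: qI0.
  rewrite nneseriesZl; last by move=> l _; exact: I0.
  rewrite muleCA; apply: lee_wpmul2l; first by rewrite lee_fin exprn_ge0.
  apply: (@overlap_integral _ _ _ L _ _ gam).
  - by move=> l; exact: mT.
  - exact: measurable_band.
  - exact: mgam.
  - exact: gam0.
  - by move=> l y [].
  move=> y M; refine (leq_trans _ (@cell_hull_overlap R n (mesh i) y M (mesh_gt0 i))).
  by apply: sub_count => l /set_mem[yl _]; exact/mem_set.
apply: (@le_trans _ _ (\sum_(i <oo) K%:E * (I (layer S (mesh i)) +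
    N%:E * \sum_(j <oo) (q ^+ j)%:E * I (band S m (8^-1 / 2 ^+ (i + j)))))%E).
  apply: lee_nneseries => [i _ _|i _]; last exact: cells.
  apply: nneseries_ge0 => l _ _; apply: mule_ge0; first by rewrite lee_fin powR_ge0.
  by apply: integral_ge0 => y _; rewrite lee_fin powR_ge0.
have J0 i : (0 <= \sum_(j <oo) (q ^+ j)%:E * I (band S m (8^-1 / 2 ^+ (i + j))))%E.
  by apply: nneseries_ge0 => j _ _; exact: qI0.
have N0 : (0 <= N%:E)%E by rewrite lee_fin.
rewrite nneseriesZl; last by move=> i _; apply: adde_ge0 => //; exact: mule_ge0.
rewrite EFinM -muleA; apply: lee_wpmul2l; first by rewrite lee_fin ltW.
rewrite nneseriesD; [|by move=> i _ _; exact: I0|by move=> i _ _; exact: mule_ge0].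
rewrite EFinD ge0_muleDl ?lee_fin//; apply: leeD.
  apply: (@overlap_integral _ _ _ L _ _ gam 1).
  - by move=> i; exact: measurable_layer.
  - exact: measurableT.
  - exact: mgam.
  - exact: gam0.
  - by [].
  by move=> y M; exact: layer_overlap.
rewrite nneseriesZl; last by move=> i _; exact: J0.
rewrite /B EFinM -muleA; apply: lee_wpmul2l; first exact: N0.
rewrite (nneseries_interchange xpredT xpredT); last by move=> i j; exact: qI0.
apply: (@le_trans _ _ (\sum_(j <oo) (m.+1%:R%:E * I setT) * (q ^+ j)%:E)%E).
  apply: lee_nneseries => [j _ _|j _]; first by apply: nneseries_ge0 => i _ _; exact: qI0.
  rewrite nneseriesZl; last by move=> i _; exact: I0.
  rewrite muleC; apply: lee_wpmul2r; first by rewrite lee_fin exprn_ge0.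
  apply: (@overlap_integral _ _ _ L _ _ gam).
  - by move=> i; exact: measurable_band.
  - exact: measurableT.
  - exact: mgam.
  - exact: gam0.
  - by [].
  move=> y M; under eq_count => i do rewrite exprD [2 ^+ i * _]mulrC invfM mulrA.
  by apply: band_overlap; rewrite divr_gt0// exprn_gt0.
have If' : I setT \is a fin_num by rewrite ge0_fin_numE.
rewrite -[I setT]fineK// -EFinM nneseriesZl; last by move=> j _; rewrite lee_fin exprn_ge0.
have -> : (\int[L]_y (g y `^ p))%E = (fine (I setT))%:E by rewrite fineK.
have -> : ((m.+1%:R / (1 - q))%:E * (fine (I setT))%:E = (m.+1%:R * fine (I setT))%:E * ((1 - q)^-1)%:E)%E.
  by rewrite -!EFinM mulrAC.
apply: lee_wpmul2l.
  by rewrite lee_fin mulr_ge0// fine_ge0.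
exact: geometric_eseries_le.
Qed.

Lemma inv_poweR_le (a : \bar R) (b e : R) : 0 < b -> 0 < e -> (b%:E <= a)%E ->
  ((a `^ e)^-1 <= (b `^ (- e))%:E)%E.
Proof.
move=> b0 e0 ba; have be : 0 < b `^ e by rewrite powR_gt0.
have -> : (b `^ (- e))%:E = ((b%:E `^ e)^-1)%E.
  by rewrite poweR_EFin inver gt_eqF// powRN.
rewrite lee_pV2 ?inE ?poweR_ge0//; apply: le_poweR => //; first exact: ltW.
by rewrite lee_fin ltW.
Qed.

(** The set itself is negligible and the weight is bounded away from it; in
    between the weight is almost constant on each layer. *)
Lemma hardy_estimate (K0 : R) : closed S -> 0 < K0 -> exists2 K, 0 < K & forall f g,
  Lmeasurable f -> Lintegrable f ->
  measurable_fun [set: Rn R n.+1] (g : Rn R n.+1 -> \bar R) ->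
  (forall y, 0 <= g y)%E ->
  (forall eta, 0 < eta -> controls k s 4^-1 f (fun y => K0%:E * (g y + eta%:E))%E) ->
  (\int[L]_y (g y `^ p) < +oo)%E ->
  hausdorff_ae d S (fun x => trace_defined f x /\ trace f x = 0) ->
  (\int[L]_y ((`|f y| `^ p)%:E * (edist_inf S y `^ (s * p))^-1) <=
     K%:E * (\int[L]_y (`|f y| `^ p)%:E + \int[L]_y (g y `^ p)))%E.
Proof.
move=> cS K00; have [K Kp HK] := layers_estimate K00.
have p0 : 0 < p by exact: lt_trans ltr01 p1.
have d0 : 0 < d by apply: le_lt_trans nd; rewrite ler0n.
have s0 : 0 < s by apply: lt_trans ps; rewrite divr_gt0// subr_gt0.
have sp0 : 0 < s * p by exact: mulr_gt0.
pose c : R := 32^-1 `^ (- (s * p)).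
have c0 : 0 < c by rewrite powR_gt0.
exists (c + K); first exact: addr_gt0.
move=> f g mf If mg g0 ctl Ig tr0.
have Hl := HK f g mf If mg g0 ctl Ig tr0.
pose phi (y : Rn R n.+1) := (`|f y| `^ p)%:E.
have phi0 y : (0 <= phi y)%E by rewrite lee_fin powR_ge0.
have mphi (A : set (Rn R n.+1)) : measurable_fun A phi by exact: measurable_powR_abs.
pose Z : set (Rn R n.+1) := [set y | (edist_inf S y <= 0)%E].
have mZ : measurable Z.
  have := emeasurable_fun_infty_c measurableT (@measurable_edist_inf R n S setT) 0%E.
  by rewrite setTI.
have LZ : L Z = 0%E.
  apply/eqP; rewrite eq_le measure_ge0 andbT -(dset_null d0 C1 HS dn).
  by apply: lebn_mono => y /= y0; exact: edist_inf_closed.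
(* A measurable majorant [G] of the integrand: infinite on [S], given by the
   bounded weight far away, and by the weight of the layer in between. *)
pose Gz : Rn R n.+1 -> \bar R := cst +oo%E \_ Z.
pose Gp i l : Rn R n.+1 -> \bar R := (fun y => (mesh i `^ (- (s * p)))%:E * phi y)%E \_ (piece i l).
pose G y := (Gz y + (c%:E * phi y + \sum_(i <oo) \sum_(l <oo) Gp i l y))%E.
have cphi0 y : (0 <= c%:E * phi y)%E by apply: mule_ge0 => //; rewrite lee_fin ltW.
have Gz0 y : (0 <= Gz y)%E by rewrite /Gz patchE; case: ifP => //= _; rewrite leey.
have mphi0 i y : (0 <= (mesh i `^ (- (s * p)))%:E * phi y)%E.
  by apply: mule_ge0 => //; rewrite lee_fin powR_ge0.
have Gp0 i l y : (0 <= Gp i l y)%E by rewrite /Gp patchE; case: ifP => // _; exact: mphi0.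
have Gs0 i y : (0 <= \sum_(l <oo) Gp i l y)%E by apply: nneseries_ge0 => l _ _; exact: Gp0.
have Gt0 y : (0 <= \sum_(i <oo) \sum_(l <oo) Gp i l y)%E by apply: nneseries_ge0 => i _ _; exact: Gs0.
have mGz : measurable_fun [set: Rn R n.+1] Gz.
  by apply/(measurable_restrictT _ mZ); exact: measurable_cst.
have mGp i l : measurable_fun [set: Rn R n.+1] (Gp i l).
  apply/(measurable_restrictT _ (measurable_piece i l)).
  by apply: emeasurable_funM; [exact: measurable_cst|exact: mphi].
have mGs i : measurable_fun [set: Rn R n.+1] (fun y => \sum_(l <oo) Gp i l y)%E.
  by apply: (ge0_emeasurable_sum (P := xpredT)) => [l y _ _|l _]; [exact: Gp0|exact: mGp].
have mGt : measurable_fun [set: Rn R n.+1] (fun y => \sum_(i <oo) \sum_(l <oo) Gp i l y)%E.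
  by apply: (ge0_emeasurable_sum (P := xpredT)) => [i y _ _|i _]; [exact: Gs0|exact: mGs].
have mcphi : measurable_fun [set: Rn R n.+1] (fun y => c%:E * phi y)%E.
  by apply: emeasurable_funM; [exact: measurable_cst|exact: mphi].
have w0 y : (0 <= (edist_inf S y `^ (s * p))^-1)%E by rewrite inve_ge0 poweR_ge0.
apply: (@le_trans _ _ (\int[L]_y G y)%E).
  apply: ge0_le_integral_of_le => [y|y _]; first exact: mule_ge0.
  rewrite /G; have [yZ|/negP] := boolP (edist_inf S y <= 0)%E.
    rewrite /Gz patchE mem_set//= addye ?leey//.
    by rewrite -ltNye (lt_le_trans (ltNyr 0))// adde_ge0.
  move/negP; rewrite -ltNge => yS.
  apply: (le_trans _ (leeDr _ (Gz0 y))).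
  have [yfar|ynear] := leP (32^-1)%:E (edist_inf S y).
    apply: (le_trans _ (leeDl _ (Gt0 y))); rewrite muleC.
    by apply: lee_wpmul2r; [exact: phi0|exact: inv_poweR_le].
  apply: (le_trans _ (leeDr _ (cphi0 y))).
  have h0 : 0 < 64^-1 :> R by [].
  have h1 : (edist_inf S y < (2 * 64^-1)%:E)%E.
    by rewrite (_ : 2 * 64^-1 = 32^-1)//; field.
  have [i yi] := layer_exists h0 yS h1.
  apply: (le_trans _ (nneseries_ge_term i (fun i' => Gs0 i' y))).
  apply: (le_trans _ (nneseries_ge_term (grid_index (mesh i) y) (fun l => Gp0 i l y))).
  rewrite /Gp patchE mem_set; last by split.
  rewrite muleC; apply: lee_wpmul2r; first exact: phi0.
  by apply: inv_poweR_le => //; case: yi.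
rewrite ge0_integralD; [|exact: measurableT|by move=> y _; exact: Gz0|exact: mGz|
  by move=> y _; exact: adde_ge0|by apply: emeasurable_funD; [exact: mcphi|exact: mGt]].
have -> : (\int[L]_y Gz y)%E = 0%E.
  by rewrite -integral_mkcond (integral_cst L mZ) LZ mule0.
rewrite add0e ge0_integralD; [|exact: measurableT|by move=> y _; exact: cphi0|exact: mcphi|
  by move=> y _; exact: Gt0|exact: mGt].
rewrite ge0_integralZl; [|exact: measurableT|exact: mphi|by move=> y _; exact: phi0|by rewrite lee_fin ltW].
have If0 : (0 <= \int[L]_y (`|f y| `^ p)%:E)%E by apply: integral_ge0 => y _; exact: phi0.
have Ig0 : (0 <= \int[L]_y (g y `^ p))%E by apply: integral_ge0 => y _; exact: poweR_ge0.
rewrite [in leRHS]ge0_muleDr//; apply: leeD.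
  by apply: lee_wpmul2r => //; rewrite lee_fin lerDl ltW.
apply: (@le_trans _ _ (K%:E * \int[L]_y (g y `^ p))%E); last first.
  by apply: lee_wpmul2r => //; rewrite lee_fin lerDr ltW.
apply: le_trans Hl.
rewrite (integral_nneseries L measurableT mGs (fun i y _ => Gs0 i y)).
apply: lee_nneseries => [i _ _|i _]; first by apply: integral_ge0 => y _; exact: Gs0.
rewrite (integral_nneseries L measurableT (mGp i) (fun l y _ => Gp0 i l y)).
apply: lee_nneseries => [l _ _|l _]; first by apply: integral_ge0 => y _; exact: Gp0.
rewrite -integral_mkcond ge0_integralZl; [by []|exact: measurable_piece|exact: mphi|
  by move=> y _; exact: phi0|by rewrite lee_fin powR_ge0].
Qed.

End assembly.

(** * The Hardy inequality *)

Lemma in_Lp_Lmeasurable (R : realType) (n : nat) (p : R) (f : 'rV[R]_n.+1 -> R) :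
  in_Lp p (EFin \o f) -> Lmeasurable f.
Proof. by move=> [mf _]; apply/measurable_EFinP. Qed.

(** On a cube, [`|f| <= 1 + `|f| `^ p] is integrable. *)
Lemma in_Lp_Lintegrable (R : realType) (n : nat) (p : R) (f : 'rV[R]_n.+1 -> R) :
  1 <= p -> in_Lp p (EFin \o f) -> Lintegrable f.
Proof.
move=> p1 fp; have mf := in_Lp_Lmeasurable fp.
have p0 : p != 0 by rewrite gt_eqF// (lt_le_trans ltr01).
move: fp => [_ fp] x r.
have mc : measurable (cube x r : set (Rn R n.+1)) by exact: measurable_cube.
have mp : measurable_fun (cube x r : set (Rn R n.+1)) (fun y : Rn R n.+1 => (`|f y| `^ p)%:E).
  exact: measurable_powR_abs.
apply/integrableP; split.
  by apply/measurable_EFinP; exact: (measurable_funS measurableT (@subsetT _ _) mf).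
apply: (@le_lt_trans _ _ (\int[lebn R n.+1]_(y in cube x r) (1 + (`|f y| `^ p)%:E))%E).
  apply: ge0_le_integral_of_le => [y|y _]; first exact: abse_ge0.
  rewrite /= -EFinD lee_fin; have [f1|f1] := leP `|f y| 1.
    by rewrite (le_trans f1)// lerDl powR_ge0.
  apply: (@le_trans _ _ (`|f y| `^ p)); last by rewrite lerDr.
  by rewrite -[leLHS]powRr1// ler_powR// ltW.
rewrite ge0_integralD; [|exact: mc|by []|exact: measurable_cst| |exact: mp]; last first.
  by move=> y _; rewrite lee_fin powR_ge0.
apply: lte_add_pinfty.
  rewrite (integral_cst _ mc 1%E) mul1e.
  have sub : cube x r `<=` cube x `|r|.
    by move=> y yx i; apply: le_trans (yx i) (ler_norm _).
  by apply: le_lt_trans (lebn_mono sub) _; rewrite lebn_cube// ltry.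
apply: (@le_lt_trans _ _ (\int[lebn R n.+1]_y (`|f y| `^ p)%:E)%E).
  apply: ge0_subset_integral; [exact: mc|exact: measurableT| | |by []].
    exact: measurable_powR_abs.
  by move=> y _; rewrite lee_fin powR_ge0.
have := poweR_Lnorm (lebn R n.+1) (EFin \o f) p0.
by rewrite /= => <-; exact: poweR_lty.
Qed.

Theorem theorem3p7 (R : realType) (n : nat) (d p s : R) (k : nat)
    (S : set 'rV[R]_n) :
  (2 <= n)%N -> n%:R - 1 < d -> d < n%:R -> d_set d S ->
  1 < p -> (n%:R - d) / p < s -> s < k%:R ->
  exists2 c : R, 0 < c &
    forall (q : \bar R) (u : R), (1 <= q)%E -> 1 <= u -> u <= p ->
      (u%:E <= q)%E ->
    forall f : 'rV[R]_n -> R, in_TL s p q k u f ->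
      hausdorff_ae d S (fun x => trace_defined f x /\ trace f x = 0) ->
      ((\int[lebn R n]_x ((`|f x| `^ p)%:E * (edist_inf S x `^ (s * p))^-1))
         `^ p^-1 <= c%:E * TL_norm s p q k u f)%E.
Proof.
case: n S => [//|n] S _ nd dn [_ cS [C C1 HS]] p1 ps _.
have p0 : 0 < p by exact: lt_trans ltr01 p1.
have pV0 : 0 <= p^-1 by rewrite invr_ge0 ltW.
have s0 : 0 < s by apply: lt_trans ps; rewrite divr_gt0// subr_gt0.
have nd' : n%:R < d by rewrite -natr1 addrK in nd.
have [K0 K00 HK0] := @TL_function_controls R n k s s0.
have [K Kp HK] := hardy_estimate k nd' dn C1 HS p1 ps cS K00.
exists ((K * 2) `^ p^-1); first by rewrite powR_gt0// mulr_gt0.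
move=> q u q1 u1 _ _ f [fp gp] tr0.
have p0' : p != 0 by rewrite gt_eqF.
set g := TL_function s q k u f in gp *.
have g0 y : (0 <= g y)%E by exact: TL_function_ge0.
have mf := in_Lp_Lmeasurable fp.
have If := in_Lp_Lintegrable (ltW p1) fp.
set a := 'N[lebn R n.+1]_p%:E [EFin \o f]%E.
set b := 'N[lebn R n.+1]_p%:E [g]%E.
have aE : (\int[lebn R n.+1]_y (`|f y| `^ p)%:E = a `^ p)%E.
  by rewrite (poweR_Lnorm (lebn R n.+1) (EFin \o f) p0').
have bE : (\int[lebn R n.+1]_y (g y `^ p) = b `^ p)%E.
  rewrite (poweR_Lnorm (lebn R n.+1) g p0'); apply: eq_integral => y _.
  by rewrite gee0_abs.
have Ig : (\int[lebn R n.+1]_y (g y `^ p) < +oo)%E.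
  by rewrite bE; apply: poweR_lty; exact: gp.2.
have := HK f g mf If gp.1 g0 (HK0 q u f mf q1 u1) Ig tr0.
rewrite aE bE => HF.
have a0 : (0 <= a)%E by exact: Lnorm_ge0.
have b0 : (0 <= b)%E by exact: Lnorm_ge0.
have F0 : (0 <= \int[lebn R n.+1]_x ((`|f x| `^ p)%:E * (edist_inf S x `^ (s * p))^-1))%E.
  by apply: integral_ge0 => x _; apply: mule_ge0; rewrite ?lee_fin ?powR_ge0// inve_ge0 poweR_ge0.
apply: (@le_trans _ _ (((K * 2)%:E * (a + b) `^ p) `^ p^-1)%E).
  apply: le_poweR => //; apply: (le_trans HF); rewrite EFinM -muleA.
  apply: lee_wpmul2l; first by rewrite lee_fin ltW.
  rewrite mule_natl mule2n; apply: leeD; apply: le_poweR => //; rewrite ?(ltW p0)//.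
    by rewrite leeDl.
  by rewrite leeDr.
rewrite poweRM ?poweR_ge0 ?lee_fin ?mulr_ge0 ?(ltW Kp)//.
by rewrite -poweRrM divff// poweRe1 ?adde_ge0.
Qed.
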